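(* Let $d\ge1$ be an integer, $d+1<\alpha<d+2$, $1\le p,q\le\infty$, and suppose that $K_\alpha:L^p\to L^q$ is bounded. Then $$\|K_\alpha\|_{L^p\to L^q}\le\frac{\Gamma(d+1)^{1+\frac1q-\frac1p}\,\Gamma(\alpha-(d+1))\,\Gamma\!\left(\frac{1}{q^{-1}-p^{-1}}(d+1-\alpha)+1\right)^{\frac1q-\frac1p}}{\Gamma\!\left(\frac{\alpha}{2}\right)^2\,\Gamma\!\left(\frac{1}{q^{-1}-p^{-1}}(d+1-\alpha)+d+1\right)^{\frac1q-\frac1p}}.$$
   Context: $\mathbb{B}^d$ is the open unit ball of $\mathbb{C}^d$ with Lebesgue measure $dv$ normalized so that $v(\mathbb{B}^d)=1$; $\langle z,w\rangle=\sum_j z_j\overline{w_j}$; $L^p=L^p(\mathbb{B}^d,dv)$. For $\alpha\in\mathbb{R}$ and $f\in L^1(\mathbb{B}^d,dv)$, $$K_\alpha f(z)=\int_{\mathbb{B}^d}\frac{f(w)}{(1-\langle z,w\rangle)^\alpha}\,dv(w),\qquad z\in\mathbb{B}^d$$ (principal branch of the power). $\Gamma$ is the Gamma function, $\|T\|_{L^p\to L^q}$ is the operator norm, and $1/\infty=0$. *)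

(* Defs.v *)
From HB Require Import structures.
From mathcomp Require Import all_boot all_order all_algebra.
From mathcomp Require Import all_classical all_reals all_analysis.
From mathcomp Require Import measurable_realfun complex.
From mathcomp Require Import ring lra.

Set Implicit Arguments.
Unset Strict Implicit.
Unset Printing Implicit Defensive.
Import Order.TTheory GRing.Theory Num.Theory.
Import numFieldNormedType.Exports.
Import Normc.

Local Open Scope classical_set_scope.
Local Open Scope ring_scope.
Local Open Scope complex_scope.

(** The Borel sigma-algebra of [R[i]] is that of [R * R], transported along
    [z |-> (Re z, Im z)]. *)
HB.instance Definition _ (R : realType) := isPointed.Build R[i] 0.

Definition complex_pair {R : realType} (z : R[i]) :
    measurableTypeR R * measurableTypeR R :=
  (complex.Re z, complex.Im z).

Definition pair_complex {R : realType}
    (x : measurableTypeR R * measurableTypeR R) : R[i] :=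
  x.1 +i* x.2.

HB.instance Definition _ (R : realType) :=
  Measurable.copy R[i] (g_sigma_algebra_preimageType (@complex_pair R)).

Lemma measurable_complex_pair (R : realType) :
  measurable_fun [set: R[i]] (@complex_pair R).
Proof. by move=> _ Y mY; exists Y. Qed.

Lemma pair_complexK (R : realType) : cancel (@pair_complex R) complex_pair.
Proof. by case. Qed.

Lemma measurable_pair_complex (R : realType) :
  measurable_fun [set: measurableTypeR R * measurableTypeR R] (@pair_complex R).
Proof.
move=> _ _ [B mB <-]; rewrite !setTI.
by rewrite (_ : _ @^-1` _ = B)//; apply/seteqP; split=> -[].
Qed.

(* Proved inside [lebesgue_integral_fubini], but the corresponding canonical
   structure is shadowed there by the one for subprobabilities. *)
Lemma sigma_finite_product_measure1 d1 d2 (T1 : measurableType d1)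
    (T2 : measurableType d2) (R : realType)
    (m1 : {sigma_finite_measure set T1 -> \bar R})
    (m2 : {sigma_finite_measure set T2 -> \bar R}) :
  sigma_finite setT (m1 \x m2)%E.
Proof.
have /sigma_finiteP[F [TF ndF Foo]] := sigma_finiteT m1.
have /sigma_finiteP[G [TG ndG Goo]] := sigma_finiteT m2.
exists (fun n => F n `*` G n).
  rewrite -setXTT TF TG predeqE => -[x y]; split.
    move=> [/= [n _ Fnx] [k _ Gky]]; exists (maxn n k) => //; split.
    - by move: x Fnx; exact/subsetPset/ndF/leq_maxl.
    - by move: y Gky; exact/subsetPset/ndG/leq_maxr.
  by move=> [n _ []/= ? ?]; split; exists n.
move=> k; have [? ?] := Foo k; have [? ?] := Goo k.
split; first exact: measurableX.
by rewrite product_measure1E// lte_mul_pinfty// ge0_fin_numE.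
Qed.

Section pushforward_retract.
Context d d' (T : measurableType d) (T' : measurableType d') (R : realType).
Variables (mu : {measure set T -> \bar R}).
Hypothesis mu_sigma_finite : sigma_finite [set: T] mu.
Variables (f : T -> T') (g : T' -> T).
Hypotheses (mf : measurable_fun [set: T] f) (mg : measurable_fun [set: T'] g).
Hypothesis fK : cancel f g.

Let nu := pushforward mu f.

Let nu0 : nu set0 = 0%E. Proof. exact: measure0. Qed.
Let nu_ge0 A : (0 <= nu A)%E. Proof. exact: measure_ge0. Qed.
Let nu_sigma_additive : semi_sigma_additive nu.
Proof. exact: measure_semi_sigma_additive. Qed.

HB.instance Definition _ := isMeasure.Build _ _ _ nu
  nu0 nu_ge0 nu_sigma_additive.

Let nu_sigma_finite : sigma_finite [set: T'] nu.
Proof.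
have [F FT Fmu] := mu_sigma_finite.
exists (fun k => g @^-1` F k) => [|k].
  by rewrite -preimage_bigcup -FT preimage_setT.
have [mF Foo] := Fmu k; split; first by rewrite -[X in measurable X]setTI; exact: mg.
rewrite /nu /pushforward -comp_preimage (_ : g \o f = id)//.
by apply/funext => x /=; rewrite fK.
Qed.

HB.instance Definition _ := Measure_isSigmaFinite.Build _ _ _ nu nu_sigma_finite.

(** The pushforward of a sigma-finite measure by a map with a measurable left
    inverse, bundled as a sigma-finite measure. *)
Definition sfpushforward : {sigma_finite_measure set T' -> \bar R} := nu.

End pushforward_retract.

Definition lebesgue_C {R : realType} : {sigma_finite_measure set R[i] -> \bar R} :=
  sfpushforward (sigma_finite_product_measure1 lebesgue_measure lebesgue_measure)
    (@measurable_pair_complex R) (@measurable_complex_pair R) (@pair_complexK R).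

Section tuple_power.
Context d (T : measurableType d) (R : realType).
Variable mu : {sigma_finite_measure set T -> \bar R}.

Definition tcons n (x : T * n.-tuple T) : n.+1.-tuple T := [tuple of x.1 :: x.2].

Definition tuncons n (x : n.+1.-tuple T) : T * n.-tuple T :=
  (thead x, [tuple of behead x]).

Lemma measurable_tcons n : measurable_fun [set: T * n.-tuple T] (@tcons n).
Proof. exact: measurable_cons. Qed.

Lemma measurable_tuncons n : measurable_fun [set: n.+1.-tuple T] (@tuncons n).
Proof.
by apply: measurable_fun_pair; [exact: measurable_tnth|exact: measurable_behead].
Qed.

Lemma tconsK n : cancel (@tcons n) (@tuncons n).
Proof. by move=> [x t]; congr pair; apply/val_inj. Qed.

(** The [n]-fold product measure [mu \x ... \x mu] on [n]-tuples. *)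
Fixpoint tuple_power n : {sigma_finite_measure set (n.-tuple T) -> \bar R} :=
  if n is n'.+1 then
    sfpushforward (sigma_finite_product_measure1 mu (tuple_power n'))
      (@measurable_tcons n') (@measurable_tuncons n') (@tconsK n')
  else \d_[tuple].

End tuple_power.

Definition tbox T n (A : set T) : set (n.-tuple T) :=
  [set t | forall i, A (tnth t i)].

Lemma measurable_tbox d (T : measurableType d) n (A : set T) :
  measurable A -> measurable (@tbox T n A).
Proof.
move=> mA; rewrite (_ : tbox A = \bigcap_(i in [set: 'I_n]) ((@tnth n T)^~ i @^-1` A)).
  apply: fin_bigcap_measurable => // i _.
  by rewrite -[X in measurable X]setTI; exact: measurable_tnth.
by apply/seteqP; split=> [t h i _|t h i]; exact: h.
Qed.

Lemma tuple_power_tbox d (T : measurableType d) (R : realType)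
    (mu : {sigma_finite_measure set T -> \bar R}) n (A : set T) :
  measurable A -> (tuple_power mu n (tbox A) = mu A ^+ n)%E.
Proof.
move=> mA; elim: n => [|n IH].
  by rewrite /= diracE mem_set// => -[].
rewrite /= /pushforward (_ : _ @^-1` _ = A `*` tbox A).
  rewrite product_measure1E//; last exact: measurable_tbox.
  rewrite [X in (_ * X)%E]IH; exact/esym/expeS.
apply/seteqP; split=> [[x t] h|[x t] [/= Ax At] i].
  split=> [|i]; first exact: (h ord0).
  by have := h (lift ord0 i); rewrite /tcons tnthS.
case: (unliftP ord0 i) => [j ->|->//].
by rewrite /tcons tnthS.
Qed.

(** [z ^ a] for the principal branch, with argument in [(-pi, pi]]. *)
Definition carg {R : realType} (z : R[i]) : R :=
  if 0 <= complex.Im z then acos (complex.Re z / normc z)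
  else - acos (complex.Re z / normc z).

Definition cpow {R : realType} (z : R[i]) (a : R) : R[i] :=
  (normc z `^ a)%:C * (cos (a * carg z) +i* sin (a * carg z)).

(** Euler's integral, which is the Gamma function for [0 < x] only. When
    [d + 1 < alpha < d + 2] and [Kop alpha] is bounded from [L^p] to [L^q],
    then [1/q - 1/p > alpha - (d + 1)], so that every argument of Gamma in the
    norm estimate is positive. *)
Definition Gamma {R : realType} (x : R) : R :=
  \int[lebesgue_measure]_(t in `]0, +oo[%classic) (t `^ (x - 1) * expR (- t)).

Section Lp.
Context d (T : measurableType d) (R : realType).
Variable mu : {measure set T -> \bar R}.

Definition cintegral (f : T -> R[i]) : R[i] :=
  (\int[mu]_x complex.Re (f x)) +i* (\int[mu]_x complex.Im (f x)).

Definition cLnorm (p : \bar R) (f : T -> R[i]) : \bar R :=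
  ('N[mu]_p [EFin \o (@normc R \o f)])%E.

Definition cLfun (p : \bar R) : set (T -> R[i]) :=
  [set f | measurable_fun [set: T] f /\ (cLnorm p f < +oo)%E].

Definition bounded_operator (p q : \bar R) (K : (T -> R[i]) -> (T -> R[i])) :=
  exists C : R, forall f, cLfun p f ->
    cLfun q (K f) /\ (cLnorm q (K f) <= C%:E * cLnorm p f)%E.

Definition operator_norm (p q : \bar R) (K : (T -> R[i]) -> (T -> R[i])) :
    \bar R :=
  ereal_sup [set cLnorm q (K f) | f in [set f | cLfun p f /\ (cLnorm p f <= 1)%E]].

End Lp.

Section ball.
Context (R : realType) (d : nat).
Implicit Types z w : d.-tuple R[i].

Definition hdot z w : R[i] := \sum_(j < d) tnth z j * conjc (tnth w j).

Definition cball : set (d.-tuple R[i]) :=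
  [set z | \sum_(j < d) normc (tnth z j) ^+ 2 < 1].

Lemma measurable_normc : measurable_fun [set: R[i]] (@normc R).
Proof.
rewrite (_ : @normc R =
  (fun x => Num.sqrt (x.1 ^+ 2 + x.2 ^+ 2)) \o complex_pair); last first.
  by apply/funext => -[].
apply: measurableT_comp (@measurable_complex_pair R).
apply: (@measurableT_comp _ _ _ _ _ _ (@Num.sqrt R)).
  by apply: continuous_measurable_fun; exact: sqrt_continuous.
by apply: measurable_funD; apply: measurable_funX.
Qed.

Lemma measurable_cball : measurable cball.
Proof.
have -> : cball =
    [set: _] `&` (fun z => \sum_(j < d) normc (tnth z j) ^+ 2 < 1) @^-1` [set true].
  by rewrite setTI.
apply: (@measurable_fun_ltr _ _ _ setT _ (cst 1)) => //.
apply: measurable_sum => j; apply: measurable_funX.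
exact: measurableT_comp measurable_normc (measurable_tnth j).
Qed.

Definition ball_volume : R := fine (tuple_power lebesgue_C d cball).

Lemma ball_volume_inv_ge0 : 0 <= ball_volume^-1.
Proof. by rewrite invr_ge0 fine_ge0. Qed.

(** Normalized Lebesgue measure on the ball, as a measure on the ambient space
    that vanishes off the ball. *)
Definition ball_measure : {measure set (d.-tuple R[i]) -> \bar R} :=
  mscale (NngNum ball_volume_inv_ge0)
    (mrestr (tuple_power lebesgue_C d) measurable_cball).

(** Functions on the ball are represented by functions on the ambient space;
    their values off the ball are irrelevant, since [ball_measure] ignores
    them. *)
Definition Kop (alpha : R) (f : d.-tuple R[i] -> R[i]) (z : d.-tuple R[i]) :
    R[i] :=
  if z \in cball then
    cintegral ball_measure (fun w => f w / cpow (1 - hdot z w) alpha)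
  else 0.

End ball.

Arguments cball : clear implicits.
Arguments ball_volume : clear implicits.
Arguments ball_measure : clear implicits.

Section ball_normalization.
Variable R : realType.

Definition square (r : R) : set R[i] :=
  [set z | (`|complex.Re z| < r) && (`|complex.Im z| < r)].

Lemma squareE r : square r = complex_pair @^-1` (`]-r, r[ `*` `]-r, r[).
Proof.
apply/seteqP; split=> -[x y] /=; rewrite !in_itv/= -!ltr_norml.
  by move=> /andP[].
by move=> [? ?]; apply/andP.
Qed.

Lemma measurable_square r : measurable (square r).
Proof.
rewrite squareE -[X in measurable X]setTI; apply: measurable_complex_pair => //.
by apply: measurableX; exact: measurable_itv.
Qed.

Lemma lebesgue_C_square r : 0 < r -> lebesgue_C (square r) = ((2 * r) ^+ 2)%:E.
Proof.
move=> r0; rewrite /= /pushforward squareE -comp_preimage.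
rewrite (_ : complex_pair \o pair_complex = id); last first.
  by apply/funext => x /=; rewrite pair_complexK.
rewrite preimage_id product_measure1E; [|exact: measurable_itv..].
rewrite /= lebesgue_measure_itv/= lte_fin gtrN// -EFinD -EFinM; congr EFin; ring.
Qed.

Lemma normcE (z : R[i]) : normc z ^+ 2 = complex.Re z ^+ 2 + complex.Im z ^+ 2.
Proof. by case: z => x y; rewrite /= sqr_sqrtr// addr_ge0 ?sqr_ge0. Qed.

Lemma ball_vol d : exists v : R, 0 < v /\ tuple_power lebesgue_C d (cball R d) = v%:E.
Proof.
have mB := @measurable_cball R d.
set r : R := (2 * d.+1%:R)^-1.
have r0 : 0 < r by rewrite invr_gt0 mulr_gt0.
have lo : ((((2 * r) ^+ 2) ^+ d)%:E <= tuple_power lebesgue_C d (cball R d))%E.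
  rewrite EFin_expe -lebesgue_C_square// -tuple_power_tbox; last exact: measurable_square.
  apply: le_measure; rewrite ?inE//; first by apply: measurable_tbox; exact: measurable_square.
  move=> z hz; rewrite /cball /=.
  apply: (@le_lt_trans _ _ (\sum_(j < d) (2 * r ^+ 2))).
    apply: ler_sum => j _; rewrite normcE mulr2n mulrDl mul1r.
    have /andP[a b] := hz j.
    by apply: lerD; rewrite -real_normK ?num_real// lerXn2r ?nnegrE// ltW.
  rewrite sumr_const card_ord -(mulr_natl _ d) /r -[d.+1%:R]natr1.
  have d0 : 0 <= d%:R :> R by [].
  move: (d%:R : R) d0 => x x0.
  rewrite (_ : _ * _ = x / (2 * (x + 1) ^+ 2)); last by field; lra.
  by rewrite ltr_pdivrMr; nra.
have hi : (tuple_power lebesgue_C d (cball R d) <= (((2 * 1) ^+ 2) ^+ d)%:E)%E.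
  rewrite EFin_expe -lebesgue_C_square// -tuple_power_tbox; last exact: measurable_square.
  apply: le_measure; rewrite ?inE//; first by apply: measurable_tbox; exact: measurable_square.
  move=> z hz j; rewrite /square/=.
  have : normc (tnth z j) ^+ 2 < 1.
    apply: le_lt_trans hz; rewrite (bigD1 j)//= lerDl.
    by apply: sumr_ge0 => i _; exact: sqr_ge0.
  rewrite normcE => h.
  by apply/andP; split; rewrite -[X in _ < X]expr1 -(@ltr_pXn2r _ 2)// ?nnegrE// expr1 expr1n real_normK ?num_real//;
    apply: le_lt_trans h; rewrite ?lerDl ?lerDr sqr_ge0.
have fin : tuple_power lebesgue_C d (cball R d) \is a fin_num.
  by rewrite ge0_fin_numE// (le_lt_trans hi)// ltry.
exists (ball_volume R d); rewrite /ball_volume fineK//; split => //.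
rewrite -lte_fin fineK//; apply: lt_le_trans lo.
by rewrite lte_fin !exprn_gt0// mulr_gt0.
Qed.

Lemma ball_measure_setT d : ball_measure R d setT = 1%E.
Proof.
have [v [v0 vE]] := ball_vol d.
rewrite /= /mscale/= /mrestr setTI /ball_volume.
by rewrite [X in (_ * X)%E]vE vE /= -EFinM mulVf// gt_eqF.
Qed.
End ball_normalization.

(** The reciprocal of an exponent in [[1, +oo]], with [recip +oo = 0]. *)
Definition recip {R : realType} (p : \bar R) : R := fine p^-1%E.

(* Main.v *)
(** Let [c = alpha - (d + 1)], [x = 1/p], [y = 1/q] and [s = y - x].

    Upper bound, when [s > c]. Expanding [(1 - u)^(-alpha/2)] and using the monomial moments of the ball
    (from Gaussian moments) together with the log-convexity of Gamma gives the sharp Forelli-Rudin bound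
    [\int |1 - <z,w>|^(-alpha) dw <= C (1 - |z|^2)^(-c)] with
    [C = Gamma(d+1) Gamma(c) / Gamma(alpha/2)^2]. Interpolating by Young's inequality between the two
    marginals of the kernel yields the norm bound [C H], where
    [H = (\int (1 - |z|^2)^(-c/s) dz)^s] is explicit.

    Boundedness forces [s > c]. Otherwise pick [x0 <= x] with [y <= x0 + c <= 1]. On the shells
    [1 - |w|^2 ~ 2^-n], [n < N], multiply the weight [(1 - |w|^2)^(-x0)] by Riesz products built on all
    monomials of degree [2^n]. Their moduli stay bounded, while on average over the signs their images
    under [K_alpha] are of size [(1 - |z|^2)^(-(x0 + c))] on every shell: the correlation with the signs
    isolates the Taylor coefficient of degree [2^n] of the kernel. As the mass of [1/(1 - |w|^2)] on the
    shells is at least a multiple of [N], letting [N] grow contradicts boundedness. *)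

Require Import Defs.
From HB Require Import structures.
From mathcomp Require Import all_boot all_order all_algebra.
From mathcomp Require Import all_classical all_reals all_analysis.
From mathcomp Require Import measurable_realfun ess_sup_inf complex.
From mathcomp Require Import cyclic separable cyclotomic.
From mathcomp Require Import ring lra.

Set Implicit Arguments.
Unset Strict Implicit.
Unset Printing Implicit Defensive.
Import Order.TTheory GRing.Theory Num.Theory.
Import numFieldNormedType.Exports.
Import Normc.

Local Open Scope classical_set_scope.
Local Open Scope ring_scope.

(** * Integrals on the line *)

(** The kernel is antiholomorphic in [w], so [K_alpha] sends every radial function to a constant:
    cancellation hides the size of the kernel from simple test functions. A test function that
    detects it must oscillate in step with the kernel for all points [z] at once. Random signs on
    all monomials do this, and the Riesz product keeps the modulus bounded for every choice of
    signs, which a plain random sum need not do; this matters because [p] may be infinite. No polar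
    coordinates are used. Circle averages become averages over roots of unity, which are exact on
    polynomials of small degree, and the radial integral over the ball is recovered from a Gaussian
    integral by a Laplace transform in the squared radius. The unit ball of [L^p] is described
    throughout by [|f| <= u ^ (1/p)] with a density [u] of mass at most 1. This treats infinite
    exponents like finite ones, and pairing with a power [v ^ (1 - 1/q)] of a second density plays
    the role of duality. *)

Section line.
Context {R : realType}.
Notation leb := (@lebesgue_measure R).
Local Open Scope ereal_scope.
Local Notation D0 := (`]0%R, +oo[%classic : set R).

Let aff (a b : R) (x : measurableTypeR R) : measurableTypeR R := (a * x + b)%R.

Let maff a b : measurable_fun setT (aff a b).
Proof. by apply: measurable_funD => //; apply: measurable_funM. Qed.

(** It suffices to compare the two measures on half-open intervals, which determine Lebesgue
    measure. *)
Lemma lebesgue_measure_affine (a b : R) : a != 0%R -> forall A, measurable A ->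
  leb A = `|a|%:E * pushforward leb (aff a b) A.
Proof.
move=> a0.
have aN0 : (0 <= `|a|)%R by [].
pose k : {nonneg R} := NngNum aN0.
pose m : {measure set (measurableTypeR R) -> \bar R} :=
  measure_function_pushforward__canonical__measure_function_Measure leb (maff a b).
pose m' : {measure set (measurableTypeR R) -> \bar R} := mscale k m.
suff H : forall X, ocitv X -> leb X = m' X.
  by move=> A mA; exact: (lebesgue_measure_unique H mA).
move=> _ [[u v]] _ <-.
rewrite /m'/= /mscale/= /m/= /pushforward.
have [ap|an] : (0 < a)%R \/ (a < 0)%R by case: (ltgtP a 0%R) a0 => // *; [right|left].
- have -> : aff a b @^-1` `]u, v] = `]((u - b) / a)%R, ((v - b) / a)%R]%classic.
    apply/seteqP; split => x /=; rewrite !in_itv/= /aff ltr_pdivrMr// ler_pdivlMr//;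
    by rewrite ltrBlDr lerBrDr (mulrC x).
  rewrite !lebesgue_measure_itv/= !lte_fin ltr_pM2r ?invr_gt0// ltrD2r gtr0_norm//.
  case: ifPn => _; last by rewrite mule0.
  by rewrite -!EFinD -EFinM; congr EFin; field.
(* A negative slope moves the closed end of the interval to the other side, without changing its
   length. *)
- have -> : aff a b @^-1` `]u, v] = `[((v - b) / a)%R, ((u - b) / a)%R[%classic.
    apply/seteqP; split => x /=; rewrite !in_itv/= /aff ler_ndivrMr// ltr_ndivlMr//;
    by rewrite ltrBlDr lerBrDr (mulrC x) andbC.
  rewrite !lebesgue_measure_itv/= !lte_fin ltr_nM2r ?invr_lt0// ltrD2r ltr0_norm//.
  case: ifPn => _; last by rewrite mule0.
  by rewrite -!EFinD -EFinM; congr EFin; field.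
Qed.

Lemma integral_affine (a b : R) (f : R -> \bar R) : a != 0%R ->
  measurable_fun setT f -> (forall x, 0 <= f x) ->
  \int[leb]_x f x = `|a|%:E * \int[leb]_x f (a * x + b)%R.
Proof.
move=> a0 mf f0.
have aN0 : (0 <= `|a|)%R by [].
pose m : {measure set (measurableTypeR R) -> \bar R} :=
  measure_function_pushforward__canonical__measure_function_Measure leb (maff a b).
rewrite (@eq_measure_integral _ _ _ _ (mscale (NngNum aN0) m)); last first.
  by move=> A mA _ /=; rewrite (lebesgue_measure_affine b a0).
rewrite ge0_integral_mscale//=; congr (_ * _).
rewrite /m/= ge0_integral_pushforward//=.
Qed.

Lemma integral_half_line_scale (a : R) (f : R -> \bar R) : (0 < a)%R ->
  measurable_fun (`]0%R, +oo[%classic : set R) f -> (forall x, (0 < x)%R -> 0 <= f x) ->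
  \int[leb]_(x in D0) f x = a%:E * \int[leb]_(x in D0) f (a * x)%R.
Proof.
move=> a0 mf f0.
have h0 x : 0 <= (f \_ (`]0%R, +oo[%classic : set R)) x.
  rewrite patchE; case: ifPn => //; rewrite inE/= in_itv/= andbT; exact: f0.
rewrite integral_mkcond (@integral_affine a 0%R)//=; last 2 first.
- exact: lt0r_neq0.
- exact: (measurable_restrictT f (measurable_itv _)).1 mf.
rewrite gtr0_norm// [in RHS]integral_mkcond; congr (_ * _).
apply: eq_integral => x _; rewrite !patchE addr0 !mem_setE !in_itv/= !andbT.
by rewrite pmulr_rgt0.
Qed.

End line.

Section tonelli_domain.
Context d1 d2 (T1 : measurableType d1) (T2 : measurableType d2) (R : realType).
Variable m1 : {sigma_finite_measure set T1 -> \bar R}.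
Variable m2 : {sigma_finite_measure set T2 -> \bar R}.
Local Open Scope ereal_scope.

(** Extension by 0 off the rectangle reduces this to Tonelli on the whole product. The typical
    rectangle below is a half line times a space. *)
Lemma tonelli_setX (A : set T1) (B : set T2) (f : T1 * T2 -> \bar R) :
  measurable A -> measurable B -> measurable_fun (A `*` B) f ->
  (forall x y, A x -> B y -> 0 <= f (x, y)) ->
  \int[m1]_(x in A) \int[m2]_(y in B) f (x, y) =
  \int[m2]_(y in B) \int[m1]_(x in A) f (x, y).
Proof.
move=> mA mB mf f0.
pose g := f \_ (A `*` B).
have g0 x : 0 <= g x.
  by case: x => x y; rewrite /g patchE; case: ifPn => //; rewrite inE/= => -[]; exact: f0.
have mg : measurable_fun setT g.
  exact: (measurable_restrictT f (measurableX mA mB)).1 mf.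
have := fubini_tonelli (m1 := m1) (m2 := m2) g mg g0.
have gE x y : g (x, y) = if (x \in A) && (y \in B) then f (x, y) else 0.
  by rewrite /g patchE in_setX.
move=> H.
transitivity (\int[m1]_x \int[m2]_y g (x, y)); last rewrite H.
- rewrite integral_mkcond; apply: eq_integral => x _; rewrite patchE; case: ifPn => xA.
    by rewrite integral_mkcond; apply: eq_integral => y _; rewrite patchE gE xA.
  by rewrite integral0_eq// => y _; rewrite gE (negbTE xA).
- rewrite [RHS]integral_mkcond; apply: eq_integral => y _; rewrite patchE; case: ifPn => yB.
    by rewrite [RHS]integral_mkcond; apply: eq_integral => x _; rewrite patchE gE yB andbT.
  by rewrite integral0_eq// => x _; rewrite gE (negbTE yB) andbF.
Qed.

Lemma measurable_tonelli_setX_G (A : set T1) (f : T1 * T2 -> \bar R) :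
  measurable A -> measurable_fun (A `*` setT) f ->
  (forall x y, A x -> 0 <= f (x, y)) ->
  measurable_fun setT (fun y => \int[m1]_(x in A) f (x, y)).
Proof.
move=> mA mf f0.
pose g := f \_ (A `*` setT).
have g0 x : 0 <= g x.
  by case: x => x y; rewrite /g patchE; case: ifPn => //; rewrite inE/= => -[/f0].
have mg : measurable_fun setT g.
  exact: (measurable_restrictT f (measurableX mA measurableT)).1 mf.
rewrite (_ : (fun y => _) = (fun y => \int[m1]_x g (x, y))).
  exact: measurable_fun_fubini_tonelli_G.
apply/funext => y; rewrite integral_mkcond; apply: eq_integral => x _.
by rewrite /g !patchE in_setX in_setT andbT.
Qed.

End tonelli_domain.

(** * The Gamma function *)

Section gamma.
Context {R : realType}.
Notation leb := (@lebesgue_measure R).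
Implicit Types x y t : R.
Local Notation D0 := (`]0%R, +oo[%classic : set R).
Local Notation D1 := (`[1%R, +oo[%classic : set R).

(** Extended-real Gamma: the functional equation is proved in [[0, +oo]] first and then serves to
    show finiteness. *)
Definition eGamma x : \bar R := (\int[leb]_(t in D0) (t `^ (x - 1) * expR (- t))%:E)%E.

Lemma measurable_gamma_integrand x l (D : set R) :
  measurable_fun D (fun t => (t `^ x * expR (- (l * t)))%:E).
Proof.
apply/measurable_EFinP; apply: measurable_funM.
  by apply: measurable_funTS; exact: measurable_powR.
apply: measurable_funTS; apply: measurableT_comp => //.
by apply: measurable_funN; exact: measurable_funM.
Qed.

Lemma measurable_gamma_integrand1 x (D : set R) :
  measurable_fun D (fun t => (t `^ x * expR (- t))%:E).
Proof.
have := @measurable_gamma_integrand x 1 D.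
by under eq_fun do rewrite mul1r.
Qed.

(** Laplace transform of a power. It is used with [l] as an integration variable in the functional
    equation, and with [l = 1 - x] in the binomial bound. *)
Lemma eGamma_scale x l : 0 < l ->
  (\int[leb]_(t in D0) (t `^ (x - 1) * expR (- (l * t)))%:E =
   (l `^ (- x))%:E * eGamma x)%E.
Proof.
move=> l0; rewrite /eGamma [in RHS](integral_half_line_scale l0); last 2 first.
- exact: measurable_gamma_integrand1.
- by move=> t _; rewrite lee_fin mulr_ge0 ?powR_ge0 ?expR_ge0.
rewrite muleA -EFinM.
under [in RHS]eq_integral => t.
  rewrite inE/= in_itv/= andbT => t0.
  rewrite powRM ?ltW// -mulrA EFinM; over.
rewrite ge0_integralZl_EFin ?powR_ge0//=; last 2 first.
- by move=> t _; rewrite lee_fin mulr_ge0 ?powR_ge0 ?expR_ge0.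
- exact: measurable_gamma_integrand.
rewrite muleA -EFinM -[X in (_ * X * _)%:E](@powRr1 _ l) ?ltW//.
have ln0 : l != 0 by rewrite gt_eqF.
rewrite -!powRD ?ln0 ?implybT//.
rewrite (_ : - x + 1 + (x - 1) = 0); last by ring.
by rewrite powRr0 mul1e.
Qed.

(** This lemma and the next write [1/x] and [expR (- t) / t] as integrals over [l >= 1]. Together
    with Tonelli they replace integration by parts, both for Gamma and for the Gaussian moments. *)
Lemma integral_powR_1y x : 0 < x ->
  (\int[leb]_(l in D1) (l `^ (- (x + 1)))%:E = (x^-1)%:E)%E.
Proof.
move=> x0.
have d (l : R) : 0 < l -> is_derive (l : R) 1 (fun l : R => - (x^-1 * l `^ (- x))) (l `^ (- (x + 1))).
  move=> l0; have := is_derive1_powR (- x) l0 => h.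
  have := is_deriveN (is_deriveZ x^-1 h); rewrite /GRing.scale/= => H.
  apply: is_derive_eq H _.
  rewrite opprD mulNr mulrN opprK mulrA mulVf ?mul1r// gt_eqF//.
rewrite (@ge0_continuous_FTC2y _ _ (fun l : R => - (x^-1 * l `^ (- x))) _ 0).
- by rewrite powR1 mulr1 EFinN oppeK add0e.
- by move=> l _; rewrite powR_ge0.
- apply: continuous_in_subspaceT => l; rewrite inE/= in_itv/= andbT => l1.
  have l0 : 0 < l by apply: lt_le_trans l1.
  by apply/differentiable_continuous/derivable1_diffP; apply: derivable_powR; rewrite in_itv/= l0.
- rewrite -oppr0; apply: cvgN; rewrite -(mulr0 x^-1); apply: cvgMr.
  apply/cvgrPdist_lt => e e0; near=> l.
  have el : (e^-1) `^ (x^-1) < l by near: l; exact: nbhs_pinfty_gt.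
  have l0 : 0 < l by apply: le_lt_trans el; exact: powR_ge0.
  rewrite sub0r normrN ger0_norm ?powR_ge0// powRN.
  rewrite invf_plt ?posrE ?powR_gt0//.
  have := gt0_ltr_powR x0 _ _ el.
  rewrite !nnegrE powR_ge0 ltW// => /(_ isT isT).
  by rewrite -powRrM mulVf ?gt_eqF// powRr1// invr_ge0 ltW.
- move=> l l1; have l0 : 0 < l by apply: lt_trans l1.
  by have [] := d _ l0.
- apply: cvg_at_right_filter.
  have [/derivable1_diffP/differentiable_continuous + _] := d _ ltr01; exact.
- move=> l; rewrite in_itv/= andbT => l1; have l0 : 0 < l by apply: lt_trans l1.
  by rewrite derive1E; have h := d _ l0; rewrite derive_val.
Unshelve. all: by end_near. Qed.

Lemma integral_expR_1y t : 0 < t ->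
  (\int[leb]_(l in D1) (expR (- (l * t)))%:E = (expR (- t) / t)%:E)%E.
Proof.
move=> t0.
have d (l : R) : is_derive l 1 (fun l : R => - (t^-1 * expR (- (l * t)))) (expR (- (l * t))).
  have h : is_derive l 1 (fun l : R => - (l * t)) (- t).
    by apply: is_derive_eq; rewrite scaler0 add0r /GRing.scale/= mulr1.
  have h2 := @is_derive1_comp _ expR (fun l : R => - (l * t)) l _ _ (is_derive_expR _) h.
  have := is_deriveN (is_deriveZ t^-1 h2); rewrite /GRing.scale/= => H.
  apply: is_derive_eq H _.
  by rewrite mulrN mulrN opprK mulrC -mulrA divff ?mulr1// gt_eqF.
rewrite (@ge0_continuous_FTC2y _ _ (fun l : R => - (t^-1 * expR (- (l * t)))) _ 0).
- by rewrite mul1r EFinN oppeK add0e mulrC.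
- by move=> l _; rewrite expR_ge0.
- apply: continuous_subspaceT => l.
  apply: continuous_comp; last exact: continuous_expR.
  by apply: cvgN; apply: cvgMl; exact: cvg_id.
- rewrite -oppr0; apply: cvgN; rewrite -(mulr0 t^-1); apply: cvgMr.
  have -> : (fun l : R => expR (- (l * t))) = (fun z => expR (- z)) \o (fun l => l * t) by [].
  apply: (@cvg_comp _ _ _ _ _ _ (pinfty_nbhs R)); last exact: cvgr_expR.
  exact: gt0_cvgMly.
- by move=> l l1; have [] := d l.
- apply: cvg_at_right_filter.
  have [/derivable1_diffP/differentiable_continuous + _] := d 1; exact.
- move=> l _; by rewrite derive1E; have h := d l; rewrite derive_val.
Qed.
End gamma.

Section gamma_properties.
Context {R : realType}.
Notation leb := (@lebesgue_measure R).
Implicit Types x y t : R.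
Local Notation D0 := (`]0%R, +oo[%classic : set R).
Local Notation D1 := (`[1%R, +oo[%classic : set R).

Lemma eGamma_ge0 x : (0 <= eGamma x)%E.
Proof. by apply: integral_ge0 => t _; rewrite lee_fin mulr_ge0 ?powR_ge0 ?expR_ge0. Qed.

(** Write [1/x] as the integral of [l ^ -(x+1)] over [l >= 1] and absorb this power into
    [eGamma (x + 1)] by scaling. The resulting double integral of [t ^ x * expR (- l t)], integrated
    over [l] first, gives [t ^ x * expR (- t) / t], the integrand of [eGamma x]. *)
Lemma eGammaS x : 0 < x -> eGamma (x + 1) = (x%:E * eGamma x)%E.
Proof.
move=> x0.
suff -> : eGamma x = (eGamma (x + 1) * (x^-1)%:E)%E.
  by rewrite muleCA -EFinM divff ?gt_eqF// mule1.
have := eGamma_ge0 (x + 1); move EG : (eGamma (x + 1)) => G G0.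
rewrite -(integral_powR_1y x0).
rewrite -(@ge0_integralZl _ _ R leb _ (measurable_itv _) (fun l => (l `^ (- (x + 1)))%:E)); last 3 first.
- apply/measurable_EFinP; apply: measurable_funTS; exact: measurable_powR.
- by move=> l _; rewrite lee_fin powR_ge0.
- exact: G0.
transitivity (\int[leb]_(t in D0) \int[leb]_(l in D1) (t `^ x * expR (- (l * t)))%:E)%E.
  apply: eq_integral => t; rewrite inE/= in_itv/= andbT => t0.
  under [RHS]eq_integral do rewrite EFinM.
  rewrite [RHS]ge0_integralZl_EFin; last 4 first.
  - exact: measurable_itv.
  - by move=> l _; rewrite lee_fin expR_ge0.
  - apply/measurable_EFinP; apply: measurable_funTS; apply: measurableT_comp => //.
    by apply: measurable_funN; apply: measurable_funM.
  - exact: powR_ge0.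
  rewrite integral_expR_1y// -EFinM; congr EFin.
  have tn0 : t != 0 by rewrite gt_eqF.
  rewrite (@powRB _ t x 1) ?tn0 ?implybT//. rewrite powRr1 ?ltW// -mulrA; congr (_ * _).
  exact: mulrC.
have /= <- := @tonelli_setX _ _ _ _ R leb leb D1 D0
  (fun z => (z.2 `^ x * expR (- (z.1 * z.2)))%:E)
  (measurable_itv _) (measurable_itv _); last 2 first.
- apply: measurable_funTS; apply/measurable_EFinP; apply: measurable_funM.
    exact: (measurableT_comp (@measurable_powR R x) measurable_snd).
  apply: (measurableT_comp (@measurable_expR R)).
  apply: measurable_funN; apply: measurable_funM.
    exact: measurable_fst.
  exact: measurable_snd.
- by move=> l t _ _; rewrite lee_fin mulr_ge0 ?powR_ge0 ?expR_ge0.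
apply: eq_integral => l; rewrite inE/= in_itv/= andbT => l1.
rewrite muleC -EG -eGamma_scale; last exact: lt_le_trans l1.
by rewrite addrK.
Qed.

Lemma eGamma1 : @eGamma R 1 = 1%E.
Proof.
rewrite /eGamma subrr.
have <- := @integral_exponential_pdf R 1 ltr01.
rewrite -[X in _ = (\int[_]_x X x)%E]/(EFin \o exponential_pdf 1).
rewrite /exponential_pdf -restrict_EFin -integral_mkcond.
rewrite -[RHS]integral_itv_obnd_cbnd; last first.
  apply/measurable_EFinP; apply: measurable_funTS.
  apply: measurable_funM => //; apply: (measurableT_comp (@measurable_expR R)).
  exact: measurable_funM.
apply: eq_integral => t _; by rewrite powRr0 /= mulN1r.
Qed.

Lemma eGamma_nat n : @eGamma R n.+1%:R = (n`!%:R)%:E.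
Proof.
elim: n => [|n IH]; first by rewrite eGamma1 fact0.
by rewrite -natr1 eGammaS ?ltr0n// IH -EFinM factS natrM.
Qed.

(** For [y >= 1] and an integer [n > y], [t ^ (y-1) <= 1 + t ^ n], which bounds [eGamma y] by two
    factorials. The functional equation carries finiteness from [x + 1] down to [x]. *)
Lemma eGamma_fin x : 0 < x -> eGamma x \is a fin_num.
Proof.
suff H y : 1 <= y -> eGamma y \is a fin_num.
  move=> x0; have := H (x + 1).
  rewrite lerDr ltW// => /(_ isT); rewrite eGammaS//.
  have := eGamma_ge0 x; case: (eGamma x) => // _.
  by rewrite gt0_muley ?lte_fin.
move=> y1; pose n := (Num.bound y).
have yn : y < n%:R by apply: archi_boundP; apply: le_trans y1.
rewrite ge0_fin_numE ?eGamma_ge0//.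
apply: (@le_lt_trans _ _ (eGamma 1 + eGamma n.+1%:R)%E); last first.
  by rewrite eGamma1 eGamma_nat -EFinD ltry.
rewrite /eGamma -ge0_integralD//=; last 4 first.
- by move=> t _; rewrite lee_fin mulr_ge0 ?powR_ge0 ?expR_ge0.
- exact: measurable_gamma_integrand1.
- by move=> t _; rewrite lee_fin mulr_ge0 ?powR_ge0 ?expR_ge0.
- exact: measurable_gamma_integrand1.
apply: ge0_le_integral => //=.
- by move=> t _; rewrite lee_fin mulr_ge0 ?powR_ge0 ?expR_ge0.
- exact: measurable_gamma_integrand1.
- by apply: emeasurable_funD; exact: measurable_gamma_integrand1.
move=> t; rewrite in_itv/= andbT => t0.
rewrite -EFinD lee_fin -mulrDl ler_wpM2r ?expR_ge0// subrr powRr0.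
have [t1|t1] := leP t 1.
  rewrite ler_wpDr ?powR_ge0//.
  by rewrite -[leRHS](@powRr0 _ t) ger_powR ?t0//= subr_ge0.
have yn' : y - 1 <= n.+1%:R - 1 by rewrite -natr1; lra.
by rewrite ler_wpDl// ler_powR// ltW.
Qed.

Lemma GammaE x : 0 < x -> eGamma x = (Gamma x)%:E.
Proof. by move=> x0; rewrite -[LHS]fineK ?eGamma_fin. Qed.

Lemma eGammaE x : eGamma x = (\int[leb]_(t in D0) (t `^ (x - 1) * expR (- t))%:E)%E.
Proof. by []. Qed.

Local Opaque Gamma eGamma.

Lemma GammaS x : 0 < x -> Gamma (x + 1) = x * Gamma x.
Proof.
by move=> x0; apply: EFin_inj; rewrite EFinM -!GammaE ?addr_gt0// eGammaS.
Qed.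

Lemma Gamma_nat n : Gamma n.+1%:R = n`!%:R :> R.
Proof. by apply: EFin_inj; rewrite -GammaE ?ltr0n// eGamma_nat. Qed.

(** For [y >= 1] the integrand is at least [expR (- t)] on [t >= 1], so [Gamma y >= expR (-1)];
    smaller arguments follow from the functional equation. *)
Lemma Gamma_gt0 x : 0 < x -> 0 < Gamma x.
Proof.
suff H y : 1 <= y -> 0 < Gamma y.
  move=> x0; have := H (x + 1).
  by rewrite lerDr ltW// => /(_ isT); rewrite GammaS// pmulr_rgt0.
move=> y1; have y0 : 0 < y by apply: lt_le_trans y1.
rewrite -lte_fin -GammaE//.
have := @integral_expR_1y R 1 ltr01; rewrite divr1 => H.
apply: (@lt_le_trans _ _ (expR (- 1))%:E); first by rewrite lte_fin expR_gt0.
rewrite -H eGammaE.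
apply: (@le_trans _ _ (\int[leb]_(t in D1) (t `^ (y - 1) * expR (- t))%:E)%E).
  apply: ge0_le_integral => //=.
  - apply/measurable_EFinP; apply: measurable_funTS.
    apply: (measurableT_comp (@measurable_expR R)).
    by apply: measurable_funN; apply: measurable_funM.
  - exact: measurable_gamma_integrand1.
  - move=> l; rewrite in_itv/= andbT => l1; rewrite lee_fin mulr1.
    rewrite ler_peMl ?expR_ge0// -[leLHS](@powRr0 _ l) ler_powR// subr_ge0//.
apply: ge0_subset_integral => //=.
- exact: measurable_gamma_integrand1.
- by move=> l _; rewrite lee_fin mulr_ge0 ?powR_ge0 ?expR_ge0.
- by move=> l /=; rewrite !in_itv/= !andbT; apply: lt_le_trans.
Qed.

(** Integrates an inequality between three powers against [expR (- t)]. Both the log-convexity and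
    the lower growth bound of Gamma come from such an inequality. *)
Lemma Gamma_le_lincomb (r p q m a b : R) :
  0 <= r -> 0 <= p -> 0 <= q -> 0 < m -> 0 < a -> 0 < b ->
  (forall t, 0 < t -> r * t `^ (m - 1) <= p * t `^ (a - 1) + q * t `^ (b - 1)) ->
  r * Gamma m <= p * Gamma a + q * Gamma b.
Proof.
move=> r0 p0 q0 m0 a0 b0 H.
have Z (k x : R) : 0 <= k -> 0 < x ->
    (k * Gamma x)%:E = (\int[leb]_(t in D0) (k * (t `^ (x - 1) * expR (- t)))%:E)%E.
  move=> k0 x0; under eq_integral do rewrite EFinM.
  rewrite ge0_integralZl_EFin//; last 2 first.
  - by move=> t _; rewrite lee_fin mulr_ge0 ?powR_ge0 ?expR_ge0.
  - exact: measurable_gamma_integrand1.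
  by rewrite EFinM -GammaE// eGammaE.
have mZ (k x : R) : measurable_fun D0 (fun t => (k * (t `^ x * expR (- t)))%:E).
  apply/measurable_EFinP; apply: measurable_funM => //; apply/measurable_EFinP.
  exact: measurable_gamma_integrand1.
have := Z _ _ r0 m0; have := Z _ _ p0 a0; have := Z _ _ q0 b0.
move: (Gamma m) (Gamma a) (Gamma b) => gm ga gb Eb Ea Em.
rewrite -lee_fin EFinD Em Ea Eb.
rewrite -ge0_integralD//=; last 4 first.
- by move=> t _; rewrite lee_fin !mulr_ge0 ?powR_ge0 ?expR_ge0.
- exact: mZ.
- by move=> t _; rewrite lee_fin !mulr_ge0 ?powR_ge0 ?expR_ge0.
- exact: mZ.
apply: ge0_le_integral => //=.
- by move=> t _; rewrite lee_fin !mulr_ge0 ?powR_ge0 ?expR_ge0.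
- exact: mZ.
- by apply: emeasurable_funD; exact: mZ.
move=> t; rewrite in_itv/= andbT => t0.
by rewrite -EFinD lee_fin !mulrA -mulrDl ler_wpM2r ?expR_ge0// H.
Qed.

(** Cauchy-Schwarz in AM-GM form: [2 X Y <= (v/u) X^2 + (u/v) Y^2] with [u^2 = Gamma a] and
    [v^2 = Gamma b]. These weights are the optimal ones, since after integration both terms on the
    right equal [u v]. *)
Lemma Gamma_midpoint (a b : R) : 0 < a -> 0 < b ->
  Gamma ((a + b) / 2) ^+ 2 <= Gamma a * Gamma b.
Proof.
move=> a0 b0; have Ga := Gamma_gt0 a0; have Gb := Gamma_gt0 b0.
have sq y : 0 < y -> exists2 u : R, 0 < u & y = u ^+ 2.
  by move=> y0; exists (Num.sqrt y); rewrite ?sqrtr_gt0// sqr_sqrtr// ltW.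
have [u u0 uE] := sq _ Ga; have [v v0 vE] := sq _ Gb.
have m0 : 0 < (a + b) / 2 by rewrite divr_gt0// addr_gt0.
have : 2 * Gamma ((a + b) / 2) <= (v / u) * Gamma a + (u / v) * Gamma b.
  apply: Gamma_le_lincomb => //; rewrite ?divr_ge0 ?ltW//.
  move=> t t0.
  pose X := t `^ ((a - 1) / 2); pose Y := t `^ ((b - 1) / 2).
  have tn0 : t != 0 by rewrite gt_eqF.
  have -> : t `^ ((a + b) / 2 - 1) = X * Y.
    by rewrite -powRD ?tn0 ?implybT//; congr powR; field.
  have -> : t `^ (a - 1) = X ^+ 2.
    by rewrite expr2 -powRD ?tn0 ?implybT//; congr powR; field.
  have -> : t `^ (b - 1) = Y ^+ 2.
    by rewrite expr2 -powRD ?tn0 ?implybT//; congr powR; field.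
  rewrite -subr_ge0.
  have -> : v / u * X ^+ 2 + u / v * Y ^+ 2 - 2 * (X * Y) = (v * X - u * Y) ^+ 2 / (u * v).
    by field; rewrite !gt_eqF.
  by rewrite divr_ge0 ?sqr_ge0// mulr_ge0 ?ltW.
rewrite uE vE.
have -> : v / u * u ^+ 2 + u / v * v ^+ 2 = 2 * (u * v) by field; rewrite !gt_eqF.
rewrite ler_pM2l// => H.
have uv : 0 <= u * v by apply: mulr_ge0; exact: ltW.
rewrite -(exprMn 2 u v); apply: lerXn2r; rewrite ?nnegrE; [|exact: uv|exact: H].
by apply: ltW; exact: Gamma_gt0.
Qed.

(** Integrate [u <= u ^ c + u^2 / 4] at [u = t/x]: for [u <= 1] because [c <= 1], and for [u >= 1]
    because [u <= 1 + u^2 / 4]. The left side becomes [Gamma x], and the quadratic term is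
    [(x+1)/(4x) * Gamma x], at most half of it. *)
Lemma Gamma_add_ge (x c : R) : 1 <= x -> 0 <= c <= 1 ->
  2^-1 * (x `^ c * Gamma x) <= Gamma (x + c).
Proof.
move=> x1 /andP[c0 c1]; have x0 : 0 < x by apply: lt_le_trans x1.
have xc0 : 0 < x + c by rewrite ltr_pwDl.
have : x^-1 * Gamma (x + 1) <= x `^ (- c) * Gamma (x + c) +
    (4 * x ^+ 2)^-1 * Gamma (x + 2).
  have x10 : 0 < x + 1 by rewrite addr_gt0.
  have x20 : 0 < x + 2 by rewrite addr_gt0.
  have xV : 0 <= x^-1 by rewrite invr_ge0 ltW.
  have x4V : 0 <= (4 * x ^+ 2)^-1 by rewrite invr_ge0 mulr_ge0 ?sqr_ge0.
  apply: (Gamma_le_lincomb xV (powR_ge0 _ _) x4V x10 xc0 x20).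
  move=> t t0; have tn0 : t != 0 by rewrite gt_eqF.
  have -> : t `^ (x + 1 - 1) = t * t `^ (x - 1).
    by rewrite -{2}(@powRr1 _ t) ?ltW// -powRD ?tn0 ?implybT//; congr powR; ring.
  have -> : t `^ (x + c - 1) = t `^ c * t `^ (x - 1).
    by rewrite -powRD ?tn0 ?implybT//; congr powR; ring.
  have -> : t `^ (x + 2 - 1) = t ^+ 2 * t `^ (x - 1).
    by rewrite -powR_mulrn ?ltW// -powRD ?tn0 ?implybT//; congr powR; ring.
  rewrite !mulrA -mulrDl ler_wpM2r ?powR_ge0//.
  pose u := t / x; have u0 : 0 < u by rewrite divr_gt0.
  have -> : x `^ (- c) * t `^ c = u `^ c.
    by rewrite powRM ?invr_ge0 ?ltW// -powR_inv1 ?ltW// -powRrM mulN1r mulrC.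
  have -> : x^-1 * t = u by rewrite mulrC.
  have -> : (4 * x * x)^-1 * t * t = u ^+ 2 / 4 by rewrite /u; field; rewrite gt_eqF.
  have [u1|u1] := leP u 1.
    by rewrite ler_wpDr ?divr_ge0 ?sqr_ge0// ger1_powR// u0.
  have : 1 <= u `^ c by rewrite -[leLHS](@powRr0 _ u) ler_powR// ltW.
  by have := sqr_ge0 (u / 2 - 1); rewrite !expr2; lra.
have -> : Gamma (x + 2) = (x + 1) * (x * Gamma x).
  by rewrite -(GammaS x0) -(GammaS (addr_gt0 x0 ltr01)); congr Gamma; ring.
rewrite GammaS// mulKf ?gt_eqF// => H.
have := Gamma_gt0 x0; move: (Gamma x) (Gamma (x + c)) H => g gc H g0.
have xc : 0 < x `^ c by rewrite powR_gt0.
have H2 : (4 * x ^+ 2)^-1 * ((x + 1) * (x * g)) <= 2^-1 * g.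
  have -> : (4 * x ^+ 2)^-1 * ((x + 1) * (x * g)) = (x + 1) / (4 * x) * g.
    by field; rewrite gt_eqF.
  apply: ler_wpM2r; first exact: ltW.
  rewrite ler_pdivrMr ?mulr_gt0//; lra.
have {H H2} : 2^-1 * g <= x `^ (- c) * gc by lra.
by rewrite powRN [X in _ <= X]mulrC ler_pdivlMr// mulrAC mulrA.
Qed.

Lemma expR_ge_partial_sum (x : R) n : 0 <= x ->
  \sum_(k < n) x ^+ k / k`!%:R <= expR x.
Proof.
move=> x0.
have := @is_cvg_series_exp_coeff _ x.
have nd : nondecreasing_seq (series (exp_coeff x)).
  by apply: nondecreasing_series => k _ _; rewrite exp_coeff_ge0.
move=> /(nondecreasing_cvgn_le nd) /(_ n).
by rewrite /series/= big_mkord.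
Qed.

(** Under Euler's integral the sum becomes a partial sum of the series of [expR (x t)], and [expR (-
    t) * expR (x t) = expR (- (1 - x) t)] is handled by scaling. *)
Lemma Gamma_binomial_partial_sum (c x : R) n : 0 < c -> 0 <= x < 1 ->
  \sum_(k < n) Gamma (c + k%:R) / k`!%:R * x ^+ k <= Gamma c * (1 - x) `^ (- c).
Proof.
move=> c0 /andP[x0 x1].
have x10 : 0 < 1 - x by rewrite subr_gt0.
rewrite -lee_fin -sumEFin EFinM -GammaE// muleC -eGamma_scale//.
have -> : (\sum_(k < n) (Gamma (c + k%:R) / k`!%:R * x ^+ k)%:E =
    \int[leb]_(t in D0) \sum_(k < n) (x ^+ k / k`!%:R * (t `^ (c + k%:R - 1) * expR (- t)))%:E)%E.
  have pos k (t : R) : (0 <= (x ^+ k / k`!%:R * (t `^ (c + k%:R - 1) * expR (- t)))%:E)%E.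
    by rewrite lee_fin !mulr_ge0 ?powR_ge0 ?expR_ge0 ?invr_ge0 ?exprn_ge0.
  rewrite ge0_integral_sum//=; last first.
    by move=> k; apply/measurable_EFinP; apply: measurable_funM => //; apply/measurable_EFinP;
      exact: measurable_gamma_integrand1.
  apply: eq_bigr => k _; under eq_integral do rewrite EFinM.
  rewrite ge0_integralZl_EFin//; last 3 first.
  - by move=> t _; rewrite lee_fin mulr_ge0 ?powR_ge0 ?expR_ge0.
  - exact: measurable_gamma_integrand1.
  - by rewrite mulr_ge0 ?invr_ge0 ?exprn_ge0.
  rewrite -eGammaE GammaE ?ltr_pwDl// -EFinM; congr EFin.
  by rewrite mulrC mulrA mulrAC.
apply: ge0_le_integral => //=.
- move=> t _; apply: sume_ge0 => k _.
  by rewrite lee_fin !mulr_ge0 ?powR_ge0 ?expR_ge0 ?invr_ge0 ?exprn_ge0.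
- apply: emeasurable_sum => k; apply/measurable_EFinP; apply: measurable_funM => //; apply/measurable_EFinP.
  exact: measurable_gamma_integrand1.
- exact: measurable_gamma_integrand.
move=> t; rewrite in_itv/= andbT => t0.
have tn0 : t != 0 by rewrite gt_eqF.
rewrite sumEFin lee_fin.
have -> : \sum_(k < n) x ^+ k / k`!%:R * (t `^ (c + k%:R - 1) * expR (- t)) =
   t `^ (c - 1) * expR (- t) * \sum_(k < n) (x * t) ^+ k / k`!%:R.
  rewrite mulr_sumr; apply: eq_bigr => k _.
  rewrite addrAC (@powRD _ t (c - 1)) ?tn0 ?implybT// powR_mulrn ?ltW// exprMn.
  by ring.
have -> : - ((1 - x) * t) = - t + x * t by ring.
rewrite expRD mulrA ler_wpM2l ?mulr_ge0 ?powR_ge0 ?expR_ge0//.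
by apply: expR_ge_partial_sum; rewrite mulr_ge0// ltW.
Qed.

End gamma_properties.

(** * Integration over tuples of complex numbers *)

Section complex_measurability.
Context d (T : measurableType d) (R : realType).
Implicit Types (f g : T -> R[i]).

Lemma measurable_Re : measurable_fun [set: R[i]] (@complex.Re R).
Proof.
rewrite (_ : @complex.Re R = fst \o complex_pair)//.
exact: (measurableT_comp measurable_fst (@measurable_complex_pair R)).
Qed.

Lemma measurable_Im : measurable_fun [set: R[i]] (@complex.Im R).
Proof.
rewrite (_ : @complex.Im R = snd \o complex_pair)//.
exact: (measurableT_comp measurable_snd (@measurable_complex_pair R)).
Qed.

Lemma measurable_fun_Re f : measurable_fun setT f ->
  measurable_fun setT (fun x => complex.Re (f x)).
Proof. exact: measurableT_comp measurable_Re. Qed.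

Lemma measurable_fun_Im f : measurable_fun setT f ->
  measurable_fun setT (fun x => complex.Im (f x)).
Proof. exact: measurableT_comp measurable_Im. Qed.

Lemma measurable_fun_normc f : measurable_fun setT f ->
  measurable_fun setT (fun x => normc (f x)).
Proof. exact: (measurableT_comp (@measurable_normc R)). Qed.

Lemma measurable_fun_complex f :
  measurable_fun setT (fun x => complex.Re (f x)) ->
  measurable_fun setT (fun x => complex.Im (f x)) -> measurable_fun setT f.
Proof.
move=> mr mi.
rewrite (_ : f = pair_complex \o (fun x => (complex.Re (f x), complex.Im (f x)))).
  exact: (measurableT_comp (@measurable_pair_complex R) (measurable_fun_pair mr mi)).
by apply/funext => x /=; case: (f x).
Qed.

Lemma cReD (a b : R[i]) : complex.Re (a + b) = complex.Re a + complex.Re b.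
Proof. by case: a; case: b. Qed.
Lemma cImD (a b : R[i]) : complex.Im (a + b) = complex.Im a + complex.Im b.
Proof. by case: a; case: b. Qed.
Lemma cReM (a b : R[i]) : complex.Re (a * b) =
  complex.Re a * complex.Re b - complex.Im a * complex.Im b.
Proof. by case: a; case: b. Qed.
Lemma cImM (a b : R[i]) : complex.Im (a * b) =
  complex.Re a * complex.Im b + complex.Im a * complex.Re b.
Proof. by case: a; case: b. Qed.

Lemma measurable_cadd f g : measurable_fun setT f -> measurable_fun setT g ->
  measurable_fun setT (fun x => f x + g x).
Proof.
move=> mf mg; apply: measurable_fun_complex.
  under eq_fun do rewrite cReD; apply: measurable_funD; exact: measurable_fun_Re.
under eq_fun do rewrite cImD; apply: measurable_funD; exact: measurable_fun_Im.
Qed.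

Lemma measurable_cmul f g : measurable_fun setT f -> measurable_fun setT g ->
  measurable_fun setT (fun x => f x * g x).
Proof.
move=> mf mg; apply: measurable_fun_complex.
  under eq_fun do rewrite cReM; apply: measurable_funB; apply: measurable_funM;
    by [exact: measurable_fun_Re|exact: measurable_fun_Im].
under eq_fun do rewrite cImM; apply: measurable_funD; apply: measurable_funM;
  by [exact: measurable_fun_Re|exact: measurable_fun_Im].
Qed.

Lemma measurable_conjc f : measurable_fun setT f ->
  measurable_fun setT (fun x => conjc (f x)).
Proof.
move=> mf; apply: measurable_fun_complex.
  have -> : (fun x => complex.Re (conjc (f x))) = (fun x => complex.Re (f x)).
    by apply/funext => x; case: (f x).
  exact: measurable_fun_Re.
have -> : (fun x => complex.Im (conjc (f x))) = (fun x => - complex.Im (f x)).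
  by apply/funext => x; case: (f x).
by apply: measurable_funN; exact: measurable_fun_Im.
Qed.

Lemma measurable_csum (I : Type) (s : seq I) (h : I -> T -> R[i]) :
  (forall i, measurable_fun setT (h i)) ->
  measurable_fun setT (fun x => \sum_(i <- s) h i x).
Proof.
move=> mh; elim: s => [|i s IH].
  by under eq_fun do rewrite big_nil; exact: measurable_cst.
by under eq_fun do rewrite big_cons; exact: measurable_cadd.
Qed.

Lemma measurable_cprod (I : Type) (s : seq I) (h : I -> T -> R[i]) :
  (forall i, measurable_fun setT (h i)) ->
  measurable_fun setT (fun x => \prod_(i <- s) h i x).
Proof.
move=> mh; elim: s => [|i s IH].
  by under eq_fun do rewrite big_nil; exact: measurable_cst.
by under eq_fun do rewrite big_cons; exact: measurable_cmul.
Qed.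

Lemma measurable_cexp f n : measurable_fun setT f ->
  measurable_fun setT (fun x => f x ^+ n).
Proof.
move=> mf; elim: n => [|n IH].
  by under eq_fun do rewrite expr0; exact: measurable_cst.
by under eq_fun do rewrite exprS; exact: measurable_cmul.
Qed.

End complex_measurability.

Section complex_integral.
Local Open Scope ereal_scope.

Lemma ge0_integral_sfpushforward d d' (T : measurableType d)
    (T' : measurableType d') (R : realType) (mu : {measure set T -> \bar R})
    (smu : sigma_finite [set: T] mu) (f : T -> T') (g : T' -> T)
    (mf : measurable_fun [set: T] f) (mg : measurable_fun [set: T'] g)
    (fK : cancel f g) (F : T' -> \bar R) :
  measurable_fun setT F -> (forall x, 0 <= F x) ->
  \int[sfpushforward smu mf mg fK]_x F x = \int[mu]_x F (f x).
Proof.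
by move=> mF F0; rewrite -(ge0_integral_pushforward mf mu measurableT mF).
Qed.

Context {R : realType}.
Notation leb := (@lebesgue_measure R).
Notation lebC := (@lebesgue_C R).

Lemma integral_lebesgue_C (F : R[i] -> \bar R) :
  measurable_fun setT F -> (forall x, 0 <= F x) ->
  \int[lebC]_w F w = \int[leb]_x \int[leb]_y F (x +i* y)%C.
Proof.
move=> mF F0; rewrite /lebesgue_C ge0_integral_sfpushforward//.
by rewrite fubini_tonelli1//; exact: (measurableT_comp mF (@measurable_pair_complex R)).
Qed.

(** For [c = a + i b], multiplication by [c] is a composition of two one-variable affine
    substitutions: [v = k y + (b/a) u] with [u] fixed, then [u = a x - b y] with [y] fixed. The
    Jacobian is [|k| |a| = a^2 + b^2]. The division by [a] explains the condition on the real part,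
    which is removed later. *)
Lemma integral_lebesgue_C_mul (c : R[i]) (F : R[i] -> \bar R) :
  complex.Re c != 0%R -> measurable_fun setT F -> (forall x, 0 <= F x) ->
  \int[lebC]_w F w = (normc c ^+ 2)%:E * \int[lebC]_w F (c * w)%R.
Proof.
move=> c0 mF F0.
have mcF : measurable_fun setT (fun w => F (c * w)%R).
  apply: measurableT_comp mF _; apply: measurable_cmul => //; exact: measurable_id.
rewrite !integral_lebesgue_C//.
case: c c0 mcF => a b /= a0 mcF.
pose T2 := (measurableTypeR R * measurableTypeR R)%type.
pose G (z : T2) : \bar R := F (z.1 +i* z.2)%C.
have mG : measurable_fun setT G.
  exact: (measurableT_comp mF (@measurable_pair_complex R)).
have mGa (h k : T2 -> measurableTypeR R) : measurable_fun setT h -> measurable_fun setT k ->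
    measurable_fun setT (fun z => G (h z, k z)).
  by move=> mh mk; exact: (measurableT_comp mG (measurable_fun_pair mh mk)).
have m1 : measurable_fun setT (fst : T2 -> measurableTypeR R) by exact: measurable_fst.
have m2 : measurable_fun setT (snd : T2 -> measurableTypeR R) by exact: measurable_snd.
have mlin (p q : R) : measurable_fun setT (fun z : T2 => (p * z.1 + q * z.2)%R).
  by apply: measurable_funD; apply: measurable_funM.
pose k := ((a ^+ 2 + b ^+ 2) / a)%R.
have ab0 : (0 < a ^+ 2 + b ^+ 2)%R.
  by rewrite ltr_pwDl ?sqr_ge0// exprn_even_gt0.
have k0 : k != 0%R by apply: mulf_neq0; [exact: lt0r_neq0|rewrite invr_eq0].
transitivity (\int[leb]_u (`|k|%:E * \int[leb]_y G (u, (k * y + b / a * u)%R))).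
  apply: eq_integral => u _.
  rewrite -(@integral_affine R k (b / a * u) (fun v => F (u +i* v)%C))//.
  exact: (measurableT_comp mG (pair1_measurable u)).
pose G1 (z : T2) := G (z.1, (b / a * z.1 + k * z.2)%R).
have mG1 : measurable_fun setT G1 by exact: (mGa _ _ m1 (mlin _ _)).
have mG1' : measurable_fun setT (fun x => \int[leb]_y G1 (x, y)).
  by apply: measurable_fun_fubini_tonelli_F => // z; exact: F0.
under eq_integral => u _.
  rewrite (_ : \int[leb]_y G _ = \int[leb]_y G1 (u, y)); last first.
    by apply: eq_integral => y _; rewrite /G1/= addrC.
  over.
rewrite ge0_integralZl_EFin; [|exact: measurableT
  |by move=> x _; apply: integral_ge0 => y _; exact: F0|exact: mG1'|exact: normr_ge0].
rewrite (fubini_tonelli G1 mG1); last by move=> z; exact: F0.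
pose G2 (z : T2) := G ((a * z.1 + (- b) * z.2)%R, (b * z.1 + a * z.2)%R).
have mG2 : measurable_fun setT G2 by exact: (mGa _ _ (mlin _ _) (mlin _ _)).
have mG2' : measurable_fun setT (fun y => \int[leb]_x G2 (x, y)).
  by apply: measurable_fun_fubini_tonelli_G => // z; exact: F0.
transitivity (`|k|%:E * \int[leb]_y (`|a|%:E * \int[leb]_x G2 (x, y))).
  congr (_ * _); apply: eq_integral => y _.
  rewrite (@integral_affine R a (- b * y) (fun x => G1 (x, y)) a0); [|idtac|by move=> x; exact: F0]; last first.
    exact: (measurableT_comp mG1 (pair2_measurable y)).
  congr (_ * _); apply: eq_integral => x _; rewrite /G1 /G2/=; congr (G (_, _)).
  by rewrite /k; field.
rewrite ge0_integralZl_EFin; [|exact: measurableT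
  |by move=> x _; apply: integral_ge0 => y _; exact: F0|exact: mG2'|exact: normr_ge0].
have -> : (normc (a +i* b)%C ^+ 2 = a ^+ 2 + b ^+ 2)%R by rewrite sqr_sqrtr// ltW.
rewrite muleA -EFinM -normrM divfK; last exact: a0.
rewrite gtr0_norm; last exact: ab0.
rewrite -(fubini_tonelli G2 mG2); last by move=> z; exact: F0.
congr (_ * _); apply: eq_integral => x _; apply: eq_integral => y _; rewrite /G2 /G/=; congr F.
by apply/eqP; rewrite eq_complex/=; apply/andP; split; apply/eqP; ring.
Qed.

Lemma measurable_C_set1 (w : R[i]) : measurable [set w].
Proof.
rewrite (_ : [set w] = complex_pair @^-1` ([set complex.Re w] `*` [set complex.Im w])).
  rewrite -[X in measurable X]setTI; apply: measurable_complex_pair => //.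
  by apply: measurableX.
by case: w => a b; apply/seteqP; split => [[x y] [<- <-]//|[x y] /= [-> ->]//].
Qed.

Lemma lebesgue_C_set1 (w : R[i]) : lebC [set w] = 0.
Proof.
rewrite /= /pushforward.
rewrite (_ : _ @^-1` _ = [set complex.Re w] `*` [set complex.Im w]); last first.
  case: w => a b; apply/seteqP; split => [[x y] [<- <-]//|[x y] /= [-> ->]//].
by rewrite product_measure1E//= lebesgue_measure_set1 mul0e.
Qed.

End complex_integral.

Section tuple_integral.
Context d (T : measurableType d) (R : realType).
Variable mu : {sigma_finite_measure set T -> \bar R}.
Local Open Scope ereal_scope.

Lemma integral_tuple_power0 (F : 0.-tuple T -> \bar R) :
  measurable_fun setT F -> \int[tuple_power mu 0]_w F w = F [tuple].
Proof. by move=> mF; rewrite /= integral_dirac// diracT mul1e. Qed.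

Lemma measurable_tcons_comp n (F : n.+1.-tuple T -> \bar R) :
  measurable_fun setT F -> measurable_fun setT (fun z => F (@tcons _ T n z)).
Proof. by move=> mF; exact: (measurableT_comp mF (@measurable_tcons _ T n)). Qed.

Lemma integral_tuple_powerS n (F : n.+1.-tuple T -> \bar R) :
  measurable_fun setT F -> (forall x, 0 <= F x) ->
  \int[tuple_power mu n.+1]_w F w =
  \int[mu]_x \int[tuple_power mu n]_t F (@tcons _ T n (x, t)).
Proof.
move=> mF F0; rewrite [tuple_power mu n.+1]/= ge0_integral_sfpushforward//.
by rewrite fubini_tonelli1//; exact: measurable_tcons_comp.
Qed.

End tuple_integral.

Section tuple_scale.
Context {R : realType}.
Notation lebC := (@lebesgue_C R).
Local Open Scope ereal_scope.

Definition tscale n (c : R[i]) (w : n.-tuple R[i]) : n.-tuple R[i] :=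
  [tuple of map (fun x => c * x)%R w].

Lemma measurable_tscale n c : measurable_fun setT (@tscale n c).
Proof.
apply/measurable_fun_tnthP => i.
rewrite (_ : _ \o _ = (fun w => c * tnth w i)%R); last first.
  by apply/funext => w; rewrite /= tnth_map.
by apply: measurable_cmul => //; exact: measurable_tnth.
Qed.

Lemma integral_tuple_power_scale n (c : R[i]) (F : n.-tuple R[i] -> \bar R) :
  complex.Re c != 0%R -> measurable_fun setT F -> (forall x, 0 <= F x) ->
  \int[tuple_power lebC n]_w F w =
  ((normc c ^+ 2) ^+ n)%:E * \int[tuple_power lebC n]_w F (tscale c w).
Proof.
move=> c0; elim: n F => [|n IH] F mF F0.
  rewrite !integral_tuple_power0//; last exact: (measurableT_comp mF (measurable_tscale c)).
  by rewrite expr0 mul1e; congr F; exact/val_inj.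
rewrite !integral_tuple_powerS//; last exact: (measurableT_comp mF (measurable_tscale c)).
have m1 : measurable_fun setT (fun z => F (@tcons _ _ n z)) by exact: measurable_tcons_comp.
rewrite (@integral_lebesgue_C_mul _ c); [|exact: c0| |]; last 2 first.
- by apply: (measurable_fun_fubini_tonelli_F (m2 := tuple_power lebC n) _ m1) => z; exact: F0.
- by move=> x; apply: integral_ge0 => t _; exact: F0.
pose F' (z : R[i] * n.-tuple R[i]) := F (tscale c (tcons z)).
have mF' : measurable_fun setT F'.
  apply: (@measurable_tcons_comp _ _ _ n (fun w => F (tscale c w))).
  exact: (measurableT_comp mF (measurable_tscale c)).
have E x : \int[tuple_power lebC n]_t F (tcons ((c * x)%R, t)) =
    ((normc c ^+ 2) ^+ n)%:E * \int[tuple_power lebC n]_t F' (x, t).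
  rewrite IH//; last first.
    exact: (measurableT_comp m1 (pair1_measurable _)).
  congr (_ * _); apply: eq_integral => t _; rewrite /F'; congr F.
  by apply/val_inj.
under eq_integral do rewrite E.
rewrite ge0_integralZl_EFin//; last 3 first.
- by move=> x _; apply: integral_ge0 => t _; exact: F0.
- by apply: (measurable_fun_fubini_tonelli_F (m2 := tuple_power lebC n) _ mF') => z; exact: F0.
- by rewrite exprn_ge0// sqr_ge0.
by rewrite muleA -EFinM -exprS.
Qed.

End tuple_scale.

(** * Roots of unity as a discrete substitute for the circle *)

Section roots_of_unity.
Context {R : realType}.
Local Open Scope complex_scope.
Implicit Types (x y w : R[i]).

Lemma sqr_normcE x : (normc x ^+ 2)%:C = x * conjc x.
Proof. by rewrite -sqr_normc rmorphXn. Qed.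

Lemma normc_ge0 x : 0 <= normc x.
Proof. by case: x => a b; rewrite sqrtr_ge0. Qed.

Lemma normcX x n : normc (x ^+ n) = normc x ^+ n.
Proof. by elim: n => [|n IH]; rewrite ?expr0 ?normc1// !exprS normcM IH. Qed.

Lemma normc_conj x : normc (conjc x) = normc x.
Proof. by case: x => a b /=; rewrite sqrrN. Qed.

Lemma normc_real (a : R) : normc a%:C = `|a|.
Proof. by rewrite /= expr0n addr0 sqrtr_sqr. Qed.

(** [R[i]] is algebraically closed and [X^N - 1] is separable, so there are [N] distinct roots of
    unity of order dividing [N], which forces a primitive one. *)
Lemma prim_root_exists N : (0 < N)%N -> exists w : R[i], N.-primitive_root w.
Proof.
pose p : {poly R[i]} := 'X^N - 1; have [r Dp] := closed_field_poly_normal p.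
move=> n_gt0; rewrite (monicP _) ?monicXnsubC // scale1r in Dp.
have rn1: all N.-unity_root r by apply/allP=> z; rewrite -root_prod_XsubC -Dp.
have sz_r: (N < (size r).+1)%N.
  by rewrite -(size_prod_XsubC r id) -Dp size_XnsubC.
have [|z] := hasP (has_prim_root n_gt0 rn1 _ sz_r); last by exists z.
by rewrite -separable_prod_XsubC -Dp separable_Xn_sub_1 // pnatr_eq0 -lt0n.
Qed.

Lemma normc_prim_root N w : N.-primitive_root w -> normc w = 1.
Proof.
move=> pw; have N0 := prim_order_gt0 pw.
apply/eqP; rewrite -(@pexpr_eq1 _ _ N) ?normc_ge0//.
by rewrite -normcX (prim_expr_order pw) normc1.
Qed.

Lemma prim_root_neq0 N w : N.-primitive_root w -> w != 0.
Proof.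
move=> /normc_prim_root w1; apply/eqP => w0; move: w1.
by rewrite w0 normc0 => /esym/eqP; rewrite oner_eq0.
Qed.

Lemma conjc_prim_root N w : N.-primitive_root w -> conjc w = w^-1.
Proof.
move=> pw; apply: (mulfI (prim_root_neq0 pw)).
by rewrite -sqr_normcE (normc_prim_root pw) expr1n divff ?(prim_root_neq0 pw).
Qed.

(** Orthogonality of the characters of [Z/N]: off the diagonal this is a geometric sum whose ratio
    is an [N]-th root of unity other than 1. *)
Lemma sum_prim_root_ratio N w i k : N.-primitive_root w -> (i < N)%N -> (k < N)%N ->
  \sum_(j < N) (w ^+ i / w ^+ k) ^+ j = if i == k then N%:R else 0.
Proof.
move=> pw iN kN; have w0 := prim_root_neq0 pw.
have [->|ik] := eqVneq i k.
  rewrite divff ?expf_neq0//; under eq_bigr do rewrite expr1n.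
  by rewrite sumr_const card_ord.
set x := w ^+ i / w ^+ k.
have x1 : x != 1.
  apply: contra ik => /eqP xE; have : w ^+ i == w ^+ k.
    by rewrite -[w ^+ k]mul1r -xE divfK// expf_neq0.
  by rewrite (eq_prim_root_expr pw) !modn_small.
have : (x - 1) * \sum_(j < N) x ^+ j = 0.
  rewrite -subrX1 /x exprMn exprVn -!exprM !(mulnC _ N) !exprM (prim_expr_order pw).
  by rewrite !expr1n divr1 subrr.
by move=> /eqP; rewrite mulf_eq0 subr_eq0 (negbTE x1)/= => /eqP.
Qed.

(** Parseval on [Z/N]; the bound [n <= N] excludes aliasing of two exponents. *)
Lemma sum_prim_root N w (a : nat -> R[i]) n : N.-primitive_root w -> (n <= N)%N ->
  \sum_(j < N) normc (\sum_(i < n) a i * (w ^+ j) ^+ i) ^+ 2 =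
  N%:R * \sum_(i < n) normc (a i) ^+ 2.
Proof.
move=> pw nN; apply: complexI; have wJ := conjc_prim_root pw.
rewrite rmorph_sum/= rmorphM rmorph_sum/= rmorph_nat.
transitivity (\sum_(j < N) \sum_(i < n) \sum_(k < n) a i * conjc (a k) * (w ^+ i / w ^+ k) ^+ j).
  apply: eq_bigr => j _; rewrite sqr_normcE mulr_suml; apply: eq_bigr => i _.
  rewrite rmorph_sum mulr_sumr; apply: eq_bigr => k _.
  rewrite rmorphM !rmorphXn/= wJ exprMn !exprVn -!exprM !(mulnC j).
  by ring.
have ltN (i : 'I_n) : (i < N)%N by exact: leq_trans (ltn_ord i) nN.
rewrite exchange_big/= mulr_sumr; apply: eq_bigr => i _; rewrite exchange_big/=.
rewrite (bigD1 i)//= [X in _ + X]big1 ?addr0.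
  by rewrite -mulr_sumr sum_prim_root_ratio// eqxx sqr_normcE mulrC.
move=> k ki; rewrite -mulr_sumr sum_prim_root_ratio// ifN ?mulr0//.
by apply: contra ki => /eqP ik; apply/eqP/val_inj.
Qed.

End roots_of_unity.

Section complex_integral_scale.
Context {R : realType}.
Notation leb := (@lebesgue_measure R).
Notation lebC := (@lebesgue_C R).
Local Open Scope ereal_scope.

(** A purely imaginary [c] is a product of [1 + i] and a factor that also has nonzero real part, so
    two applications of the earlier change of variables suffice. *)
Lemma integral_tuple_power_cscale n (c : R[i]) (F : n.-tuple R[i] -> \bar R) :
  c != 0%R -> measurable_fun setT F -> (forall x, 0 <= F x) ->
  \int[tuple_power lebC n]_w F w =
  ((normc c ^+ 2) ^+ n)%:E * \int[tuple_power lebC n]_w F (tscale c w).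
Proof.
move=> c0 mF F0; have [a0|a0] := eqVneq (complex.Re c) 0%R; last exact: integral_tuple_power_scale.
pose c1 : R[i] := (1%R +i* 1%R)%C; pose c2 := (c / c1)%R.
have c1n : c1 != 0%R by rewrite eq_complex/= oner_eq0.
have cE : c = (c2 * c1)%R by rewrite divfK.
have c2r : complex.Re c2 != 0%R.
  apply: contra c0 => /eqP c20; move: a0; rewrite cE cReM/= c20 !mulr1 sub0r => /eqP.
  rewrite oppr_eq0 => /eqP c2i.
  rewrite mulf_eq0; apply/orP; left; rewrite eq_complex/= c2i c20.
  by rewrite eqxx.
have mF2 : measurable_fun setT (fun w => F (tscale c2 w)).
  exact: (measurableT_comp mF (measurable_tscale c2)).
rewrite (integral_tuple_power_scale c2r mF F0).
have c1r : complex.Re c1 != 0%R by exact: oner_neq0.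
rewrite (integral_tuple_power_scale c1r mF2)//.
rewrite muleA -EFinM -exprMn -exprMn -normcM -cE; congr (_ * _).
apply: eq_integral => w _; congr F; apply: eq_from_tnth => i.
by rewrite !tnth_map mulrA -cE.
Qed.

Lemma integral_tuple_power1 (F : R[i] -> \bar R) :
  measurable_fun setT F -> (forall x, 0 <= F x) ->
  \int[tuple_power lebC 1]_w F (tnth w ord0) = \int[lebC]_w F w.
Proof.
move=> mF F0; rewrite integral_tuple_powerS//; last first.
  exact: (measurableT_comp mF (measurable_tnth ord0)).
apply: eq_integral => x _; rewrite integral_tuple_power0//.
have -> : (fun x0 : 0.-tuple R[i] => F (tnth (tcons (x, x0)) ord0)) = cst (F x).
  by apply/funext.
exact: measurable_cst.
Qed.

Lemma integral_lebesgue_C_scale (c : R[i]) (F : R[i] -> \bar R) :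
  c != 0%R -> measurable_fun setT F -> (forall x, 0 <= F x) ->
  \int[lebC]_w F w = (normc c ^+ 2)%:E * \int[lebC]_w F (c * w)%R.
Proof.
move=> c0 mF F0; rewrite -!integral_tuple_power1//; last first.
  by apply: measurableT_comp mF _; apply: measurable_cmul.
rewrite (integral_tuple_power_cscale c0)//; last first.
  exact: (measurableT_comp mF (measurable_tnth ord0)).
rewrite expr1; congr (_ * _); apply: eq_integral => w _.
by rewrite tnth_map.
Qed.

Lemma integral_rotation_average n N (w : R[i]) (F : n.-tuple R[i] -> \bar R) :
  N.-primitive_root w -> measurable_fun setT F -> (forall x, 0 <= F x) ->
  \int[tuple_power lebC n]_x \sum_(j < N) F (tscale (w ^+ j)%R x) =
  N%:R%:E * \int[tuple_power lebC n]_x F x.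
Proof.
move=> pw mF F0; have w1 := normc_prim_root pw.
rewrite ge0_integral_sum//; last first.
  by move=> j; exact: (measurableT_comp mF (measurable_tscale _)).
transitivity (\sum_(j < N) \int[tuple_power lebC n]_x F x).
  apply: eq_bigr => j _; rewrite [RHS](@integral_tuple_power_cscale _ (w ^+ j)%R)//.
    by rewrite normcX w1 !expr1n mul1e.
  by rewrite expf_neq0// (prim_root_neq0 pw).
by rewrite sumr_const card_ord mule_natl.
Qed.

End complex_integral_scale.

(** * Gaussian moments *)

Section gaussian_moments.
Context {R : realType}.
Notation leb := (@lebesgue_measure R).
Notation lebC := (@lebesgue_C R).
Local Notation D1 := (`[1%R, +oo[%classic : set R).

Definition sqnorm n (w : n.-tuple R[i]) : R := \sum_(j < n) normc (tnth w j) ^+ 2.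

Lemma sqnorm_ge0 n (w : n.-tuple R[i]) : 0 <= sqnorm w.
Proof. by apply: sumr_ge0 => j _; exact: sqr_ge0. Qed.

Lemma sqnorm_scale n c (w : n.-tuple R[i]) : sqnorm (tscale c w) = normc c ^+ 2 * sqnorm w.
Proof. by rewrite mulr_sumr; apply: eq_bigr => j _; rewrite tnth_map normcM exprMn. Qed.

Lemma hdot_scale n c (z w : n.-tuple R[i]) : hdot z (tscale c w) = conjc c * hdot z w.
Proof.
by rewrite mulr_sumr; apply: eq_bigr => j _; rewrite tnth_map rmorphM/= mulrCA.
Qed.

Lemma sqnorm_tcons n x (t : n.-tuple R[i]) :
  sqnorm (tcons (x, t)) = normc x ^+ 2 + sqnorm t.
Proof.
rewrite /sqnorm big_ord_recl; congr (_ + _).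
by apply: eq_bigr => j _; rewrite /tcons tnthS.
Qed.

Lemma hdot_tcons n x y (s t : n.-tuple R[i]) :
  hdot (tcons (x, s)) (tcons (y, t)) = x * conjc y + hdot s t.
Proof.
rewrite /hdot big_ord_recl; congr (_ + _).
by apply: eq_bigr => j _; rewrite /tcons !tnthS.
Qed.

Lemma measurable_sqnorm n : measurable_fun setT (@sqnorm n).
Proof.
apply: measurable_sum => j; apply: measurable_funX.
exact: (measurableT_comp (@measurable_normc R) (measurable_tnth j)).
Qed.

Lemma measurable_hdotr n (z : n.-tuple R[i]) : measurable_fun setT (hdot z).
Proof.
apply: measurable_csum => j; apply: measurable_cmul; first exact: measurable_cst.
by apply: measurable_conjc; exact: measurable_tnth.
Qed.

Lemma measurable_hdot_pow n k (z : n.-tuple R[i]) :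
  measurable_fun setT (fun w => (normc (hdot z w) ^+ 2) ^+ k).
Proof. by do 2 apply: measurable_funX; apply: measurable_fun_normc; exact: measurable_hdotr. Qed.

Lemma lebesgue_C_rotation_average N (w : R[i]) (F : R[i] -> \bar R) :
  N.-primitive_root w -> measurable_fun setT F -> (forall x, 0 <= F x)%E ->
  (\int[lebC]_x \sum_(j < N) F (w ^+ j * x)%R = N%:R%:E * \int[lebC]_x F x)%E.
Proof.
move=> pw mF F0; have w1 := normc_prim_root pw.
rewrite ge0_integral_sum//; last first.
  by move=> j; apply: measurableT_comp mF _; apply: measurable_cmul.
transitivity (\sum_(j < N) \int[lebC]_x F x)%E.
  apply: eq_bigr => j _; rewrite [RHS](@integral_lebesgue_C_scale _ (w ^+ j)%R)//.
    by rewrite normcX w1 !expr1n mul1e.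
  by rewrite expf_neq0// (prim_root_neq0 pw).
by rewrite sumr_const card_ord mule_natl.
Qed.

Let g i := (\int[lebC]_w ((normc w ^+ 2) ^+ i * expR (- (normc w ^+ 2)))%:E)%E.

Let mnorm2 : measurable_fun setT (fun w : R[i] => normc w ^+ 2).
Proof. by apply: measurable_funX; exact: measurable_normc. Qed.

Let mgl (l : R) i : measurable_fun setT
  (fun w : R[i] => ((normc w ^+ 2) ^+ i * expR (- (l * normc w ^+ 2)))%:E).
Proof.
apply/measurable_EFinP; apply: measurable_funM; first exact: measurable_funX.
apply: (measurableT_comp (@measurable_expR R)); apply: measurable_funN.
exact: measurable_funM.
Qed.

Let mg i : measurable_fun setT
  (fun w : R[i] => ((normc w ^+ 2) ^+ i * expR (- (normc w ^+ 2)))%:E).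
Proof. by have := @mgl 1 i; under eq_fun do rewrite mul1r. Qed.

Let g0 : g 0 = pi%:E.
Proof.
rewrite /g integral_lebesgue_C; last 2 first.
- exact: mg.
- by move=> w; rewrite lee_fin mulr_ge0 ?exprn_ge0 ?expR_ge0 ?normc_ge0.
transitivity (\int[leb]_x \int[leb]_y ((gauss_fun x)%:E * (gauss_fun y)%:E))%E.
  apply: eq_integral => x _; apply: eq_integral => y _.
  by rewrite expr0 mul1r sqr_sqrtr ?addr_ge0 ?sqr_ge0// opprD expRD.
have mG : measurable_fun setT (fun x : R => (gauss_fun x)%:E).
  by apply/measurable_EFinP; exact: measurable_gauss_fun.
under eq_integral => x _.
  rewrite ge0_integralZl_EFin//; last first.
  - exact: gauss_fun_ge0.
  - by move=> y _; rewrite lee_fin gauss_fun_ge0.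
  rewrite integralT_gauss muleC; over.
rewrite ge0_integralZl_EFin//; last by move=> y _; rewrite lee_fin gauss_fun_ge0.
by rewrite integralT_gauss -EFinM -expr2 sqr_sqrtr// pi_ge0.
Qed.

(** Same device as in [eGammaS]: [1/(i+1)] is an integral over [l >= 1], and the factor [l] is moved
    into the Gaussian by scaling [w] with [sqrt l]. *)
Let gS i : g i.+1 = (i.+1%:R%:E * g i)%E.
Proof.
suff -> : g i = (g i.+1 * (i.+1%:R^-1)%:E)%E.
  by rewrite muleCA -EFinM divff ?mule1// pnatr_eq0.
have : (0 <= g i.+1)%E.
  by apply: integral_ge0 => w _; rewrite lee_fin mulr_ge0 ?exprn_ge0 ?expR_ge0 ?normc_ge0.
move EG : (g i.+1) => G G0.
have i0 : 0 < i.+1%:R :> R by rewrite ltr0n.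
rewrite -(integral_powR_1y i0).
rewrite -(@ge0_integralZl _ _ R leb _ (measurable_itv _) (fun l => (l `^ (- (i.+1%:R + 1)))%:E)); last 3 first.
- apply/measurable_EFinP; apply: measurable_funTS; exact: measurable_powR.
- by move=> l _; rewrite lee_fin powR_ge0.
- exact: G0.
pose f (p : measurableTypeR R * R[i]) := ((normc p.2 ^+ 2) ^+ i.+1 * expR (- (p.1 * normc p.2 ^+ 2)))%:E.
have mf : measurable_fun setT f.
  have m2 : measurable_fun setT (fun p : measurableTypeR R * R[i] => normc p.2 ^+ 2).
    exact: (measurableT_comp mnorm2 measurable_snd).
  apply/measurable_EFinP; apply: measurable_funM; first exact: measurable_funX.
  apply: (measurableT_comp (@measurable_expR R)); apply: measurable_funN.
  by apply: measurable_funM => //; exact: measurable_fst.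
have f0 p : (0 <= f p)%E by rewrite lee_fin mulr_ge0 ?exprn_ge0 ?expR_ge0 ?normc_ge0.
transitivity (\int[lebC]_w \int[leb]_(l in D1) f (l, w))%E.
  (* The integrands agree only almost everywhere: for [i = 0] and [w = 0] the left one is
     [0 ^+ 0 = 1] while the inner integral on the right is 0. *)
  apply: ge0_ae_eq_integral.
  - exact: measurableT.
  - exact: mg.
  - apply: (@measurable_tonelli_setX_G _ _ _ _ R leb D1 f (measurable_itv _)).
      exact: measurable_funTS.
    by move=> l w _; exact: f0.
  - by move=> w _; rewrite lee_fin mulr_ge0 ?exprn_ge0 ?expR_ge0 ?normc_ge0.
  - by move=> w _; apply: integral_ge0 => l _; exact: f0.
  exists [set 0]; split.
  - exact: measurable_C_set1.
  - exact: lebesgue_C_set1.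
  move=> w /= H; apply/eqP; apply: contra_notT H => w0 _.
  have nw : 0 < normc w ^+ 2.
    rewrite exprn_gt0// lt_neqAle normc_ge0 eq_sym andbT.
    by apply: contra w0 => /eqP/eq0_normc ->.
  rewrite /f/=; under [RHS]eq_integral do rewrite EFinM.
  rewrite [RHS]ge0_integralZl_EFin; last 4 first.
  - exact: measurable_itv.
  - by move=> l _; rewrite lee_fin expR_ge0.
  - apply/measurable_EFinP; apply: measurable_funTS.
    apply: (measurableT_comp (@measurable_expR R)).
    by apply: measurable_funN; apply: measurable_funM.
  - by rewrite ?exprn_ge0 ?normc_ge0.
  rewrite integral_expR_1y// -EFinM; congr EFin.
  move: (normc w ^+ 2) nw => r r0; rewrite exprSr -mulrA; congr (_ * _).
  by field; rewrite gt_eqF.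
rewrite -(@tonelli_setX _ _ _ _ R leb lebC D1 setT f (measurable_itv _) measurableT); last 2 first.
- exact: measurable_funTS.
- by move=> l w _ _; exact: f0.
apply: eq_integral => l; rewrite inE/= in_itv/= andbT => l1.
have l0 : 0 < l by apply: lt_le_trans l1.
have [c c0 sl] : exists2 c : R[i], c != 0 & normc c ^+ 2 = l.
  exists (Num.sqrt l)%:C%C; last by rewrite normc_real ger0_norm ?sqrtr_ge0// sqr_sqrtr// ltW.
  by rewrite eq_complex/= eqxx andbT gt_eqF// sqrtr_gt0.
rewrite -EG /g (integral_lebesgue_C_scale c0); last 2 first.
- exact: mg.
- by move=> w; rewrite lee_fin mulr_ge0 ?exprn_ge0 ?expR_ge0 ?normc_ge0.
rewrite sl.
transitivity (l%:E * \int[lebC]_w ((l ^+ i.+1)%:E * f (l, w)) * (l `^ (- (i.+1%:R + 1)))%:E)%E; last first.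
  congr (_ * _ * _)%E; apply: eq_integral => w _; rewrite /f/= normcM.
  by rewrite (exprMn 2 (normc c)) sl (exprMn i.+1 l) -mulrA -!EFinM.
rewrite ge0_integralZl_EFin; last 4 first.
- exact: measurableT.
- by move=> w _; exact: f0.
- exact: mgl.
- by rewrite exprn_ge0// ltW.
rewrite muleA -EFinM muleAC -EFinM -exprS.
have -> : - (i.+1%:R + 1) = - i.+2%:R :> R by rewrite natr1.
by rewrite powR_invn ?ltW// divff ?mul1e// expf_neq0// gt_eqF.
Qed.

Lemma gaussian_moment1 i :
  (\int[lebC]_w ((normc w ^+ 2) ^+ i * expR (- (normc w ^+ 2)))%:E = (pi * i`!%:R)%:E)%E.
Proof.
rewrite -/(g i); elim: i => [|i IH]; first by rewrite g0 fact0 mulr1.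
by rewrite gS IH -EFinM factS natrM mulrCA.
Qed.

(** The Gaussian is rotation invariant. Averaging the [k]-th power over the [(k+1)]-th roots of
    unity leaves, by Parseval, only the squared moduli of the [k+1] terms of the binomial
    expansion. *)
Lemma gaussian_moment_affine (A B : R[i]) k :
  (\int[lebC]_w ((normc (A * conjc w + B) ^+ 2) ^+ k * expR (- (normc w ^+ 2)))%:E =
   (pi * \sum_(i < k.+1) 'C(k, i)%:R ^+ 2 * i`!%:R * (normc A ^+ 2) ^+ i * (normc B ^+ 2) ^+ (k - i))%:E)%E.
Proof.
have [rt prt] := @prim_root_exists R k.+1 (ltn0Sn k).
have mF : measurable_fun setT
    (fun w : R[i] => ((normc (A * conjc w + B) ^+ 2) ^+ k * expR (- (normc w ^+ 2)))%:E).
  apply/measurable_EFinP; apply: measurable_funM.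
    do 2 apply: measurable_funX; apply: measurable_fun_normc.
    apply: measurable_cadd; last exact: measurable_cst.
    apply: measurable_cmul; first exact: measurable_cst.
    by apply: measurable_conjc; exact: measurable_id.
  by apply: (measurableT_comp (@measurable_expR R)); exact: measurable_funN.
have F0 (w : R[i]) : (0 <= ((normc (A * conjc w + B) ^+ 2) ^+ k * expR (- (normc w ^+ 2)))%:E)%E.
  by rewrite lee_fin mulr_ge0 ?exprn_ge0 ?expR_ge0 ?normc_ge0.
have K0 : k.+1%:R != 0 :> R by rewrite pnatr_eq0.
set I := (\int[lebC]_w _)%E.
have H := lebesgue_C_rotation_average prt mF F0; rewrite -/I in H.
have {H} : (k.+1%:R%:E * I = \int[lebC]_w (\sum_(i < k.+1)
    (k.+1%:R * ('C(k, i)%:R ^+ 2 * (normc A ^+ 2) ^+ i * (normc B ^+ 2) ^+ (k - i)))%:E *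
    ((normc w ^+ 2) ^+ i * expR (- (normc w ^+ 2)))%:E))%E.
  rewrite -H; apply: eq_integral => w _.
  rewrite sumEFin; under [RHS]eq_bigr do rewrite -EFinM; rewrite sumEFin; congr EFin.
  (* The modulus is taken of the conjugate polynomial, so that the root of unity enters with
     nonnegative powers. *)
  pose a i := (conjc B ^+ (k - i) * (conjc A * w) ^+ i) *+ 'C(k, i).
  transitivity ((\sum_(j < k.+1) normc (\sum_(i < k.+1) a i * (rt ^+ j) ^+ i) ^+ 2) * expR (- (normc w ^+ 2))).
    rewrite mulr_suml; apply: eq_bigr => j _.
    rewrite normcM normcX (normc_prim_root prt) expr1n mul1r; congr (_ * _).
    rewrite -exprM mulnC exprM -normcX -normc_conj; congr (_ ^+ 2); congr normc.
    rewrite rmorphXn rmorphD !rmorphM/= !conjcK addrC exprDn; apply: eq_bigr => i _.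
    rewrite /a mulrnAl -[in RHS]mulrA -[in RHS]exprMn -[in RHS](mulrA (conjc A)).
    by rewrite [in RHS](mulrC w).
  rewrite sum_prim_root// -mulrA mulr_suml mulr_sumr; apply: eq_bigr => i _.
  rewrite /a normcMn normcM !normcX normcM !normc_conj -[_ *+ _]mulr_natl.
  rewrite !exprMn.
  move: (normc A ^+ i) (normc B ^+ (k - i)) (normc w ^+ i) (expR _) => pA pB pw e.
  ring.
rewrite ge0_integral_sum//; last 2 first.
- by move=> i; apply: emeasurable_funM => //; exact: mg.
- by move=> i w _; rewrite -EFinM lee_fin !mulr_ge0 ?exprn_ge0 ?expR_ge0 ?normc_ge0.
under eq_bigr => i _.
  rewrite ge0_integralZl_EFin; last 4 first.
  - exact: measurableT.
  - by move=> w _; rewrite lee_fin mulr_ge0 ?exprn_ge0 ?expR_ge0 ?normc_ge0.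
  - exact: mg.
  - by rewrite !mulr_ge0 ?exprn_ge0 ?normc_ge0.
  rewrite gaussian_moment1 -EFinM; over.
rewrite sumEFin => H.
have : (k.+1%:R^-1%:E * (k.+1%:R%:E * I) = I)%E by rewrite muleA -EFinM mulVf// mul1e.
rewrite H -EFinM => <-; congr EFin.
rewrite !mulr_sumr; apply: eq_bigr => i _.
by field.
Qed.

(** Induction on the coordinates takes the place of unitary invariance. The identity
    [C(k,i) * i! * (k-i)! = k!] turns the squared binomial coefficients into the binomial expansion
    of [sqnorm z ^+ k]. *)
Lemma gaussian_moment n (z : n.-tuple R[i]) k :
  (\int[tuple_power lebC n]_w ((normc (hdot z w) ^+ 2) ^+ k * expR (- sqnorm w))%:E =
   (pi ^+ n * k`!%:R * sqnorm z ^+ k)%:E)%E.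
Proof.
have mF m (x : m.-tuple R[i]) j : measurable_fun setT
    (fun w => ((normc (hdot x w) ^+ 2) ^+ j * expR (- sqnorm w))%:E).
  apply/measurable_EFinP; apply: measurable_funM.
    exact: measurable_hdot_pow.
  apply: (measurableT_comp (@measurable_expR R)); apply: measurable_funN.
  exact: measurable_sqnorm.
have F0 m (x : m.-tuple R[i]) j w :
    (0 <= ((normc (hdot x w) ^+ 2) ^+ j * expR (- sqnorm w))%:E)%E.
  by rewrite lee_fin mulr_ge0 ?exprn_ge0 ?expR_ge0 ?normc_ge0.
elim: n z k => [|n IH] z k.
  rewrite integral_tuple_power0; last exact: mF.
  rewrite /hdot /sqnorm !big_ord0 normc0 oppr0 expR0 expr0 mulr1 mul1r expr0n/=.
  by case: k => [|k]; rewrite ?expr0 ?fact0 ?mulr1// !expr0n/= mulr0.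
have -> : z = tcons (thead z, [tuple of behead z]).
  by rewrite [LHS]tuple_eta; exact/val_inj.
move: (thead z) [tuple of behead z] => z0 {}z.
rewrite integral_tuple_powerS; [|exact: mF|exact: F0].
pose f (p : R[i] * n.-tuple R[i]) := ((normc (hdot (tcons (z0, z)) (tcons p)) ^+ 2) ^+ k * expR (- sqnorm (tcons p)))%:E.
have mf : measurable_fun setT f by exact: (measurable_tcons_comp (mF n.+1 (tcons (z0, z)) k)).
rewrite (fubini_tonelli (m1 := lebC) (m2 := tuple_power lebC n) f mf); last by move=> p; exact: F0.
transitivity (\int[tuple_power lebC n]_t (\sum_(i < k.+1)
   (pi * ('C(k, i)%:R ^+ 2 * i`!%:R * (normc z0 ^+ 2) ^+ i))%:E *
   ((normc (hdot z t) ^+ 2) ^+ (k - i) * expR (- sqnorm t))%:E))%E.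
  apply: eq_integral => t _.
  transitivity (\int[lebC]_x ((expR (- sqnorm t))%:E *
     ((normc (z0 * conjc x + hdot z t) ^+ 2) ^+ k * expR (- (normc x ^+ 2)))%:E))%E.
    apply: eq_integral => x _; rewrite /f hdot_tcons sqnorm_tcons opprD expRD -EFinM.
    by congr EFin; ring.
  rewrite ge0_integralZl_EFin; last 4 first.
  - exact: measurableT.
  - by move=> w _; rewrite lee_fin mulr_ge0 ?exprn_ge0 ?expR_ge0 ?normc_ge0.
  - apply/measurable_EFinP; apply: measurable_funM.
      do 2 apply: measurable_funX; apply: measurable_fun_normc.
      apply: measurable_cadd; last exact: measurable_cst.
      apply: measurable_cmul; first exact: measurable_cst.
      by apply: measurable_conjc; exact: measurable_id.
    by apply: (measurableT_comp (@measurable_expR R)); exact: measurable_funN.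
  - exact: expR_ge0.
  rewrite gaussian_moment_affine -EFinM; under [RHS]eq_bigr do rewrite -EFinM.
  rewrite sumEFin; congr EFin; rewrite !mulr_sumr; apply: eq_bigr => i _; ring.
rewrite ge0_integral_sum; last 3 first.
- exact: measurableT.
- by move=> i; apply: emeasurable_funM => //; exact: mF.
- by move=> i w _; rewrite -EFinM lee_fin !mulr_ge0 ?exprn_ge0 ?expR_ge0 ?normc_ge0 ?pi_ge0.
under eq_bigr => i _.
  rewrite ge0_integralZl_EFin; last 4 first.
  - exact: measurableT.
  - by move=> w _; exact: F0.
  - exact: mF.
  - by rewrite !mulr_ge0 ?exprn_ge0 ?normc_ge0 ?pi_ge0.
  rewrite IH -EFinM; over.
rewrite sumEFin; congr EFin.
rewrite sqnorm_tcons (addrC (normc z0 ^+ 2)) (exprDn (sqnorm z)) mulr_sumr; apply: eq_bigr => i _.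
have ik : (i <= k)%N by rewrite -ltnS.
rewrite -(bin_fact ik) !natrM -[X in _ = _ * X]mulr_natl (exprS pi n).
move: (pi : R) (pi ^+ n) (sqnorm z ^+ _) (_ ^+ i) => p pn sz zi; ring.
Qed.

End gaussian_moments.

(** * Moments of the ball *)

Section ball_moments.
Context {R : realType}.
Notation leb := (@lebesgue_measure R).
Notation lebC := (@lebesgue_C R).
Local Notation D0 := (`]0%R, +oo[%classic : set R).
Local Opaque Gamma eGamma.

(* [powR] at a negative base is not [0], whereas the weights below must vanish off the ball. *)
Definition ppow (t x : R) : R := \1_D0 x * x `^ t.

Lemma ppow_ge0 t x : 0 <= ppow t x.
Proof. by rewrite mulr_ge0 ?powR_ge0// indicE. Qed.

Lemma ppow_gt t x : 0 < x -> ppow t x = x `^ t.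
Proof. by move=> x0; rewrite /ppow indicE mem_set ?mul1r//= in_itv/= x0. Qed.

Lemma ppow_le t x : x <= 0 -> ppow t x = 0.
Proof.
by move=> x0; rewrite /ppow indicE memNset ?mul0r//= in_itv/= andbT; apply/negP; rewrite -leNgt.
Qed.

Lemma ppowM t s x : 0 < s -> ppow t (s * x) = s `^ t * ppow t x.
Proof.
move=> s0; have [x0|x0] := leP x 0.
  by rewrite !ppow_le ?mulr0// pmulr_rle0.
by rewrite !ppow_gt ?mulr_gt0// powRM// ltW.
Qed.

Lemma measurable_ppow t : measurable_fun setT (ppow t).
Proof.
apply: measurable_funM; last exact: measurable_powR.
exact: measurable_indic.
Qed.

(** With [r = |w|^2], this Laplace transform of the weight [(s - |w|^2)_+ ^ t] is what produces the
    Gaussian [expR (- |w|^2)]. *)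
Lemma integral_ppow_shift (t r : R) : -1 < t -> 0 <= r ->
  (\int[leb]_(s in D0) (expR (- s) * ppow t (s - r))%:E = (expR (- r) * Gamma (t + 1))%:E)%E.
Proof.
move=> t1 r0.
have mg : measurable_fun setT (fun s : R => (expR (- s) * ppow t (s - r))%:E).
  apply/measurable_EFinP; apply: measurable_funM.
    by apply: (measurableT_comp (@measurable_expR R)); exact: measurable_funN.
  by apply: (measurableT_comp (@measurable_ppow t)); apply: measurable_funD.
transitivity (\int[leb]_s (expR (- s) * ppow t (s - r))%:E)%E.
  rewrite integral_mkcond; apply: eq_integral => s _; rewrite patchE; case: ifPn => //.
  rewrite notin_setE/= in_itv/= andbT => /negP; rewrite -leNgt => s0.
  by rewrite ppow_le ?mulr0// subr_le0 (le_trans s0).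
rewrite (@integral_affine _ 1 r _ (oner_neq0 _) mg); last first.
  by move=> s; rewrite lee_fin mulr_ge0 ?expR_ge0 ?ppow_ge0.
rewrite normr1 mul1e.
transitivity (\int[leb]_(s in D0) ((expR (- r))%:E * (s `^ (t + 1 - 1) * expR (- s))%:E))%E.
  rewrite [RHS]integral_mkcond; apply: eq_integral => s _.
  rewrite mul1r addrK patchE; case: ifPn.
    rewrite inE/= in_itv/= andbT => s0; rewrite ppow_gt// addrK opprD expRD -EFinM.
    by congr EFin; ring.
  rewrite notin_setE/= in_itv/= andbT => /negP; rewrite -leNgt => s0.
  by rewrite ppow_le ?mulr0.
rewrite ge0_integralZl_EFin; last 4 first.
- exact: measurable_itv.
- by move=> s _; rewrite lee_fin mulr_ge0 ?expR_ge0 ?powR_ge0.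
- exact: measurable_gamma_integrand1.
- exact: expR_ge0.
by rewrite -eGammaE GammaE -?EFinM//; lra.
Qed.

Section moment.
Variables (n : nat) (z : n.-tuple R[i]) (k : nat).
Let phi (w : n.-tuple R[i]) := (normc (hdot z w) ^+ 2) ^+ k.

Let phi0 w : 0 <= phi w.
Proof. by rewrite ?exprn_ge0 ?normc_ge0. Qed.

Let mphi : measurable_fun setT phi.
Proof. exact: measurable_hdot_pow. Qed.

Let H t s := (\int[tuple_power lebC n]_w (phi w * ppow t (s - sqnorm w))%:E)%E.

Let mH t s : measurable_fun setT (fun w => (phi w * ppow t (s - sqnorm w))%:E).
Proof.
apply/measurable_EFinP; apply: measurable_funM => //.
apply: (measurableT_comp (@measurable_ppow t)); apply: measurable_funB => //.
exact: measurable_sqnorm.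
Qed.

Let H_ge0 t s : (0 <= H t s)%E.
Proof. by apply: integral_ge0 => w _; rewrite lee_fin mulr_ge0 ?ppow_ge0. Qed.

Let H_scale t s : 0 < s -> H t s = ((s `^ ((n + k)%:R + t))%:E * H t 1)%E.
Proof.
move=> s0.
have [c c0 cE] : exists2 c : R[i], c != 0 & normc c ^+ 2 = s.
  exists (Num.sqrt s)%:C%C; last by rewrite normc_real ger0_norm ?sqrtr_ge0// sqr_sqrtr// ltW.
  by rewrite eq_complex/= eqxx andbT gt_eqF// sqrtr_gt0.
rewrite /H (integral_tuple_power_cscale c0 (mH t s)); last first.
  by move=> w; rewrite lee_fin mulr_ge0 ?ppow_ge0.
rewrite cE.
transitivity ((s ^+ n)%:E * \int[tuple_power lebC n]_w ((s ^+ k * s `^ t)%:E *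
    (phi w * ppow t (1 - sqnorm w))%:E))%E.
  congr (_ * _)%E; apply: eq_integral => w _.
  rewrite sqnorm_scale cE -[s in s - _]mulr1 -mulrBr ppowM// /phi hdot_scale.
  rewrite normcM normc_conj (exprMn 2 (normc c)) cE (exprMn k s) -EFinM; congr EFin.
  by rewrite mulrACA.
rewrite ge0_integralZl_EFin; last 4 first.
- exact: measurableT.
- by move=> w _; rewrite lee_fin mulr_ge0 ?ppow_ge0.
- exact: mH.
- by rewrite mulr_ge0 ?powR_ge0// exprn_ge0// ltW.
rewrite muleA -EFinM; congr (_%:E * _)%E.
rewrite mulrA -exprD -powR_mulrn ?ltW// -powRD//.
by apply/implyP => _; rewrite gt_eqF.
Qed.

(** The integral of [expR (- s) * H t s] over [s > 0] is computed in two ways. Homogeneity in [s]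
    gives [Gamma (n+k+t+1) * H t 1]; Tonelli gives [Gamma (t+1)] times the Gaussian moment. *)
Let H1E t : -1 < t -> H t 1 =
  (pi ^+ n * k`!%:R * sqnorm z ^+ k * Gamma (t + 1) / Gamma ((n + k)%:R + t + 1))%:E.
Proof.
move=> t1.
have x0 : 0 < (n + k)%:R + t + 1 by have : 0 <= (n + k)%:R :> R by []; lra.
have G0 := Gamma_gt0 x0.
suff E : ((Gamma ((n + k)%:R + t + 1))%:E * H t 1 =
    (pi ^+ n * k`!%:R * sqnorm z ^+ k * Gamma (t + 1))%:E)%E.
  rewrite EFinM -E muleAC -EFinM; move: (Gamma _) G0 => G G0.
  by rewrite divff ?mul1e// gt_eqF.
pose f (p : R * n.-tuple R[i]) := (expR (- p.1) * (phi p.2 * ppow t (p.1 - sqnorm p.2)))%:E.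
have mf : measurable_fun setT (f : measurableTypeR R * n.-tuple R[i] -> \bar R).
  apply/measurable_EFinP; apply: measurable_funM.
    apply: (measurableT_comp (@measurable_expR R)); apply: measurable_funN.
    exact: measurable_fst.
  apply: measurable_funM; first exact: (measurableT_comp mphi measurable_snd).
  apply: (measurableT_comp (@measurable_ppow t)); apply: measurable_funB.
    exact: measurable_fst.
  exact: (measurableT_comp (@measurable_sqnorm _ n) measurable_snd).
have f0 p : (0 <= f p)%E.
  by rewrite lee_fin mulr_ge0 ?expR_ge0// mulr_ge0 ?ppow_ge0.
have := @tonelli_setX _ _ _ _ R leb (tuple_power lebC n) D0 setT f (measurable_itv _) measurableT
  (measurable_funTS mf) (fun x y _ _ => f0 (x, y)).
rewrite (_ : \int[leb]_(x in D0) _ = (Gamma ((n + k)%:R + t + 1))%:E * H t 1)%E; last first.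
  transitivity (\int[leb]_(s in D0) ((s `^ ((n + k)%:R + t + 1 - 1) * expR (- s))%:E * H t 1))%E.
    apply: eq_integral => s; rewrite inE/= in_itv/= andbT => s0.
    rewrite addrK mulrC EFinM -muleA -H_scale//.
    rewrite -ge0_integralZl_EFin; last 4 first.
    - exact: measurableT.
    - by move=> w _; rewrite lee_fin mulr_ge0 ?ppow_ge0.
    - exact: mH.
    - exact: expR_ge0.
    by apply: eq_integral => w _; rewrite -EFinM.
  rewrite ge0_integralZr; last 4 first.
  - exact: measurable_itv.
  - exact: measurable_gamma_integrand1.
  - by move=> s _; rewrite lee_fin mulr_ge0 ?expR_ge0 ?powR_ge0.
  - exact: H_ge0.
  by rewrite -eGammaE GammaE.
move=> ->.
transitivity (\int[tuple_power lebC n]_w ((Gamma (t + 1))%:E * (phi w * expR (- sqnorm w))%:E))%E.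
  apply: eq_integral => w _.
  transitivity (\int[leb]_(s in D0) ((phi w)%:E * (expR (- s) * ppow t (s - sqnorm w))%:E))%E.
    by apply: eq_integral => s _; rewrite /f -EFinM; congr EFin => /=; rewrite mulrCA.
  rewrite ge0_integralZl_EFin; last 4 first.
  - exact: measurable_itv.
  - by move=> s _; rewrite lee_fin mulr_ge0 ?expR_ge0 ?ppow_ge0.
  - apply: measurable_funTS; apply/measurable_EFinP; apply: measurable_funM.
      by apply: (measurableT_comp (@measurable_expR R)); exact: measurable_funN.
    by apply: (measurableT_comp (@measurable_ppow t)); apply: measurable_funD.
  - exact: phi0.
  rewrite integral_ppow_shift ?sqnorm_ge0// -!EFinM; congr EFin.
  by rewrite mulrA mulrC.
rewrite ge0_integralZl_EFin; last 4 first.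
- exact: measurableT.
- by move=> w _; rewrite lee_fin mulr_ge0 ?expR_ge0.
- apply/measurable_EFinP; apply: measurable_funM => //.
  apply: (measurableT_comp (@measurable_expR R)); apply: measurable_funN.
  exact: measurable_sqnorm.
- by apply/ltW/Gamma_gt0; lra.
by rewrite gaussian_moment -EFinM mulrC.
Qed.

Lemma integral_ppow_moment t s : -1 < t -> 0 < s ->
  (\int[tuple_power lebC n]_w ((normc (hdot z w) ^+ 2) ^+ k * ppow t (s - sqnorm w))%:E =
  (s `^ ((n + k)%:R + t) * (pi ^+ n * k`!%:R * sqnorm z ^+ k * Gamma (t + 1) /
     Gamma ((n + k)%:R + t + 1)))%:E)%E.
Proof. by move=> t1 s0; rewrite -/(H t s) H_scale// H1E// EFinM. Qed.

End moment.

End ball_moments.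

Section ball_measure_integral.
Context {R : realType}.
Notation lebC := (@lebesgue_C R).
Local Opaque Gamma eGamma.

Lemma ge0_integral_mrestr d (T : measurableType d) (mu : {measure set T -> \bar R})
    (D : set T) (mD : measurable D) (F : T -> \bar R) :
  measurable_fun setT F -> (forall x, 0 <= F x)%E ->
  (\int[mrestr mu mD]_x F x = \int[mu]_(x in D) F x)%E.
Proof.
move=> mF F0.
rewrite -(setUv D) ge0_integral_setU//=; last 3 first.
- exact: measurableC.
- by rewrite setUv.
- by apply/disj_setPCl.
rewrite [X in (_ + X)%E](_ : _ = 0%E); last first.
  rewrite (@eq_measure_integral _ _ _ _ mzero)//.
    by rewrite integral_measure_zero.
  move=> A mA AD; rewrite /= /mrestr (_ : A `&` D = set0)// ?measure0//.
  by apply/disjoints_subset.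
rewrite adde0; apply: eq_measure_integral => A mA AD.
by rewrite /= /mrestr; congr (mu _); apply/setIidPl.
Qed.

Variable d : nat.
Let V := ball_volume R d.

Lemma cballE (w : d.-tuple R[i]) : cball R d w = (sqnorm w < 1).
Proof. by []. Qed.

Lemma ball_volume_gt0 : 0 < V.
Proof.
have [v [v0 E]] := ball_vol R d.
by rewrite /V /ball_volume E.
Qed.

Lemma integral_ball_measure (F : d.-tuple R[i] -> \bar R) :
  measurable_fun setT F -> (forall x, 0 <= F x)%E ->
  (\int[ball_measure R d]_w F w = (V^-1)%:E * \int[tuple_power lebC d]_(w in cball R d) F w)%E.
Proof.
move=> mF F0; rewrite /ball_measure ge0_integral_mscale//=.
by rewrite ge0_integral_mrestr.
Qed.

(** This is the moment with [k = 0] and [t = 0]; the point [z = 0] is a placeholder, as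
    [sqnorm z ^+ 0 = 1]. *)
Lemma ball_volumeE : V = pi ^+ d / Gamma (d%:R + 1).
Proof.
have [v [v0 E]] := ball_vol R d.
apply: EFin_inj; rewrite /V /ball_volume E fineK// -E.
have := @integral_ppow_moment R d [tuple of nseq d (0 : R[i])] 0%N 0 1 (ltrN10 R) ltr01.
rewrite powR1 mul1r fact0 expr0 !mulr1 addn0 addr0 add0r.
have -> : Gamma (1 : R) = 1 by have := @Gamma_nat R 0.
rewrite mulr1 => <-.
rewrite -[LHS]mul1e -integral_cst//; last exact: measurable_cball.
rewrite integral_mkcond; apply: eq_integral => w _.
rewrite patchE; case: ifPn.
  by rewrite inE cballE => w1; rewrite expr0 mul1r ppow_gt ?powRr0// subr_gt0.
rewrite notin_setE cballE => /negP; rewrite -leNgt => w1.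
by rewrite ppow_le ?mulr0// subr_le0.
Qed.

Lemma ball_moment (z : d.-tuple R[i]) k (t : R) : -1 < t ->
  (\int[ball_measure R d]_w ((1 - sqnorm w) `^ t * (normc (hdot z w) ^+ 2) ^+ k)%:E =
   (Gamma (d%:R + 1) * Gamma (t + 1) * k`!%:R / Gamma (d%:R + 1 + t + k%:R) * sqnorm z ^+ k)%:E)%E.
Proof.
move=> t1; rewrite integral_ball_measure; last 2 first.
- apply/measurable_EFinP; apply: measurable_funM.
    apply: (measurableT_comp (@measurable_powR R t)); apply: measurable_funB => //.
    exact: measurable_sqnorm.
  exact: measurable_hdot_pow.
- by move=> w; rewrite lee_fin mulr_ge0 ?powR_ge0 ?exprn_ge0 ?normc_ge0.
(* On the ball both powers agree, and off it [ppow] vanishes, so the integrand itself carries the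
   restriction to the ball. *)
transitivity ((V^-1)%:E * \int[tuple_power lebC d]_w
    ((normc (hdot z w) ^+ 2) ^+ k * ppow t (1 - sqnorm w))%:E)%E.
  congr (_ * _)%E; rewrite integral_mkcond; apply: eq_integral => w _.
  rewrite patchE; case: ifPn.
    by rewrite inE cballE => w1; rewrite ppow_gt ?subr_gt0// mulrC.
  rewrite notin_setE cballE => /negP; rewrite -leNgt => w1.
  by rewrite ppow_le ?mulr0// subr_le0.
rewrite integral_ppow_moment// powR1 mul1r -EFinM; congr EFin.
have d0 : 0 <= d%:R :> R by [].
have k0 : 0 <= k%:R :> R by [].
have -> : (d + k)%:R + t + 1 = d%:R + 1 + t + k%:R :> R by rewrite natrD; ring.
have := @ball_volume_gt0; rewrite ball_volumeE.
have : 0 < Gamma (d%:R + 1 : R) by apply: Gamma_gt0; lra.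
have : 0 < Gamma (d%:R + 1 + t + k%:R : R) by apply: Gamma_gt0; lra.
have : 0 < (pi : R) ^+ d by rewrite exprn_gt0// pi_gt0.
move: (pi ^+ d) (Gamma (d%:R + 1 : R)) (Gamma (d%:R + 1 + t + k%:R)) (Gamma (t + 1)) (sqnorm z ^+ k).
move=> p g1 g2 g3 s p0 g10 g20 _.
by field; rewrite !gt_eqF.
Qed.

Lemma ball_moment_lt (z : d.-tuple R[i]) k (r : R) : 0 < r <= 1 ->
  (\int[ball_measure R d]_(w in [set w : d.-tuple R[i] | (sqnorm w < r)%R]) ((normc (hdot z w) ^+ 2) ^+ k)%:E =
   (r ^+ (d + k) * (Gamma (d%:R + 1) * k`!%:R / Gamma (d%:R + 1 + k%:R)) * sqnorm z ^+ k)%:E)%E.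
Proof.
move=> /andP[r0 r1].
have mphi : measurable_fun setT (fun w : d.-tuple R[i] => (normc (hdot z w) ^+ 2) ^+ k).
  exact: measurable_hdot_pow.
have mps : measurable_fun setT (fun w : d.-tuple R[i] => ppow 0 (r - sqnorm w)).
  apply: (measurableT_comp (@measurable_ppow R 0)); apply: measurable_funB => //.
  exact: measurable_sqnorm.
transitivity (\int[ball_measure R d]_w
    ((normc (hdot z w) ^+ 2) ^+ k * ppow 0 (r - sqnorm w))%:E)%E.
  rewrite integral_mkcond; apply: eq_integral => w _; rewrite patchE; case: ifPn.
    by rewrite inE/= => w1; rewrite ppow_gt ?subr_gt0// powRr0 mulr1.
  rewrite notin_setE/= => /negP; rewrite -leNgt => w1.
  by rewrite ppow_le ?mulr0// subr_le0.
rewrite integral_ball_measure; last 2 first.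
- by apply/measurable_EFinP; exact: measurable_funM.
- by move=> w; rewrite lee_fin mulr_ge0 ?ppow_ge0 ?exprn_ge0 ?normc_ge0.
transitivity ((V^-1)%:E * \int[tuple_power lebC d]_w
    ((normc (hdot z w) ^+ 2) ^+ k * ppow 0 (r - sqnorm w))%:E)%E.
  congr (_ * _)%E; rewrite integral_mkcond; apply: eq_integral => w _.
  rewrite patchE; case: ifPn => //.
  rewrite notin_setE cballE => /negP; rewrite -leNgt => w1.
  by rewrite ppow_le ?mulr0// subr_le0 (le_trans r1).
rewrite integral_ppow_moment// ?ltrN10// addr0 powR_mulrn ?ltW// -EFinM; congr EFin.
have d0 : 0 <= d%:R :> R by [].
have k0 : 0 <= k%:R :> R by [].
have -> : (d + k)%:R + 1 = d%:R + 1 + k%:R :> R by rewrite natrD; ring.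
rewrite add0r; have -> : Gamma (1 : R) = 1 by have := @Gamma_nat R 0.
have := @ball_volume_gt0; rewrite ball_volumeE.
have : 0 < Gamma (d%:R + 1 : R) by apply: Gamma_gt0; lra.
have : 0 < Gamma (d%:R + 1 + k%:R : R) by apply: Gamma_gt0; lra.
have : 0 < (pi : R) ^+ d by rewrite exprn_gt0// pi_gt0.
move: (pi ^+ d) (Gamma (d%:R + 1 : R)) (Gamma (d%:R + 1 + k%:R)) (sqnorm z ^+ k) (r ^+ _).
move=> p g1 g2 s x p0 g10 g20 _.
by field; rewrite !gt_eqF.
Qed.

End ball_measure_integral.

(** * The binomial series *)

Section binomial_coefficients.
Context {R : realType}.
Local Opaque Gamma.

(** The Taylor coefficients [a (a+1) ... (a+m-1) / m!] of [(1 - x) ^ (- a)]. *)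
Definition bcoef (a : R) m : R := Gamma (a + m%:R) / (Gamma a * m`!%:R).

Lemma bcoef_gt0 a m : 0 < a -> 0 < bcoef a m.
Proof.
move=> a0; apply: divr_gt0; first by apply: Gamma_gt0; rewrite ltr_pwDl.
by rewrite mulr_gt0 ?Gamma_gt0// ltr0n fact_gt0.
Qed.

Lemma bcoef_ge0 a m : 0 < a -> 0 <= bcoef a m.
Proof. by move=> a0; apply/ltW/bcoef_gt0. Qed.

Lemma bcoef0 a : 0 < a -> bcoef a 0 = 1.
Proof.
move=> a0; rewrite /bcoef addr0 fact0 mulr1 divff// gt_eqF//.
exact: Gamma_gt0.
Qed.

(** The differential equation [(1 - x) f' = a f] read on coefficients. Combined with [bcoef_shift],
    it shows that differentiating the series replaces [a] by [a + 1], up to a factor [a]. *)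
Lemma bcoefS a m : 0 < a -> m.+1%:R * bcoef a m.+1 = (a + m%:R) * bcoef a m.
Proof.
move=> a0; have am : 0 < a + m%:R by rewrite ltr_pwDl.
have := Gamma_gt0 a0.
rewrite /bcoef -natr1 addrA (GammaS am) factS natrM -natr1.
move: (Gamma _) (Gamma _) => g h h0.
have m0 : m`!%:R != 0 :> R by rewrite pnatr_eq0 -lt0n fact_gt0.
have m1 : m%:R + 1 != 0 :> R by rewrite natr1 pnatr_eq0.
by field; rewrite m0 m1 gt_eqF.
Qed.

Lemma bcoef_shift a m : 0 < a -> (a + m%:R) * bcoef a m = a * bcoef (a + 1) m.
Proof.
move=> a0; have am : 0 < a + m%:R by rewrite ltr_pwDl.
have := Gamma_gt0 a0.
rewrite /bcoef addrAC (GammaS am) (GammaS a0).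
move: (Gamma _) (Gamma _) => g h h0.
have m0 : m`!%:R != 0 :> R by rewrite pnatr_eq0 -lt0n fact_gt0.
by field; rewrite m0 !gt_eqF.
Qed.

Lemma bcoef_sum_le a x n : 0 < a -> 0 <= x < 1 ->
  \sum_(k < n) bcoef a k * x ^+ k <= (1 - x) `^ (- a).
Proof.
move=> a0 x01; have := Gamma_binomial_partial_sum n a0 x01.
rewrite -ler_pdivrMl; last exact: Gamma_gt0.
suff -> : (Gamma a)^-1 * \sum_(k < n) (Gamma (a + k%:R) / k`!%:R * x ^+ k) =
    \sum_(k < n) bcoef a k * x ^+ k by [].
rewrite mulr_sumr; apply: eq_bigr => k _; rewrite /bcoef invfM !mulrA.
by congr (_ * _ * _); rewrite mulrC.
Qed.

(** Absolute convergence: the partial sums of the absolute values are at most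
    [C * (1 - K * rho) ^ (- b)]. *)
Lemma is_cvg_pseries_bcoef (c : R^nat) C b rho K : 0 <= C -> 0 < b -> 0 <= rho -> 0 <= K ->
  K * rho < 1 -> (forall m, `|c m| <= C * bcoef b m * rho ^+ m) -> cvgn (pseries c K).
Proof.
move=> C0 b0 rho0 K0 Krho cb; apply: normed_cvg; apply: nondecreasing_is_cvgn.
  by apply: nondecreasing_series => n _ _; exact: normr_ge0.
exists (C * (1 - K * rho) `^ (- b)) => _ [n _ <-].
rewrite /= seriesEord.
apply: (@le_trans _ _ (C * \sum_(k < n) bcoef b k * (K * rho) ^+ k)); last first.
  by rewrite ler_wpM2l// bcoef_sum_le// mulr_ge0.
rewrite mulr_sumr; apply: ler_sum => k _.
rewrite normrM normrX (ger0_norm K0) exprMn.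
rewrite (le_trans (ler_wpM2r _ (cb k))) ?exprn_ge0//.
by rewrite -!mulrA [rho ^+ k * _]mulrC.
Qed.

End binomial_coefficients.

(** * The principal power on the right half-plane *)

Section principal_power.
Context {R : realType}.
Implicit Types z : R[i].

Lemma carg_atan z : 0 < complex.Re z -> carg z = atan (complex.Im z / complex.Re z).
Proof.
case: z => x y /= x0; rewrite /carg/=.
have xn0 : x != 0 by rewrite gt_eqF.
have -> : x / Num.sqrt (x ^+ 2 + y ^+ 2) = cos (atan (y / x)).
  rewrite cos_atan.
  have -> : 1 + (y / x) ^+ 2 = (x ^+ 2 + y ^+ 2) / x ^+ 2 by field.
  rewrite sqrtrM ?addr_ge0 ?sqr_ge0// sqrtrV ?sqr_ge0// sqrtr_sqr gtr0_norm//.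
  by rewrite invfM invrK mulrC.
have a1 := atan_gtNpi2 (y / x); have a2 := atan_ltpi2 (y / x).
have p0 := @pi_gt0 R.
have [y0|y0] := leP 0 y.
  rewrite cosK// in_itv/=; apply/andP; split; last lra.
  by rewrite -atan0 le_atan// divr_ge0// ltW.
rewrite cosKN ?opprK//; apply/andP; split; first lra.
by rewrite -atan0 le_atan// nmulr_rle0// invr_ge0 ltW.
Qed.

Lemma cpowE z a : 0 < complex.Re z ->
  let L := expR (a / 2 * ln (complex.Re z ^+ 2 + complex.Im z ^+ 2)) in
  let t := a * atan (complex.Im z / complex.Re z) in
  cpow z a = (L * cos t +i* (L * sin t))%C.
Proof.
move=> z0 /=; rewrite /cpow carg_atan//.
have -> : normc z `^ a = expR (a / 2 * ln (complex.Re z ^+ 2 + complex.Im z ^+ 2)).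
  rewrite -Defs.normcE; have n0 : 0 < normc z.
    rewrite lt_neqAle normc_ge0 andbT eq_sym; apply/eqP => /eq0_normc zE.
    by move: z0; rewrite zE ltxx.
  rewrite /powR gt_eqF// lnXn//; congr expR.
  by rewrite mulr2n; field.
by apply/eqP; rewrite eq_complex/= !mul0r subr0 addr0 !eqxx.
Qed.

Lemma normc_cpow z a : normc (cpow z a) = normc z `^ a.
Proof.
rewrite /cpow normcM normc_real ger0_norm ?powR_ge0//.
by rewrite /= cos2Dsin2 sqrtr1 mulr1.
Qed.

Lemma normc_le_Re z : `|complex.Re z| <= normc z.
Proof.
case: z => x y /=; rewrite -sqrtr_sqr.
by rewrite ler_sqrt ?addr_ge0 ?sqr_ge0// lerDl sqr_ge0.
Qed.

Lemma normc_le_Im z : `|complex.Im z| <= normc z.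
Proof.
case: z => x y /=; rewrite -sqrtr_sqr.
by rewrite ler_sqrt ?addr_ge0 ?sqr_ge0// lerDr sqr_ge0.
Qed.

End principal_power.

(** * Convergence of the binomial series in the complex unit disc *)

Section binomial_series.
Context {R : realType}.
Local Opaque Gamma bcoef.

Definition bsum (a : R) (u : R[i]) n : R[i] := \sum_(m < n) (bcoef a m)%:C%C * u ^+ m.

Section series.
Variables (a : R) (u : R[i]).
Hypotheses (a0 : 0 < a) (u1 : normc u < 1).

Let p := complex.Re u.
Let q := complex.Im u.
Let rho := normc u.
(** A radius with [1 < K] and [K * rho < 1], so that the whole segment [0 <= r <= 1], endpoint
    included, lies strictly inside the region of convergence. *)
Let K := 2 / (1 + rho).

Let rho0 : 0 <= rho. Proof. exact: normc_ge0. Qed.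
Let K1 : 1 < K.
Proof. by rewrite /K ltr_pdivlMr ?mul1r; have := rho0; have := u1; rewrite -/rho; lra. Qed.
Let Krho : K * rho < 1.
Proof. by rewrite /K mulrAC ltr_pdivrMr ?mul1r; have := rho0; have := u1; rewrite -/rho; lra. Qed.
Let K0 : 0 <= K. Proof. by have := K1; lra. Qed.

Let a1 : 0 < a + 1. Proof. by rewrite addr_gt0. Qed.
Let a2 : 0 < a + 1 + 1. Proof. by rewrite addr_gt0. Qed.

(** Termwise differentiation asks for convergence of the series and of its first two formal
    derivatives. These have coefficients controlled by [bcoef] at [a], [a + 1] and [a + 2]. *)
Let bound (e : nat -> R) : (forall m, `|e m| <= rho ^+ m) ->
  [/\ cvgn (pseries (fun m => bcoef a m * e m) K),
      cvgn (pseries (pseries_diffs (fun m => bcoef a m * e m)) K) &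
      cvgn (pseries (pseries_diffs (pseries_diffs (fun m => bcoef a m * e m))) K)].
Proof.
move=> eb.
have d1 m : pseries_diffs (fun m => bcoef a m * e m) m = a * bcoef (a + 1) m * e m.+1.
  by rewrite /pseries_diffs mulrA (bcoefS _ a0) (bcoef_shift _ a0).
have d2 m : pseries_diffs (pseries_diffs (fun m => bcoef a m * e m)) m =
    a * (a + 1) * bcoef (a + 1 + 1) m * e m.+2.
  rewrite {1}/pseries_diffs d1 mulrA mulrCA (bcoefS _ a1) (bcoef_shift _ a1).
  by rewrite mulrA.
have ebw m j : `|e (m + j)%N| <= rho ^+ m.
  rewrite (le_trans (eb _))// exprD ler_piMr ?exprn_ge0// exprn_ile1//.
  exact: ltW.
split.
- apply: (is_cvg_pseries_bcoef ler01 a0 rho0 K0 Krho) => m.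
  by rewrite mul1r normrM ger0_norm ?bcoef_ge0// ler_wpM2l ?bcoef_ge0.
- apply: (is_cvg_pseries_bcoef (ltW a0) a1 rho0 K0 Krho) => m.
  have h : 0 <= a * bcoef (a + 1) m by rewrite mulr_ge0 ?bcoef_ge0// ltW.
  rewrite d1 normrM ger0_norm//; apply: ler_wpM2l => //.
  by have := ebw m 1%N; rewrite addn1.
- apply: (is_cvg_pseries_bcoef (mulr_ge0 (ltW a0) (ltW a1)) a2 rho0 K0 Krho) => m.
  have h : 0 <= a * (a + 1) * bcoef (a + 1 + 1) m.
    by apply: mulr_ge0; [apply: mulr_ge0; exact: ltW|exact: bcoef_ge0].
  rewrite d2 normrM ger0_norm//; apply: ler_wpM2l => //.
  by have := ebw m 2%N; rewrite addn2.
Qed.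

Let pc m := complex.Re (u ^+ m).
Let qc m := complex.Im (u ^+ m).
Let pS m : pc m.+1 = p * pc m - q * qc m.
Proof. by rewrite /pc exprS cReM. Qed.
Let qS m : qc m.+1 = p * qc m + q * pc m.
Proof. by rewrite /qc exprS cImM. Qed.

Let pb m : `|pc m| <= rho ^+ m.
Proof. by rewrite -normcX normc_le_Re. Qed.
Let qb m : `|qc m| <= rho ^+ m.
Proof. by rewrite -normcX normc_le_Im. Qed.

Let Kr (r : R) : 0 <= r <= 1 -> `|r| < `|K|.
Proof.
by move=> /andP[r0 r1]; rewrite !ger0_norm//; have := K1; lra.
Qed.

(** The Euler operator [r d/dr] multiplies the [m]-th coefficient by [m]. *)
Let euler_cvg (c : R^nat) (r : R) : cvgn (pseries (pseries_diffs c) r) ->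
  pseries (fun m => m%:R * c m) r @ \oo --> r * limn (pseries (pseries_diffs c) r).
Proof.
move=> h; rewrite -cvg_shiftS.
have -> : [sequence pseries (fun m => m%:R * c m) r n.+1]_n =
    (fun n => r * pseries (pseries_diffs c) r n).
  apply/funext => n; rewrite /pseries !seriesEord/= big_ord_recl/= !mul0r add0r.
  rewrite mulr_sumr; apply: eq_bigr => m _; rewrite /pseries_diffs/= /bump leq0n add1n.
  by rewrite exprS; ring.
exact: cvgMr.
Qed.

(** [X r + i Y r] is the value [F r] of the binomial series at [r u], seen as two real power series
    in the real variable [r]. *)
Let X (r : R) : R := limn (pseries (fun m => bcoef a m * pc m) r).
Let Y (r : R) : R := limn (pseries (fun m => bcoef a m * qc m) r).
Let X' (r : R) : R := limn (pseries (pseries_diffs (fun m => bcoef a m * pc m)) r).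
Let Y' (r : R) : R := limn (pseries (pseries_diffs (fun m => bcoef a m * qc m)) r).

Let dX (r : R) : 0 <= r <= 1 -> is_derive r (1 : R) X (X' r).
Proof. by have [h1 h2 h3] := bound pb; move=> /Kr; exact: pseries_snd_diffs. Qed.
Let dY (r : R) : 0 <= r <= 1 -> is_derive r (1 : R) Y (Y' r).
Proof. by have [h1 h2 h3] := bound qb; move=> /Kr; exact: pseries_snd_diffs. Qed.

(** In complex form [F' = u (a F + r F')], that is, [(1 - r u) F' = a u F]. *)
Let ode (r : R) : 0 <= r <= 1 ->
  X' r = p * (a * X r + r * X' r) - q * (a * Y r + r * Y' r) /\
  Y' r = p * (a * Y r + r * Y' r) + q * (a * X r + r * X' r).
Proof.
move=> /Kr rK; have [h1 h2 h3] := bound pb; have [k1 k2 k3] := bound qb.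
have cX : pseries (fun m => bcoef a m * pc m) r @ \oo --> X r by exact: is_cvg_pseries_inside h1 rK.
have cY : pseries (fun m => bcoef a m * qc m) r @ \oo --> Y r by exact: is_cvg_pseries_inside k1 rK.
have cX' := is_cvg_pseries_inside h2 rK; have cY' := is_cvg_pseries_inside k2 rK.
have eX := euler_cvg cX'; have eY := euler_cvg cY'.
have cA : (fun n => a * pseries (fun m => bcoef a m * pc m) r n +
    pseries (fun m => m%:R * (bcoef a m * pc m)) r n) @ \oo --> a * X r + r * X' r.
  by apply: cvgD => //; exact: cvgMr.
have cB : (fun n => a * pseries (fun m => bcoef a m * qc m) r n +
    pseries (fun m => m%:R * (bcoef a m * qc m)) r n) @ \oo --> a * Y r + r * Y' r.
  by apply: cvgD => //; exact: cvgMr.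
split; apply/cvg_lim => //.
- rewrite [X in X @ \oo --> _](_ : _ = fun n =>
    p * (a * pseries (fun m => bcoef a m * pc m) r n + pseries (fun m => m%:R * (bcoef a m * pc m)) r n) -
    q * (a * pseries (fun m => bcoef a m * qc m) r n + pseries (fun m => m%:R * (bcoef a m * qc m)) r n)).
    by apply: cvgB; exact: cvgMr.
  apply/funext => n; rewrite /pseries !seriesEord/= !mulr_sumr -!big_split/= !mulr_sumr -sumrB.
  apply: eq_bigr => m _; rewrite /pseries_diffs mulrA (bcoefS _ a0) pS.
  by move: (bcoef a m) (r ^+ m) => b rm; ring.
- rewrite [X in X @ \oo --> _](_ : _ = fun n =>
    p * (a * pseries (fun m => bcoef a m * qc m) r n + pseries (fun m => m%:R * (bcoef a m * qc m)) r n) +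
    q * (a * pseries (fun m => bcoef a m * pc m) r n + pseries (fun m => m%:R * (bcoef a m * pc m)) r n)).
    by apply: cvgD; exact: cvgMr.
  apply/funext => n; rewrite /pseries !seriesEord/= !mulr_sumr -!big_split/= !mulr_sumr -big_split/=.
  apply: eq_bigr => m _; rewrite /pseries_diffs mulrA (bcoefS _ a0) qS.
  by move: (bcoef a m) (r ^+ m) => b rm; ring.
Qed.

(** [D r + i E r = 1 - r u]. *)
Let D (r : R) : R := 1 - r * p.
Let E (r : R) : R := - (r * q).

Let D0 (r : R) : 0 <= r <= 1 -> 0 < D r.
Proof.
move=> /andP[r0 r1]; rewrite /D subr_gt0.
have := normc_le_Re u; rewrite -/p -/rho => h.
have /ler_normlW h2 := h.
by have := u1; rewrite -/rho => h3; have := rho0; nra.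
Qed.

Let dD (r : R) : is_derive r (1 : R) D (- p).
Proof.
have h : is_derive r (1 : R) (fun r : R => 1 - r * p) (- p).
  by apply: is_derive_eq; rewrite /GRing.scale/=; ring.
exact: h.
Qed.
Let dE (r : R) : is_derive r (1 : R) E (- q).
Proof.
have h : is_derive r (1 : R) (fun r : R => - (r * q)) (- q).
  by apply: is_derive_eq; rewrite /GRing.scale/=; ring.
exact: h.
Qed.

(** [L] and [th] are the modulus and the argument of [(1 - r u) ^ a]. *)
Let L (r : R) : R := expR (a / 2 * ln (D r ^+ 2 + E r ^+ 2)).
Let th (r : R) : R := a * atan (E r / D r).
Let n2 (r : R) : R := D r ^+ 2 + E r ^+ 2.
Let n20 (r : R) : 0 <= r <= 1 -> 0 < n2 r.
Proof. by move=> r01; rewrite ltr_pwDl ?sqr_ge0// exprn_gt0// D0. Qed.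

Let dL (r : R) : 0 <= r <= 1 -> is_derive r (1 : R) L (L r * (a * ((- p * D r - q * E r) / n2 r))).
Proof.
move=> r01; have n0 := n20 r01.
have h1 : is_derive r (1 : R) n2 (2 * (- p * D r - q * E r)).
  have i1 := dD r; have i2 := dE r; rewrite /n2.
  by apply: is_derive_eq; rewrite /GRing.scale/=; ring.
have h2 := @is_derive1_comp _ (@ln R) n2 r _ _ (is_derive1_ln n0) h1.
have h3 := is_deriveZ (a / 2) h2.
have h4 := @is_derive1_comp _ expR (fun r : R => a / 2 * ln (n2 r)) r _ _ (is_derive_expR _) h3.
apply: (is_derive_eq h4); rewrite /GRing.scale/= -/(n2 r).
by rewrite /L -/(n2 r); congr (_ * _); field; rewrite gt_eqF.
Qed.

Let dth (r : R) : 0 <= r <= 1 -> is_derive r (1 : R) th (a * ((- q * D r + E r * p) / n2 r)).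
Proof.
move=> r01; have n0 := n20 r01; have d0 := D0 r01; have dn0 : D r != 0 by rewrite gt_eqF.
have h1 := is_deriveM (dE r) (is_deriveV dn0 (dD r)).
have h2 := @is_derive1_comp _ (@atan R) (fun r : R => E r / D r) r _ _ (is_derive1_atan _) h1.
have h3 := is_deriveZ a h2.
apply: (is_derive_eq h3); rewrite /GRing.scale/=.
have -> : 1 + (E r / D r) ^+ 2 = n2 r / D r ^+ 2 by rewrite /n2; field.
by congr (_ * _); field; rewrite dn0 gt_eqF.
Qed.

(** The two real equations of [ode] solved for [X'] and [Y']; the determinant of the system is
    [n2 r = |1 - r u|^2]. *)
Let solved (r : R) : 0 <= r <= 1 ->
  X' r = (D r * (a * (p * X r - q * Y r)) + E r * (a * (p * Y r + q * X r))) / n2 r /\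
  Y' r = (D r * (a * (p * Y r + q * X r)) - E r * (a * (p * X r - q * Y r))) / n2 r.
Proof.
move=> r01; have := n20 r01; have [] := ode r01; rewrite /n2 /D /E.
move: (X' r) (Y' r) (X r) (Y r) => x' y' x y ex ey n0.
have e1 : (1 - r * p) * x' + r * q * y' = a * (p * x - q * y) by lra.
have e2 : (1 - r * p) * y' - r * q * x' = a * (p * y + q * x) by lra.
rewrite -e1 -e2; split; field; rewrite gt_eqF//; move: n0; congr (_ < _); ring.
Qed.

(** [M + i N] is the product [F r * (1 - r u) ^ a]. Its derivative vanishes by the differential
    equation and its value at [r = 0] is 1, so at [r = 1] the series is the inverse of
    [(1 - u) ^ a]. *)
Let M (r : R) : R := X r * (L r * cos (th r)) - Y r * (L r * sin (th r)).
Let N (r : R) : R := X r * (L r * sin (th r)) + Y r * (L r * cos (th r)).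

Let dMN (r : R) : 0 <= r <= 1 -> is_derive r (1 : R) M 0 /\ is_derive r (1 : R) N 0.
Proof.
move=> r01; have i1 := dX r01; have i2 := dY r01; have i3 := dL r01; have i4 := dth r01.
have i5 := @is_derive1_comp _ (@cos R) th r _ _ (is_derive_cos _) i4.
have i6 := @is_derive1_comp _ (@sin R) th r _ _ (is_derive_sin _) i4.
have [eX eY] := solved r01; have nn0 : n2 r != 0 by rewrite gt_eqF ?n20.
split; rewrite /M /N; apply: is_derive_eq; rewrite /GRing.scale/= eX eY;
  move: (X r) (Y r) (L r) (cos _) (sin _) (D r) (E r) (n2 r) nn0 => x y l c s dd ee n nn0;
  by field.
Qed.

Let const_01 (f : R -> R) : (forall r : R, 0 <= r <= 1 -> is_derive r (1 : R) f 0) -> f 1 = f 0.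
Proof.
move=> df; have [c _] : exists2 c : R, c \in `]0, 1[ & f 1 - f 0 = (fun=> 0) c * (1 - 0).
  apply: MVT => //.
    by move=> x; rewrite in_itv/= => /andP[x0 x1]; apply: df; rewrite !ltW.
  apply: continuous_in_subspaceT => x; rewrite inE/= in_itv/= => /df[h _].
  exact/differentiable_continuous/derivable1_diffP.
by rewrite mul0r => /eqP; rewrite subr_eq0 => /eqP.
Qed.

Let pseries0 (c : R^nat) : limn (pseries c 0) = c 0%N.
Proof.
apply/cvg_lim => //; rewrite -cvg_shiftS.
rewrite [X in X @ \oo --> _](_ : _ = cst (c 0%N)); first exact: cvg_cst.
apply/funext => n; rewrite /pseries seriesEord/= big_ord_recl/= expr0 mulr1 big1 ?addr0//.
by move=> i _; rewrite expr0n mulr0.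
Qed.

Let MN1 : M 1 = 1 /\ N 1 = 0.
Proof.
have hM (r : R) : 0 <= r <= 1 -> is_derive r (1 : R) M 0 by move=> /dMN[].
have hN (r : R) : 0 <= r <= 1 -> is_derive r (1 : R) N 0 by move=> /dMN[].
rewrite (const_01 hM) (const_01 hN) /M /N /X /Y !pseries0 /pc /qc /=.
have -> : L 0 = 1.
  by rewrite /L /D /E !mul0r subr0 oppr0 expr1n expr0n addr0 ln1 mulr0 expR0.
have -> : th 0 = 0 by rewrite /th /E !mul0r oppr0 mul0r atan0 mulr0.
by rewrite cos0 sin0 bcoef0// !(mulr1, mulr0, mul0r, subr0, addr0).
Qed.

Lemma bsum_cvg :
  (fun n => complex.Re (bsum a u n)) @ \oo --> complex.Re (cpow (1 - u) a)^-1 /\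
  (fun n => complex.Im (bsum a u n)) @ \oo --> complex.Im (cpow (1 - u) a)^-1.
Proof.
have z01 : 0 <= (1 : R) <= 1 by rewrite ler01 lexx.
have Re1 : complex.Re (1 - u) = D 1 by rewrite /D /p mul1r; case: (u).
have Im1 : complex.Im (1 - u) = E 1 by rewrite /E /q mul1r; case: (u) => ? ?; rewrite /= sub0r.
have -> : (cpow (1 - u) a)^-1 = (X 1 +i* Y 1)%C.
  have e : (X 1 +i* Y 1)%C * cpow (1 - u) a = 1.
    rewrite cpowE Re1 ?D0// Im1 -/(L 1) -/(th 1).
    by have [eM eN] := MN1; apply/eqP; rewrite eq_complex/= -/(M 1) -/(N 1) eM eN !eqxx.
  have c0 : cpow (1 - u) a != 0.
    by apply/eqP => c0; move: e; rewrite c0 mulr0 => /esym/eqP; rewrite oner_eq0.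
  by apply: (mulIf c0); rewrite mulVf// e.
have [h1 _ _] := bound pb; have [k1 _ _] := bound qb.
have rK := Kr z01.
have ReS n : complex.Re (bsum a u n) = pseries (fun m => bcoef a m * pc m) 1 n.
  rewrite /pseries seriesEord/= /bsum; elim: n => [|n IH]; first by rewrite !big_ord0.
  by rewrite !big_ord_recr/= cReD IH cReM/= mul0r subr0 expr1n mulr1.
have ImS n : complex.Im (bsum a u n) = pseries (fun m => bcoef a m * qc m) 1 n.
  rewrite /pseries seriesEord/= /bsum; elim: n => [|n IH]; first by rewrite !big_ord0.
  by rewrite !big_ord_recr/= cImD IH cImM/= mul0r addr0 expr1n mulr1.
split.
- by under eq_fun do rewrite ReS; exact: is_cvg_pseries_inside h1 rK.
- by under eq_fun do rewrite ImS; exact: is_cvg_pseries_inside k1 rK.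
Qed.

End series.

Lemma normc_le_ReIm (z : R[i]) : normc z <= `|complex.Re z| + `|complex.Im z|.
Proof.
case: z => x y /=; rewrite -(@ler_pXn2r _ 2)// ?nnegrE ?addr_ge0 ?sqrtr_ge0//.
rewrite sqr_sqrtr ?addr_ge0 ?sqr_ge0// sqrrD !real_normK ?num_real//.
by rewrite lerD2r lerDl mulrn_wge0// mulr_ge0.
Qed.

Lemma bsum_sub a u n m : 0 < a -> (n <= m)%N ->
  normc (bsum a u m - bsum a u n) <=
  \sum_(k < m) bcoef a k * normc u ^+ k - \sum_(k < n) bcoef a k * normc u ^+ k.
Proof.
move=> a0; elim: m => [|m IH]; first by rewrite leqn0 => /eqP ->; rewrite !subrr normc0.
rewrite leq_eqVlt => /orP[/eqP ->|]; first by rewrite !subrr normc0.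
rewrite ltnS => /IH {}IH; rewrite /bsum !big_ord_recr/= -/(bsum a u m) -/(bsum a u n).
rewrite addrAC [leRHS]addrAC (le_trans (le_normcD _ _))// lerD//.
by rewrite normcM normc_real normcX ger0_norm// bcoef_ge0.
Qed.

(** The error is uniform in [u] because the tail is dominated by the real series at [rho]. The
    factor 2 in the witness comes from bounding the modulus by the real and imaginary parts, whose
    limits are taken separately. *)
Lemma bsum_tail a rho : 0 < a -> 0 <= rho < 1 -> exists2 tau : R^nat, tau @ \oo --> 0 &
  forall n u, normc u <= rho -> normc ((cpow (1 - u) a)^-1 - bsum a u n) <= tau n.
Proof.
move=> a0 /andP[rho0 rho1].
pose s (n : nat) : R := \sum_(k < n) bcoef a k * rho ^+ k.
have sE : s = pseries (bcoef a) rho by apply/funext => n; rewrite /pseries seriesEord.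
have nds : nondecreasing_seq s.
  apply/nondecreasing_seqP => n; rewrite /s big_ord_recr/= lerDl.
  by rewrite mulr_ge0 ?exprn_ge0 ?bcoef_ge0.
have cs : cvgn s.
  rewrite sE; apply: (@is_cvg_pseries_bcoef _ _ 1 a 1) => //; rewrite ?mulr1//.
  by move=> m; rewrite mul1r expr1n mulr1 ger0_norm// bcoef_ge0.
exists (fun n => 2 * (limn s - s n)).
  rewrite -(mulr0 2); apply: cvgMr; rewrite -(subrr (limn s)).
  by apply: cvgB => //; exact: cvg_cst.
move=> n u uR; have u1 : normc u < 1 by apply: le_lt_trans rho1.
have [cR cI] := bsum_cvg a0 u1.
have key m : (n <= m)%N -> normc (bsum a u m - bsum a u n) <= limn s - s n.
  move=> nm; rewrite (le_trans (bsum_sub u a0 nm))//.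
  apply: (@le_trans _ _ (s m - s n)); last by rewrite lerD2r nondecreasing_cvgn_le.
  rewrite /s -(subnKC nm) !big_split_ord/= [leLHS]addrAC subrr add0r [leRHS]addrAC subrr add0r.
  by apply: ler_sum => k _; rewrite ler_wpM2l ?bcoef_ge0// lerXn2r ?nnegrE ?normc_ge0.
rewrite (le_trans (normc_le_ReIm _))// mulr2n mulrDl mul1r.
have ReB (x y : R[i]) : complex.Re (x - y) = complex.Re x - complex.Re y by case: x; case: y.
have ImB (x y : R[i]) : complex.Im (x - y) = complex.Im x - complex.Im y by case: x; case: y.
apply: lerD.
- rewrite ReB.
  have c : (fun m => `|complex.Re (bsum a u m) - complex.Re (bsum a u n)|) @ \oo -->
      `|complex.Re (cpow (1 - u) a)^-1 - complex.Re (bsum a u n)|.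
    by apply: cvg_norm; apply: cvgB => //; exact: cvg_cst.
  rewrite -(cvg_lim _ c)//; apply: limr_le; first by apply/cvg_ex; eexists; exact: c.
  near=> m; rewrite -ReB (le_trans (normc_le_Re _))// key//.
  by near: m; exact: nbhs_infty_ge.
- rewrite ImB.
  have c : (fun m => `|complex.Im (bsum a u m) - complex.Im (bsum a u n)|) @ \oo -->
      `|complex.Im (cpow (1 - u) a)^-1 - complex.Im (bsum a u n)|.
    by apply: cvg_norm; apply: cvgB => //; exact: cvg_cst.
  rewrite -(cvg_lim _ c)//; apply: limr_le; first by apply/cvg_ex; eexists; exact: c.
  near=> m; rewrite -ImB (le_trans (normc_le_Im _))// key//.
  by near: m; exact: nbhs_infty_ge.
Unshelve. all: by end_near. Qed.

End binomial_series.

(** * Measurability of the principal power *)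

Section measurable_principal_power.
Context {R : realType}.

(** Agrees with [acos] on [[-1, 1]], where the ratio in [carg] always lies, and is constant on
    either side of it. Measurability on the whole line then follows from continuity on the open
    interval. *)
Let acos' (x : R) : R := if (-1 < x) && (x < 1) then acos x else if x <= -1 then pi else 0.

Let acos'E (x : R) : -1 <= x <= 1 -> acos x = acos' x.
Proof.
move=> /andP[x1 x2]; rewrite /acos'.
have [h1|h1] := ltP (-1) x; have [h2|h2] := ltP x 1 => //=.
- by rewrite (_ : x = 1) ?acos1//; apply/le_anti; rewrite x2 h2.
- by rewrite (_ : x = -1) ?acosN1//; apply/le_anti; rewrite x1 h1.
- by rewrite (_ : x = -1) ?acosN1//; apply/le_anti; rewrite x1 h1.
Qed.

Let macos' : measurable_fun setT acos'.
Proof.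
have mlt : measurable_fun setT (fun x : R => (-1 < x) && (x < 1)).
  by apply: measurable_and; apply: measurable_fun_ltr.
apply: measurable_fun_if => //.
  rewrite setTI (_ : _ @^-1` _ = `]-1, 1[%classic); last first.
    by apply/seteqP; split=> x /=; rewrite in_itv.
  apply: open_continuous_measurable_fun; first exact: interval_open.
  by move=> x; rewrite inE/= in_itv/= => /continuous_acos.
apply: measurable_funTS; apply: measurable_fun_ifT => //.
exact: measurable_fun_ler.
Qed.

Let normc_ratio (z : R[i]) : -1 <= complex.Re z / normc z <= 1.
Proof.
have [->|z0] := eqVneq z 0; first by rewrite /= mul0r lerN10 ler01.
have n0 : 0 < normc z.
  by rewrite lt_neqAle normc_ge0 eq_sym andbT; apply: contra z0 => /eqP/eq0_normc ->.
rewrite -ler_norml normrM normrV ?unitfE ?gt_eqF// (gtr0_norm n0).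
by rewrite ler_pdivrMr// mul1r normc_le_Re.
Qed.

Lemma measurable_carg : measurable_fun setT (@carg R).
Proof.
have m : measurable_fun setT (fun z : R[i] => acos' (complex.Re z * normc z `^ (- 1))).
  apply: (measurableT_comp macos'); apply: measurable_funM; first exact: measurable_Re.
  exact: (measurableT_comp (@measurable_powR R (- 1)) (@measurable_normc R)).
rewrite (_ : @carg R = fun z => if 0 <= complex.Im z then acos' (complex.Re z * normc z `^ (- 1))
  else - acos' (complex.Re z * normc z `^ (- 1))); last first.
  by apply/funext => z; rewrite /carg powR_inv1 ?normc_ge0// acos'E.
apply: measurable_fun_ifT => //; last exact: measurable_funN.
by apply: measurable_fun_ler => //; exact: measurable_Im.
Qed.

Lemma measurable_cpow (a : R) : measurable_fun setT (fun z : R[i] => cpow z a).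
Proof.
have mt : measurable_fun setT (fun z : R[i] => a * carg z).
  by apply: measurable_funM => //; exact: measurable_carg.
apply: measurable_cmul; apply: measurable_fun_complex => //=.
- exact: (measurableT_comp (@measurable_powR R a) (@measurable_normc R)).
- by apply: (measurableT_comp _ mt); apply: continuous_measurable_fun; exact: continuous_cos.
- by apply: (measurableT_comp _ mt); apply: continuous_measurable_fun; exact: continuous_sin.
Qed.

Lemma measurable_cinv d (T : measurableType d) (f : T -> R[i]) :
  measurable_fun setT f -> measurable_fun setT (fun x => (f x)^-1).
Proof.
move=> mf; rewrite (_ : (fun x => _) =
  fun x => ((normc (f x) ^+ 2) `^ (- 1))%:C%C * conjc (f x)); last first.
  apply/funext => x; rewrite powR_inv1 ?sqr_ge0//; move: (f x) => y.
  have -> : ((normc y ^+ 2)^-1)%:C%C = (y * conjc y)^-1 by rewrite -sqr_normcE fmorphV.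
  have [->|y0] := eqVneq y 0; first by rewrite mul0r invr0 mul0r.
  by rewrite invfM -mulrA mulVf ?mulr1// fmorph_eq0.
apply: measurable_cmul; last exact: measurable_conjc.
apply: measurable_fun_complex => //=.
apply: (measurableT_comp (@measurable_powR R (- 1))); apply: measurable_funX.
exact: measurable_fun_normc.
Qed.

End measurable_principal_power.

(** * Pointwise bounds on the ball and rotation averages *)

Section ball_pointwise.
Context {R : realType} (d : nat).
Implicit Types z w : d.-tuple R[i].

Lemma normc_sum (I : Type) (s : seq I) (F : I -> R[i]) :
  normc (\sum_(i <- s) F i) <= \sum_(i <- s) normc (F i).
Proof.
elim: s => [|i s IH]; first by rewrite !big_nil normc0.
by rewrite !big_cons (le_trans (le_normcD _ _))// lerD2l.
Qed.

(** AM-GM in each coordinate. Though weaker than Cauchy-Schwarz, it keeps [hdot z w] in a fixed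
    smaller disc when [z] is fixed and [w] runs over the ball. *)
Lemma normc_hdot_le z w : 2 * normc (hdot z w) <= sqnorm z + sqnorm w.
Proof.
rewrite /sqnorm -big_split/=.
apply: (@le_trans _ _ (2 * \sum_(j < d) normc (tnth z j * conjc (tnth w j)))).
  by rewrite ler_pM2l// normc_sum.
rewrite mulr_sumr; apply: ler_sum => j _; rewrite normcM normc_conj.
have := sqr_ge0 (normc (tnth z j) - normc (tnth w j)); rewrite sqrrB -mulr_natl; lra.
Qed.

Lemma normc_hdot_lt1 z w : sqnorm z < 1 -> sqnorm w < 1 -> normc (hdot z w) < 1.
Proof. by have := normc_hdot_le z w; lra. Qed.

Lemma ball_measureC : ball_measure R d (~` cball R d) = 0%E.
Proof. by rewrite /= /mscale/= /mrestr/= setICl measure0 mule0. Qed.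

Lemma ae_cball : {ae ball_measure R d, forall w, sqnorm w < 1}.
Proof.
exists (~` cball R d); split => //.
- by apply: measurableC; exact: measurable_cball.
- exact: ball_measureC.
Qed.

Lemma ge0_integral_cball (F : d.-tuple R[i] -> \bar R) :
  measurable_fun setT F -> (forall x, 0 <= F x)%E ->
  (\int[ball_measure R d]_w F w = \int[ball_measure R d]_(w in cball R d) F w)%E.
Proof.
move=> mF F0.
have mB := @measurable_cball R d.
rewrite (@ge0_negligible_integral _ _ _ _ _ (~` cball R d))//.
- by rewrite setTD setCK.
- exact: measurableC.
- exact: ball_measureC.
Qed.

Lemma ball_rotation_average N (rt : R[i]) (F : d.-tuple R[i] -> \bar R) :
  N.-primitive_root rt -> measurable_fun setT F -> (forall x, 0 <= F x)%E ->
  (\int[ball_measure R d]_w \sum_(j < N) F (tscale (rt ^+ j)%R w) =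
  N%:R%:E * \int[ball_measure R d]_w F w)%E.
Proof.
move=> pr mF F0; have mB := @measurable_cball R d.
have ms j : measurable_fun setT (fun w => F (tscale (rt ^+ j)%R w)).
  exact: (measurableT_comp mF (measurable_tscale _)).
rewrite integral_ball_measure; last 2 first.
- by apply: emeasurable_sum.
- by move=> w; apply: sume_ge0.
rewrite integral_ball_measure// muleCA; congr (_ * _)%E.
rewrite [X in (_ * X)%E]integral_mkcond -(integral_rotation_average pr); last 2 first.
- exact: (measurable_restrictT F mB).1 (measurable_funTS mF).
- by move=> w; rewrite patchE; case: ifPn.
rewrite integral_mkcond; apply: eq_integral => w _; rewrite patchE.
have inB j : (tscale (rt ^+ j) w \in cball R d) = (w \in cball R d).
  apply/idP/idP; rewrite !inE !cballE sqnorm_scale normcX (normc_prim_root pr) !expr1n mul1r//.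
case: ifPn => wB; first by apply: eq_bigr => j _; rewrite patchE inB wB.
by rewrite big1// => j _; rewrite patchE inB (negbTE wB).
Qed.

End ball_pointwise.

(** * The Forelli-Rudin estimate *)

Lemma limn_einf_le (R : realType) (u : (\bar R)^nat) M :
  (forall n, u n <= M)%E -> (limn_einf u <= M)%E.
Proof.
move=> uM; rewrite limn_einf_lim; apply: lime_le; first exact: is_cvg_einfs.
apply: nearW => n; apply: le_trans (uM n); apply: ereal_inf_lbound.
by exists n => //=.
Qed.

Section forelli_rudin.
Context {R : realType} (d : nat).
Implicit Types z w : d.-tuple R[i].
Local Opaque Gamma eGamma bcoef.

Lemma bcoefE (a : R) k : bcoef a k = Gamma (a + k%:R) / (Gamma a * k`!%:R).
Proof. by []. Qed.

Lemma measurable_weight t : measurable_fun setT (fun w : d.-tuple R[i] => (1 - sqnorm w) `^ t).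
Proof.
apply: (measurableT_comp (@measurable_powR R t)); apply: measurable_funB => //.
exact: measurable_sqnorm.
Qed.

Lemma measurable_bsum_hdotr b z n : measurable_fun setT (fun w => bsum b (hdot z w) n).
Proof.
apply: measurable_csum => m; apply: measurable_cmul; first exact: measurable_cst.
by apply: measurable_cexp; exact: measurable_hdotr.
Qed.

(** The powers of [hdot z w] are orthogonal for a radial weight. This is obtained by averaging over
    rotations by [(n+1)]-th roots of unity, which separate the degrees below [n]. *)
Lemma bsum_moment b z n (t : R) : -1 < t ->
  (\int[ball_measure R d]_w ((1 - sqnorm w) `^ t * normc (bsum b (hdot z w) n) ^+ 2)%:E =
   (\sum_(k < n) bcoef b k ^+ 2 *
     (Gamma (d%:R + 1) * Gamma (t + 1) * k`!%:R / Gamma (d%:R + 1 + t + k%:R) * sqnorm z ^+ k))%:E)%E.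
Proof.
move=> t1.
have [rt prt] := @prim_root_exists R n.+1 isT.
(* [hdot] is conjugate linear in [w], so rotating [w] by [rt] rotates [hdot z w] by the conjugate
   root. *)
have prtc : n.+1.-primitive_root (conjc rt) by rewrite (fmorph_primitive_root (@conjc R)).
pose F w : \bar R := ((1 - sqnorm w) `^ t * normc (bsum b (hdot z w) n) ^+ 2)%:E.
have mF : measurable_fun setT F.
  apply/measurable_EFinP; apply: measurable_funM; first exact: measurable_weight.
  by apply: measurable_funX; apply: measurable_fun_normc; exact: measurable_bsum_hdotr.
have F0 w : (0 <= F w)%E by rewrite lee_fin mulr_ge0 ?powR_ge0 ?sqr_ge0.
pose G k w : \bar R := ((bcoef b k ^+ 2)%:E * ((1 - sqnorm w) `^ t * (normc (hdot z w) ^+ 2) ^+ k)%:E)%E.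
have mH k : measurable_fun setT
   (fun w => ((1 - sqnorm w) `^ t * (normc (hdot z w) ^+ 2) ^+ k)%:E).
  apply/measurable_EFinP; apply: measurable_funM; first exact: measurable_weight.
  exact: measurable_hdot_pow.
have H0 k w : (0 <= ((1 - sqnorm w) `^ t * (normc (hdot z w) ^+ 2) ^+ k)%:E)%E.
  by rewrite lee_fin mulr_ge0 ?powR_ge0 ?exprn_ge0 ?normc_ge0.
have mG k : measurable_fun setT (G k) by apply: emeasurable_funM => //.
have G0 k w : (0 <= G k w)%E by apply: mule_ge0; [rewrite lee_fin sqr_ge0|exact: H0].
have S w : (\sum_(j < n.+1) F (tscale (rt ^+ j)%R w) = n.+1%:R%:E * \sum_(k < n) G k w)%E.
  under eq_bigr do rewrite /F sqnorm_scale normcX (normc_prim_root prt) !expr1n mul1r.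
  rewrite sumEFin -mulr_sumr.
  have -> : \sum_(j < n.+1) normc (bsum b (hdot z (tscale (rt ^+ j) w)) n) ^+ 2 =
     \sum_(j < n.+1) normc (\sum_(k < n) ((bcoef b k)%:C%C * hdot z w ^+ k) * (conjc rt ^+ j) ^+ k) ^+ 2.
    apply: eq_bigr => j _; congr (normc _ ^+ 2); rewrite hdot_scale /bsum.
    by apply: eq_bigr => k _; rewrite exprMn rmorphXn/= -mulrA [_ * (_ ^+ _) ^+ _]mulrC.
  rewrite (sum_prim_root (fun k => ((bcoef b k)%:C%C * hdot z w ^+ k)) prtc (leqnSn n)).
  rewrite /G; under [in RHS]eq_bigr do rewrite -EFinM.
  rewrite sumEFin -EFinM; congr EFin; rewrite mulrCA; congr (_ * _).
  rewrite mulr_sumr; apply: eq_bigr => k _.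
  rewrite normcM normc_real normcX exprMn real_normK ?num_real// exprAC; ring.
have := ball_rotation_average prt mF F0.
under eq_integral do rewrite S.
have N0 : n.+1%:R%:E != 0%E :> \bar R by rewrite eqe pnatr_eq0.
rewrite ge0_integralZl_EFin; last 4 first.
- exact: measurableT.
- by move=> w _; apply: sume_ge0.
- exact: emeasurable_sum.
- exact: ler0n.
move=> /(congr1 (fun x => (n.+1%:R^-1)%:E * x)%E).
rewrite !muleA -!EFinM mulVf ?pnatr_eq0// !mul1e => <-.
rewrite ge0_integral_sum// -sumEFin; apply: eq_bigr => k _.
rewrite /G ge0_integralZl_EFin; last 4 first.
- exact: measurableT.
- by move=> w _; exact: H0.
- exact: mH.
- exact: sqr_ge0.
by rewrite ball_moment// EFinM.
Qed.

(* Log-convexity of Gamma at the midpoint of [d + 1 + t + k] and [c - t + k] compares the k-th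
   coefficient with that of [(1 - x) `^ (t - c)]. *)
Lemma bsum_moment_le b z n (t : R) : -1 < t -> t < b *+ 2 - (d%:R + 1) -> sqnorm z < 1 ->
  \sum_(k < n) bcoef b k ^+ 2 *
     (Gamma (d%:R + 1) * Gamma (t + 1) * k`!%:R / Gamma (d%:R + 1 + t + k%:R) * sqnorm z ^+ k) <=
  Gamma (d%:R + 1) * Gamma (t + 1) * Gamma (b *+ 2 - (d%:R + 1) - t) / Gamma b ^+ 2 *
    (1 - sqnorm z) `^ (t - (b *+ 2 - (d%:R + 1))).
Proof.
move=> t1 tc z1; move cE : (b *+ 2 - (d%:R + 1)) => c in tc *; have ct0 : 0 < c - t by rewrite subr_gt0.
have d0 : 0 <= d%:R :> R by [].
have dt0 : 0 < d%:R + 1 + t by lra.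
have b0 : 0 < b by move: tc; rewrite -cE mulr2n; lra.
have d10 : 0 < d%:R + 1 :> R by lra.
have t10 : 0 < t + 1 by lra.
have Gb := Gamma_gt0 b0.
have Gd := Gamma_gt0 d10.
have Gt := Gamma_gt0 t10.
set x := sqnorm z in z1 *; have x0 : 0 <= x by exact: sqnorm_ge0.
have -> : t - c = - (c - t) by rewrite opprB.
have bE := bcoefE b.
move: (Gamma b) Gb bE (Gamma (d%:R + 1)) Gd (Gamma (t + 1)) Gt => g g0 bE h h0 l l0.
have K0 : 0 <= h * l / g ^+ 2 by rewrite ltW// divr_gt0 ?exprn_gt0 ?mulr_gt0.
rewrite (mulrAC (h * l) _ (g ^- 2)) -(mulrA (h * l / _)).
apply: le_trans (ler_wpM2l K0 (@Gamma_binomial_partial_sum R _ x n ct0 _)); last by rewrite x0.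
rewrite mulr_sumr; apply: ler_sum => k _.
have k0 : 0 < k`!%:R :> R by rewrite ltr0n fact_gt0.
have kn : 0 <= k%:R :> R by [].
have p1 : 0 < d%:R + 1 + t + k%:R by clear -kn dt0; lra.
have p2 : 0 < c - t + k%:R by clear -kn ct0; lra.
have GM := Gamma_midpoint p1 p2; have G1 := Gamma_gt0 p1.
have E : (d%:R + 1 + t + k%:R + (c - t + k%:R)) / 2 = b + k%:R by rewrite -cE mulr2n; field.
rewrite E in GM.
rewrite bE.
have gE (A B : R) : 0 < B -> (A / (g * k`!%:R)) ^+ 2 * (h * l * k`!%:R / B * x ^+ k) =
   (h * l / g ^+ 2) * ((A ^+ 2 / B) / k`!%:R * x ^+ k).
  by move=> B0; field; rewrite !gt_eqF.
rewrite gE//; apply: ler_wpM2l; first exact: K0.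
apply: ler_wpM2r; first exact: exprn_ge0.
rewrite ler_pM2r; last by rewrite invr_gt0.
rewrite ler_pdivrMr; last exact: G1.
by rewrite [leRHS]mulrC; exact: GM.
Qed.

Lemma measurable_kernel_norm z s : measurable_fun setT (fun w => normc (1 - hdot z w) `^ s).
Proof.
apply: (measurableT_comp (@measurable_powR R s)); apply: measurable_fun_normc.
apply: measurable_cadd; first exact: measurable_cst.
rewrite (_ : (fun x => _) = fun x => (-1) * hdot z x); last by apply/funext => x; rewrite mulN1r.
by apply: measurable_cmul; [exact: measurable_cst|exact: measurable_hdotr].
Qed.

(** Reason for halving the exponent: the modulus of the kernel is a limit of squared moduli of
    polynomials, to which orthogonality applies. *)
Lemma bsum_normc_cvg b (u : R[i]) : 0 < b -> normc u < 1 ->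
  (fun n => normc (bsum b u n) ^+ 2) @ \oo --> normc (1 - u) `^ (- (b *+ 2)).
Proof.
move=> b0 u1; have [hr hi] := bsum_cvg b0 u1.
have -> : normc (1 - u) `^ (- (b *+ 2)) = normc (cpow (1 - u) b)^-1 ^+ 2.
  rewrite normcV normc_cpow exprVn powRN; congr (_^-1).
  by rewrite mulr2n powRD ?expr2//; apply/implyP => /eqP; lra.
rewrite Defs.normcE; under eq_fun do rewrite Defs.normcE.
by apply: cvgD; rewrite expr2; under eq_fun do rewrite expr2; apply: cvgM.
Qed.

(** The bound on the truncated series is uniform in the degree, so Fatou's lemma passes to the
    limit. The exponent [t] is 0 for the norm bound and [- x0] for the lacunary functions. *)
Lemma forelli_rudin alpha z (t : R) : -1 < t -> t < alpha - (d%:R + 1) -> sqnorm z < 1 ->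
  (\int[ball_measure R d]_w ((1 - sqnorm w) `^ t * normc (1 - hdot z w) `^ (- alpha))%:E <=
   (Gamma (d%:R + 1) * Gamma (t + 1) * Gamma (alpha - (d%:R + 1) - t) / Gamma (alpha / 2) ^+ 2 *
    (1 - sqnorm z) `^ (t - (alpha - (d%:R + 1))))%:E)%E.
Proof.
move=> t1 tc z1; set b := alpha / 2.
have ab : alpha = b *+ 2 by rewrite /b mulr2n; lra.
have d0 : 0 <= d%:R :> R by [].
have b0 : 0 < b by move: tc; rewrite /b; lra.
rewrite ab in tc *.
pose F n w : \bar R := ((1 - sqnorm w) `^ t * normc (bsum b (hdot z w) n) ^+ 2)%:E.
have mF n : measurable_fun setT (F n).
  apply/measurable_EFinP; apply: measurable_funM; first exact: measurable_weight.
  by apply: measurable_funX; apply: measurable_fun_normc; exact: measurable_bsum_hdotr.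
have F0 n w : (0 <= F n w)%E by rewrite lee_fin mulr_ge0 ?powR_ge0 ?sqr_ge0.
rewrite ge0_integral_cball; last 2 first.
- apply/measurable_EFinP; apply: measurable_funM; first exact: measurable_weight.
  exact: measurable_kernel_norm.
- by move=> w; rewrite lee_fin mulr_ge0 ?powR_ge0.
have mB := @measurable_cball R d.
have -> : (\int[ball_measure R d]_(w in cball R d)
    ((1 - sqnorm w) `^ t * normc (1 - hdot z w) `^ (- (b *+ 2)))%:E =
  \int[ball_measure R d]_(w in cball R d) limn_einf (F ^~ w))%E.
  apply: eq_integral => w; rewrite inE cballE => w1.
  have cF : (F n w @[n --> \oo] --> ((1 - sqnorm w) `^ t * normc (1 - hdot z w) `^ (- (b *+ 2)))%:E)%E.
    apply: cvg_EFin; first by near=> n.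
    by apply: cvgM; [exact: cvg_cst|apply: bsum_normc_cvg => //; exact: normc_hdot_lt1].
  by have [-> _] := cvg_limn_einf_sup cF.
apply: le_trans (@fatou _ _ _ _ _ mB _ _ _) _.
- by move=> n; apply: measurable_funTS.
- by move=> n w _; exact: F0.
apply: limn_einf_le => n.
rewrite -ge0_integral_cball// bsum_moment// lee_fin.
exact: bsum_moment_le.
Unshelve. all: by end_near. Qed.
End forelli_rudin.

(** * Schur's test *)

Section holder_inequalities.
Context {R : realType}.

(** Young's inequality with exponents [1/th] and [1/(1 - th)]; the endpoints, where one of these is
    infinite, are treated apart. *)
Lemma powR_amgm (a b th : R) : 0 <= a -> 0 <= b -> 0 <= th <= 1 ->
  a `^ th * b `^ (1 - th) <= th * a + (1 - th) * b.
Proof.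
move=> a0 b0 /andP[t0 t1].
move: t0; rewrite le_eqVlt => /predU1P[<-|t0].
  by rewrite powRr0 subr0 powRr1// mul1r mul0r add0r.
move: t1; rewrite le_eqVlt => /predU1P[->|t1].
  by rewrite subrr powRr0 powRr1// mulr1 mul1r mul0r addr0.
have t10 : 0 < 1 - th by rewrite subr_gt0.
have H := @conjugate_powR R (a `^ th) (b `^ (1 - th)) th^-1 (1 - th)^-1
  (powR_ge0 _ _) (powR_ge0 _ _).
rewrite !invr_gt0 !invrK -!powRrM !divff ?gt_eqF// !powRr1// in H.
by have := H t0 t10; rewrite [th + _]addrC subrK => /(_ erefl); rewrite [a * _]mulrC [b * _]mulrC.
Qed.

Context d (T : measurableType d) (mu : {measure set T -> \bar R}).

Lemma integral_scale (f : T -> R) (a : R) :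
  measurable_fun setT f -> (forall x, 0 <= f x) -> 0 <= a ->
  (\int[mu]_x (a * f x)%:E = a%:E * \int[mu]_x (f x)%:E)%E.
Proof.
move=> mf f0 a0; under eq_integral do rewrite EFinM.
rewrite ge0_integralZl_EFin; last 4 first.
- exact: measurableT.
- by move=> x _; rewrite lee_fin.
- exact/measurable_EFinP.
- exact: a0.
by [].
Qed.

Lemma integral_lincomb (f g : T -> R) (a b : R) :
  measurable_fun setT f -> measurable_fun setT g ->
  (forall x, 0 <= f x) -> (forall x, 0 <= g x) -> 0 <= a -> 0 <= b ->
  (\int[mu]_x (a * f x + b * g x)%:E = a%:E * \int[mu]_x (f x)%:E + b%:E * \int[mu]_x (g x)%:E)%E.
Proof.
move=> mf mg f0 g0 a0 b0.
under eq_integral do rewrite EFinD.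
rewrite ge0_integralD; last 5 first.
- exact: measurableT.
- by move=> x _; rewrite lee_fin mulr_ge0.
- by apply/measurable_EFinP; apply: measurable_funM.
- by move=> x _; rewrite lee_fin mulr_ge0.
- by apply/measurable_EFinP; apply: measurable_funM.
by rewrite !integral_scale.
Qed.

(** Hoelder's inequality for [1/s] and [1/(1 - s)], obtained by integrating AM-GM between
    [h ^ (1/s) / I] and [u]. Dividing by [I] makes both masses at most 1 and gives the constant
    [I ^ s], also for [s = 1]. *)
Lemma integral_weight_holder (h u : T -> R) (I s : R) :
  measurable_fun setT h -> measurable_fun setT u ->
  (forall x, 0 <= h x) -> (forall x, 0 <= u x) -> 0 < s <= 1 -> 0 < I ->
  (\int[mu]_x (h x `^ s^-1)%:E <= I%:E)%E -> (\int[mu]_x (u x)%:E <= 1)%E ->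
  (\int[mu]_x (h x * u x `^ (1 - s))%:E <= (I `^ s)%:E)%E.
Proof.
move=> mh mu_ h0 u0 s01 I0 hI uI; have /andP[s0 s1] := s01.
have mhs : measurable_fun setT (fun x => h x `^ s^-1).
  exact: (measurableT_comp (@measurable_powR R _) mh).
have mus : measurable_fun setT (fun x => u x `^ (1 - s)).
  exact: (measurableT_comp (@measurable_powR R _) mu_).
have s10 : 0 <= 1 - s by rewrite subr_ge0.
have Is0 : 0 < I `^ s by exact: powR_gt0.
have c0 : 0 <= I `^ s * s / I by rewrite ltW// divr_gt0 ?mulr_gt0.
have c1 : 0 <= I `^ s * (1 - s) by rewrite mulr_ge0// ltW.
have pt x : h x * u x `^ (1 - s) <= I `^ s * s / I * h x `^ s^-1 + I `^ s * (1 - s) * u x.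
  have hI0 : 0 <= h x `^ s^-1 / I by rewrite divr_ge0 ?powR_ge0 ?ltW.
  have s01' : 0 <= s <= 1 by rewrite (ltW s0) s1.
  have := powR_amgm hI0 (u0 x) s01'.
  have -> : (h x `^ s^-1 / I) `^ s = h x / I `^ s.
    have IV : 0 <= I^-1 by rewrite invr_ge0 ltW.
    rewrite (powRM _ (powR_ge0 _ _) IV) -powRrM mulVf ?gt_eqF// powRr1//.
    by rewrite -powR_inv1 ?ltW// -powRrM mulN1r powRN.
  move=> /(ler_wpM2l (ltW Is0)); congr (_ <= _); last ring.
  by rewrite mulrA mulrCA divff ?mulr1// gt_eqF.
apply: (@le_trans _ _ (\int[mu]_x (I `^ s * s / I * h x `^ s^-1 + I `^ s * (1 - s) * u x)%:E)%E).
  apply: ge0_le_integral => //.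
  - by move=> x _; rewrite lee_fin mulr_ge0 ?powR_ge0.
  - by apply/measurable_EFinP; exact: measurable_funM.
  - by apply/measurable_EFinP; apply: measurable_funD; exact: measurable_funM.
  - by move=> x _; rewrite lee_fin.
rewrite integral_lincomb//; last by move=> x; exact: powR_ge0.
have -> : (I `^ s)%:E = (I `^ s * s / I * I + I `^ s * (1 - s) * 1)%:E.
  by congr EFin; field; rewrite gt_eqF.
by rewrite EFinD; apply: leeD; rewrite [leRHS]EFinM; apply: lee_wpmul2l; rewrite ?lee_fin.
Qed.

Definition cintegrable (g : T -> R[i]) :=
  measurable_fun setT g /\ (\int[mu]_x (normc (g x))%:E < +oo)%E.

Lemma cintegrable_normc g : cintegrable g -> mu.-integrable setT (EFin \o (fun x => normc (g x))).
Proof.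
move=> [mg fg]; apply/integrableP; split; first by apply/measurable_EFinP; exact: measurable_fun_normc.
by under eq_integral do rewrite /= ger0_norm ?normc_ge0//.
Qed.

Lemma cintegrable_Re g : cintegrable g -> mu.-integrable setT (EFin \o (fun x => complex.Re (g x))).
Proof.
move=> ig; apply: (le_integrable measurableT _ _ (cintegrable_normc ig)).
  by apply/measurable_EFinP; apply: measurable_fun_Re; exact: ig.1.
by move=> x _ /=; rewrite lee_fin (ger0_norm (normc_ge0 _)) normc_le_Re.
Qed.

Lemma cintegrable_Im g : cintegrable g -> mu.-integrable setT (EFin \o (fun x => complex.Im (g x))).
Proof.
move=> ig; apply: (le_integrable measurableT _ _ (cintegrable_normc ig)).
  by apply/measurable_EFinP; apply: measurable_fun_Im; exact: ig.1.
by move=> x _ /=; rewrite lee_fin (ger0_norm (normc_ge0 _)) normc_le_Im.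
Qed.

(** With [c] the integral of [g], [|c|^2] is the integral of the real part of [conjc c * g], hence
    at most [|c|] times the integral of [|g|]. *)
Lemma normc_cintegral_le (g : T -> R[i]) : measurable_fun setT g ->
  ((normc (cintegral mu g))%:E <= \int[mu]_x (normc (g x))%:E)%E.
Proof.
move=> mg; have [ny|fy] := leP +oo%E (\int[mu]_x (normc (g x))%:E)%E.
  exact: le_trans (leey _) ny.
have ig : cintegrable g by split.
have inorm := cintegrable_normc ig; have iRe := cintegrable_Re ig; have iIm := cintegrable_Im ig.
set c := cintegral mu g.
have iR' : mu.-integrable setT (EFin \o (fun x => complex.Re c * complex.Re (g x))).
  rewrite (_ : EFin \o _ = fun x => (complex.Re c)%:E * (complex.Re (g x))%:E)%E//.
  exact: integrableZl.
have iI' : mu.-integrable setT (EFin \o (fun x => complex.Im c * complex.Im (g x))).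
  rewrite (_ : EFin \o _ = fun x => (complex.Im c)%:E * (complex.Im (g x))%:E)%E//.
  exact: integrableZl.
have in' : mu.-integrable setT (EFin \o (fun x => normc c * normc (g x))).
  rewrite (_ : EFin \o _ = fun x => (normc c)%:E * (normc (g x))%:E)%E//.
  exact: integrableZl.
have key : normc c ^+ 2 <= normc c * \int[mu]_x normc (g x).
  have -> : normc c ^+ 2 = \int[mu]_x (complex.Re c * complex.Re (g x) + complex.Im c * complex.Im (g x)).
    by rewrite RintegralD// !RintegralZl// Defs.normcE !expr2.
  rewrite -RintegralZl//; apply: le_Rintegral => //.
    exact: (integrableD measurableT iR' iI').
  move=> x _; apply: le_trans (ler_norm _) _.
  rewrite -[normc c]normc_conj -normcM; apply: le_trans (normc_le_Re _).
  by rewrite cReM; case: (c) => a b; rewrite /= mulNr opprK.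
have cle : normc c <= \int[mu]_x normc (g x).
  have := normc_ge0 c; rewrite le_eqVlt => /predU1P[<-|n0].
    by apply: Rintegral_ge0 => x _; exact: normc_ge0.
  by move: key; rewrite expr2 ler_pM2l.
apply: le_trans (_ : (\int[mu]_x normc (g x))%:E <= _)%E; first by rewrite lee_fin.
rewrite /Rintegral fineK// ge0_fin_numE//.
by apply: integral_ge0 => x _; rewrite lee_fin normc_ge0.
Qed.

Lemma cLnormE (r : R) (f : T -> R[i]) :
  (cLnorm mu r%:E f = (\int[mu]_x (normc (f x) `^ r)%:E) `^ r^-1)%E.
Proof.
rewrite /cLnorm unlock; under eq_integral => x _ do rewrite /= ger0_norm ?normc_ge0//.
by [].
Qed.

Lemma recip_fin (r : R) : r != 0 -> recip r%:E = r^-1.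
Proof. by move=> r0; rewrite /recip inver (negbTE r0). Qed.

(** The density is [(|f| / M) ^ p] for finite [p]. For [p = +oo] it is the constant 1, and
    [recip p = 0] turns the bound into the essential bound [M]. *)
Lemma cLnorm_le_density p f (M : R) : (1 <= p)%E -> (0 < mu setT)%E -> 0 < M ->
  measurable_fun setT f -> (cLnorm mu p f <= M%:E)%E -> (mu setT <= 1)%E ->
  exists u : T -> R, [/\ measurable_fun setT u, forall w, 0 <= u w,
    (\int[mu]_w (u w)%:E <= 1)%E & {ae mu, forall w, normc (f w) <= M * u w `^ recip p}].
Proof.
move=> p1 mu0 M0 mf; case: p p1 => [r|_|//].
  rewrite lee_fin => r1; have r0 : 0 < r by apply: lt_le_trans r1.
  have rn : r != 0 by rewrite gt_eqF.
  have mfr : measurable_fun setT (fun w => normc (f w) `^ r).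
    by apply: (measurableT_comp (@measurable_powR R _)); exact: measurable_fun_normc.
  have MV0 : 0 <= M `^ (- r) by exact: powR_ge0.
  rewrite cLnormE => fle _; exists (fun w => M `^ (- r) * normc (f w) `^ r); split.
  - exact: measurable_funM.
  - by move=> w; rewrite mulr_ge0 ?powR_ge0.
  - rewrite integral_scale//; last by move=> w; exact: powR_ge0.
    have I0 : (0 <= \int[mu]_x (normc (f x) `^ r)%:E)%E.
      by apply: integral_ge0 => x _; rewrite lee_fin powR_ge0.
    move: (gt0_ler_poweR (ltW r0)) => /(_ _ _ _ _ fle).
    rewrite !in_itv/= !leey !andbT poweR_ge0 lee_fin (ltW M0) => /(_ isT isT).
    rewrite -poweRrM mulVf// poweRe1//.
    have MVE : (0 <= (M `^ (- r))%:E)%E by rewrite lee_fin.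
    move=> /(lee_wpmul2l MVE) /le_trans; apply.
    by rewrite -EFinM -powRD ?(lt0r_neq0 M0) ?implybT// addNr powRr0.
  - apply: aeW => w; rewrite recip_fin// powRM ?powR_ge0//.
    by rewrite -!powRrM mulNr divff// (powRr1 (normc_ge0 _)) (powR_inv1 (ltW M0)) (mulVKf (lt0r_neq0 M0)).
rewrite /cLnorm unlock mu0 => /ess_supP fle m1.
exists (cst 1); split => //.
  by rewrite (integral_cst mu measurableT 1%E) mul1e.
apply: filterS fle => w /=; rewrite /recip /= powRr0 mulr1.
by rewrite lee_fin ger0_norm ?normc_ge0.
Qed.

End holder_inequalities.

Section ball_prob.
Context (R : realType) (d : nat).

(* [ball_measure] with its probability structure, which Tonelli's theorem needs. *)
Definition ball_prob : set (d.-tuple R[i]) -> \bar R := ball_measure R d.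
HB.instance Definition _ := Measure.copy ball_prob (ball_measure R d).
HB.instance Definition _ :=
  Measure_isProbability.Build _ _ _ ball_prob (ball_measure_setT R d).

Lemma measurable_ball_integral (F : d.-tuple R[i] * d.-tuple R[i] -> \bar R) :
  measurable_fun setT F -> (forall x, 0 <= F x)%E ->
  measurable_fun setT (fun z => \int[ball_measure R d]_w F (z, w))%E.
Proof.
by move=> mF F0; apply: (@measurable_fun_fubini_tonelli_F _ _ _ _ _ ball_prob F).
Qed.

End ball_prob.

Section schur.
Context {R : realType}.

Lemma schur_exponent (x y s : R) : 0 <= x -> 0 <= y -> x + y + s = 1 -> 0 < s ->
  exists th, [/\ 0 <= th <= 1, (1 - s) * th = x & (1 - s) * (1 - th) = y].
Proof.
move=> x0 y0 xys s0; exists (x / (1 - s)).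
(* For [s = 1] both [x] and [y] are 0, and division by zero makes the witness 0. *)
have [s1|s1] := eqVneq s 1.
  by rewrite s1 subrr invr0 mulr0 lexx ler01 !mul0r; split => //; lra.
have s1' : 0 < 1 - s by rewrite subr_gt0 lt_neqAle s1; lra.
split; [|by rewrite mulrCA divff ?mulr1// gt_eqF|by rewrite mulrBr mulr1 mulrCA divff ?gt_eqF//; lra].
by rewrite divr_ge0 ?(ltW s1')//= ler_pdivrMr// mul1r; lra.
Qed.


Context dd (T : measurableType dd) (mu : {sigma_finite_measure set T -> \bar R}).

(* [u `^ x * v `^ y <= th * u `^ (1 - s) + (1 - th) * v `^ (1 - s)] leaves only the marginals of [k],
   and Hoelder's inequality integrates [h * u `^ (1 - s)]. *)
Lemma schur_bilinear (k : T * T -> R) (h u v : T -> R) (x y s C I : R) :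
  measurable_fun setT k -> (forall zw, 0 <= k zw) ->
  measurable_fun setT h -> (forall z, 0 <= h z) ->
  0 <= C -> 0 < I -> 0 <= x -> 0 <= y -> x + y + s = 1 -> 0 < s ->
  {ae mu, forall z, (\int[mu]_w (k (z, w))%:E <= (C * h z)%:E)%E} ->
  {ae mu, forall w, (\int[mu]_z (k (z, w))%:E <= (C * h w)%:E)%E} ->
  (\int[mu]_z (h z `^ s^-1)%:E <= I%:E)%E ->
  measurable_fun setT u -> (forall w, 0 <= u w) -> (\int[mu]_w (u w)%:E <= 1)%E ->
  measurable_fun setT v -> (forall w, 0 <= v w) -> (\int[mu]_w (v w)%:E <= 1)%E ->
  (\int[mu]_z ((v z `^ y)%:E * \int[mu]_w (u w `^ x * k (z, w))%:E) <= (C * I `^ s)%:E)%E.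
Proof.
move=> mk k0 mh h0 C0 I0 x0 y0 xys s0 k1 k2 hI mu_ u0 uI mv v0 vI.
have [th [th01 thx thy]] := schur_exponent x0 y0 xys s0.
have s01 : 0 < s <= 1 by rewrite s0; clear -x0 y0 xys; lra.
have /andP[th0 th1] := th01; have th10 : 0 <= 1 - th by rewrite subr_ge0.
have mkz z : measurable_fun setT (fun w => k (z, w)) by exact: (measurableT_comp mk (pair1_measurable z)).
have mkw w : measurable_fun setT (fun z => k (z, w)) by exact: (measurableT_comp mk (pair2_measurable w)).
have mp (a : R) (g : T -> R) : measurable_fun setT g -> measurable_fun setT (fun w => g w `^ a).
  exact: (measurableT_comp (@measurable_powR R _)).
have mg (g : T -> R) : measurable_fun setT g -> measurable_fun setT (fun z => (C * (h z * g z `^ (1 - s)))).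
  by move=> mg; do 2 apply: measurable_funM => //; exact: mp.
have g0 (g : T -> R) z : 0 <= C * (h z * g z `^ (1 - s)) by rewrite !mulr_ge0 ?powR_ge0.
have wh (g : T -> R) : measurable_fun setT g -> (forall w, 0 <= g w) -> (\int[mu]_w (g w)%:E <= 1)%E ->
    (\int[mu]_w (C * (h w * g w `^ (1 - s)))%:E <= (C * I `^ s)%:E)%E.
  move=> mg' g0' gI; rewrite integral_scale; last 3 first.
  - by apply: measurable_funM => //; exact: mp.
  - by move=> z; rewrite mulr_ge0 ?powR_ge0.
  - exact: C0.
  by rewrite EFinM; apply: lee_wpmul2l; [rewrite lee_fin|exact: integral_weight_holder].
pose UK a zw : \bar R := (u zw.2 `^ a * k zw)%:E.
have mUK a : measurable_fun setT (UK a).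
  apply/measurable_EFinP; apply: measurable_funM => //.
  exact: (measurableT_comp (mp _ _ mu_) measurable_snd).
have UK0 a zw : (0 <= UK a zw)%E by rewrite lee_fin mulr_ge0 ?powR_ge0.
pose P a z := (\int[mu]_w UK a (z, w))%E.
have mP a : measurable_fun setT (P a).
  by apply: (@measurable_fun_fubini_tonelli_F _ _ _ _ _ mu (UK a)).
have P0 a z : (0 <= P a z)%E by apply: integral_ge0 => w _; exact: UK0.
have step : {ae mu, forall z, ((v z `^ y)%:E * P x z <=
    th%:E * P (1 - s)%R z + (1 - th)%:E * (C * (h z * v z `^ (1 - s)))%:E)%E}.
  apply: filterS k1 => z kz.
  rewrite /P /UK /= -integral_scale; last 3 first.
  - by apply: measurable_funM => //; exact: mp.
  - by move=> w; rewrite mulr_ge0 ?powR_ge0.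
  - exact: powR_ge0.
  apply: (@le_trans _ _ (\int[mu]_w (th * (u w `^ (1 - s) * k (z, w)) + ((1 - th) * v z `^ (1 - s)) * k (z, w))%:E)%E).
    apply: ge0_le_integral => //.
    - by move=> w _; rewrite lee_fin !mulr_ge0 ?powR_ge0.
    - by apply/measurable_EFinP; do 2 apply: measurable_funM => //; exact: mp.
    - apply/measurable_EFinP; apply: measurable_funD; apply: measurable_funM => //.
      by apply: measurable_funM => //; exact: mp.
    - move=> w _; rewrite lee_fin [leLHS]mulrA [leRHS](_ : _ =
        (th * u w `^ (1 - s) + (1 - th) * v z `^ (1 - s)) * k (z, w)); last by ring.
      apply: ler_wpM2r; first exact: k0.
      rewrite mulrC; have := powR_amgm (powR_ge0 (u w) (1 - s)) (powR_ge0 (v z) (1 - s)) th01.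
      by rewrite -!powRrM thx thy.
  rewrite integral_lincomb; last 6 first.
  - by apply: measurable_funM => //; exact: mp.
  - exact: mkz.
  - by move=> w; rewrite mulr_ge0 ?powR_ge0.
  - by move=> w; exact: k0.
  - exact: th0.
  - by rewrite mulr_ge0 ?powR_ge0.
  apply: leeD => //; rewrite EFinM -muleA; apply: lee_wpmul2l; first by rewrite lee_fin.
  have vs0 : (0 <= (v z `^ (1 - s))%:E)%E by rewrite lee_fin powR_ge0.
  by apply: le_trans (lee_wpmul2l vs0 kz) _; rewrite -EFinM mulrCA [v z `^ _ * _]mulrC.
have mgE : measurable_fun setT (fun z => (C * (h z * v z `^ (1 - s)))%:E) by apply/measurable_EFinP; exact: mg.
apply: (@le_trans _ _ (\int[mu]_z (th%:E * P (1 - s)%R z + (1 - th)%:E * (C * (h z * v z `^ (1 - s)))%:E))%E).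
  apply: ae_ge0_le_integral => //.
  - by move=> z _; rewrite mule_ge0 ?lee_fin ?powR_ge0//; exact: P0.
  - apply: emeasurable_funM; last exact: mP.
    by apply/measurable_EFinP; exact: mp.
  - by move=> z _; rewrite adde_ge0// mule_ge0 ?lee_fin ?P0.
  - by apply: emeasurable_funD; apply: emeasurable_funM.
  - by apply: filterS step => z.
rewrite ge0_integralD; last 5 first.
- exact: measurableT.
- by move=> z _; apply: mule_ge0; [rewrite lee_fin|exact: P0].
- exact: emeasurable_funM.
- by move=> z _; apply: mule_ge0; rewrite lee_fin.
- exact: emeasurable_funM.
rewrite ge0_integralZl_EFin; last 4 first.
- exact: measurableT.
- by move=> z _; exact: P0.
- exact: mP.
- exact: th0.
rewrite ge0_integralZl_EFin; last 4 first.
- exact: measurableT.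
- by move=> z _; rewrite lee_fin.
- exact: mgE.
- exact: th10.
(* Tonelli moves the integral onto [z] first, so that the second marginal bound [k2] applies. *)
have Pint : (\int[mu]_z P (1 - s)%R z <= (C * I `^ s)%:E)%E.
  rewrite /P (fubini_tonelli (m1 := mu) (m2 := mu) (UK (1 - s)) (mUK _) (UK0 _)).
  apply: le_trans (wh u mu_ u0 uI).
  apply: ae_ge0_le_integral => //.
  - by move=> w _; apply: integral_ge0 => z _; exact: UK0.
  - by apply: (@measurable_fun_fubini_tonelli_G _ _ _ _ _ mu (UK (1 - s))).
  - by move=> w _; rewrite lee_fin.
  - by apply/measurable_EFinP; exact: mg.
  apply: filterS k2 => w kw _.
  rewrite /UK /= integral_scale; last 3 first.
  - exact: mkw.
  - by move=> z; exact: k0.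
  - exact: powR_ge0.
  have us0 : (0 <= (u w `^ (1 - s))%:E)%E by rewrite lee_fin powR_ge0.
  by apply: le_trans (lee_wpmul2l us0 kw) _; rewrite -EFinM mulrCA [u w `^ _ * _]mulrC.
have -> : (C * I `^ s)%:E = (th%:E * (C * I `^ s)%:E + (1 - th)%:E * (C * I `^ s)%:E)%E.
  by rewrite -!EFinM -EFinD; congr EFin; ring.
by apply: leeD; apply: lee_wpmul2l; rewrite ?lee_fin//; exact: wh.
Qed.

End schur.

(** * The bilinear estimate for [K_alpha] *)

Section upper_bound.
Context {R : realType} (d : nat).
Local Opaque Gamma eGamma bcoef.
Implicit Types z w : d.-tuple R[i].
Local Notation mu := (ball_measure R d).

Lemma hdotC z w : hdot w z = conjc (hdot z w).
Proof.
rewrite /hdot rmorph_sum; apply: eq_bigr => j _.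
by rewrite rmorphM/= conjcK mulrC.
Qed.

Lemma kernel_normC z w : normc (1 - hdot w z) = normc (1 - hdot z w).
Proof. by rewrite hdotC -[RHS]normc_conj rmorphB rmorph1. Qed.

Lemma measurable_hdot : measurable_fun setT (fun zw : d.-tuple R[i] * d.-tuple R[i] => hdot zw.1 zw.2).
Proof.
apply: measurable_csum => j; apply: measurable_cmul.
  exact: (measurableT_comp (measurable_tnth j) measurable_fst).
by apply: measurable_conjc; exact: (measurableT_comp (measurable_tnth j) measurable_snd).
Qed.

Lemma measurable_kernel s :
  measurable_fun setT (fun zw : d.-tuple R[i] * d.-tuple R[i] => normc (1 - hdot zw.1 zw.2) `^ s).
Proof.
apply: (measurableT_comp (@measurable_powR R s)); apply: measurable_fun_normc.
apply: measurable_cadd; first exact: measurable_cst.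
rewrite (_ : (fun x => _) = fun x => (-1) * hdot x.1 x.2); last by apply/funext => x; rewrite mulN1r.
by apply: measurable_cmul; [exact: measurable_cst|exact: measurable_hdot].
Qed.

Lemma measurable_Kop_integrand alpha (f : d.-tuple R[i] -> R[i]) z : measurable_fun setT f ->
  measurable_fun setT (fun w => f w / cpow (1 - hdot z w) alpha).
Proof.
move=> mf; apply: measurable_cmul => //; apply: measurable_cinv.
apply: (measurableT_comp (measurable_cpow alpha)); apply: measurable_cadd; first exact: measurable_cst.
rewrite (_ : (fun x => _) = fun x => (-1) * hdot z x); last by apply/funext => x; rewrite mulN1r.
by apply: measurable_cmul; [exact: measurable_cst|exact: measurable_hdotr].
Qed.

Lemma normc_Kop_le alpha (f : d.-tuple R[i] -> R[i]) (g : d.-tuple R[i] -> R) z :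
  measurable_fun setT f -> measurable_fun setT g ->
  (forall w, 0 <= g w) -> {ae mu, forall w, normc (f w) <= g w} ->
  ((normc (Kop alpha f z))%:E <= \int[mu]_w (g w * normc (1 - hdot z w) `^ (- alpha))%:E)%E.
Proof.
move=> mf mg g0 fg; rewrite /Kop; case: ifPn => _; last first.
  by rewrite normc0; apply: integral_ge0 => w _; rewrite lee_fin mulr_ge0 ?powR_ge0.
apply: le_trans (normc_cintegral_le _ (measurable_Kop_integrand alpha z mf)) _.
apply: ae_ge0_le_integral => //.
- by move=> w _; rewrite lee_fin normc_ge0.
- by apply/measurable_EFinP; apply: measurable_fun_normc; exact: measurable_Kop_integrand.
- by move=> w _; rewrite lee_fin mulr_ge0 ?powR_ge0.
- by apply/measurable_EFinP; apply: measurable_funM => //; exact: measurable_kernel_norm.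
apply: filterS fg => w fgw _; rewrite lee_fin normcM normcV normc_cpow -powRN.
by apply: ler_wpM2r => //; exact: powR_ge0.
Qed.

Definition fr_const alpha : R :=
  Gamma (d%:R + 1) * Gamma (alpha - (d%:R + 1)) / Gamma (alpha / 2) ^+ 2.

Lemma fr_const_gt0 alpha : d%:R + 1 < alpha -> 0 < fr_const alpha.
Proof.
move=> da; have d0 : 0 <= d%:R :> R by [].
have p1 : 0 < d%:R + 1 :> R by lra.
have p2 : 0 < alpha - (d%:R + 1) by lra.
have p3 : 0 < alpha / 2 by lra.
apply: divr_gt0; first by apply: mulr_gt0; apply: Gamma_gt0.
by apply: exprn_gt0; apply: Gamma_gt0.
Qed.

Lemma kernel_integral_le alpha z : d%:R + 1 < alpha -> sqnorm z < 1 ->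
  (\int[mu]_w (normc (1 - hdot z w) `^ (- alpha))%:E <=
   (fr_const alpha * (1 - sqnorm z) `^ (- (alpha - (d%:R + 1))))%:E)%E.
Proof.
move=> da z1; have c0 : 0 < alpha - (d%:R + 1) by rewrite subr_gt0.
have := forelli_rudin (ltrN10 R) c0 z1.
under eq_integral do rewrite powRr0 mul1r.
have -> : Gamma (0 + 1 : R) = 1 by rewrite add0r; have := @Gamma_nat R 0; rewrite fact0.
by rewrite mulr1 subr0 sub0r.
Qed.

Lemma weight_integral t : -1 < t ->
  (\int[mu]_z ((1 - sqnorm z) `^ t)%:E =
   (Gamma (d%:R + 1) * Gamma (t + 1) / Gamma (d%:R + 1 + t))%:E)%E.
Proof.
move=> t1; have := ball_moment [tuple of nseq d (0 : R[i])] 0 t1.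
under eq_integral do rewrite expr0 mulr1.
by rewrite expr0 fact0 !mulr1 addr0.
Qed.

Lemma weight_const_gt0 t : -1 < t ->
  0 < Gamma (d%:R + 1 : R) * Gamma (t + 1) / Gamma (d%:R + 1 + t).
Proof.
move=> t1; have d0 : 0 <= d%:R :> R by [].
have p1 : 0 < d%:R + 1 :> R by lra.
have p2 : 0 < t + 1 by lra.
have p3 : 0 < d%:R + 1 + t by lra.
by apply: divr_gt0; [apply: mulr_gt0|]; exact: Gamma_gt0.
Qed.

Lemma Kop_bilinear_le alpha (f : d.-tuple R[i] -> R[i]) (u v : d.-tuple R[i] -> R) x y s :
  d%:R + 1 < alpha -> alpha - (d%:R + 1) < s -> 0 <= x -> 0 <= y -> x + y + s = 1 ->
  measurable_fun setT f -> measurable_fun setT u -> measurable_fun setT v ->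
  measurable_fun setT (Kop alpha f) ->
  (forall w, 0 <= u w) -> (forall w, 0 <= v w) ->
  (\int[mu]_w (u w)%:E <= 1)%E -> (\int[mu]_w (v w)%:E <= 1)%E ->
  {ae mu, forall w, normc (f w) <= u w `^ x} ->
  (\int[mu]_z (normc (Kop alpha f z) * v z `^ y)%:E <=
    (fr_const alpha * (Gamma (d%:R + 1) * Gamma (- (alpha - (d%:R + 1)) / s + 1) /
       Gamma (d%:R + 1 + (- (alpha - (d%:R + 1)) / s))) `^ s)%:E)%E.
Proof.
move=> da cs x0 y0 xys mf mu_ mv mK u0 v0 uI vI fu.
have c0 : 0 < alpha - (d%:R + 1) by rewrite subr_gt0.
have s0 : 0 < s by exact: lt_trans cs.
(* Here the gap [c < s] enters: it makes the weight [(1 - |z|^2) ^ (- c/s)] integrable over the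
   ball. *)
have cs1 : -1 < - (alpha - (d%:R + 1)) / s by rewrite mulNr ltrN2 ltr_pdivrMr// mul1r.
have hI : (\int[mu]_z (((1 - sqnorm z) `^ (- (alpha - (d%:R + 1)))) `^ s^-1)%:E <=
    (Gamma (d%:R + 1) * Gamma (- (alpha - (d%:R + 1)) / s + 1) /
       Gamma (d%:R + 1 + (- (alpha - (d%:R + 1)) / s)))%:E)%E.
  by rewrite -(weight_integral cs1); under eq_integral do rewrite -powRrM.
have I0 := weight_const_gt0 cs1.
have k1 : {ae mu, forall z, (\int[mu]_w (normc (1 - hdot z w) `^ (- alpha))%:E <=
   (fr_const alpha * (1 - sqnorm z) `^ (- (alpha - (d%:R + 1))))%:E)%E}.
  by have := @ae_cball R d; apply: filterS => z z1; exact: kernel_integral_le.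
have k2 : {ae mu, forall w, (\int[mu]_z (normc (1 - hdot z w) `^ (- alpha))%:E <=
   (fr_const alpha * (1 - sqnorm w) `^ (- (alpha - (d%:R + 1))))%:E)%E}.
  apply: filterS k1 => w; under eq_integral do rewrite kernel_normC; exact.
apply: le_trans (@schur_bilinear R _ _ (@ball_prob R d) _ _ u v x y s _ _ (measurable_kernel (- alpha))
  (fun zw => powR_ge0 _ _) (@measurable_weight R d _) (fun z => powR_ge0 _ _) (ltW (fr_const_gt0 da)) I0
  x0 y0 xys s0 k1 k2 hI mu_ u0 uI mv v0 vI).
apply: ge0_le_integral.
- exact: measurableT.
- by move=> z _; rewrite lee_fin mulr_ge0 ?powR_ge0 ?normc_ge0.
- apply/measurable_EFinP; apply: measurable_funM; first exact: measurable_fun_normc.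
  exact: (measurableT_comp (@measurable_powR R _) mv).
- apply: emeasurable_funM.
    by apply/measurable_EFinP; exact: (measurableT_comp (@measurable_powR R _) mv).
  apply: (measurable_ball_integral (F := fun zw => (u zw.2 `^ x * normc (1 - hdot zw.1 zw.2) `^ (- alpha))%:E)).
    apply/measurable_EFinP; apply: measurable_funM; last exact: measurable_kernel.
    exact: (measurableT_comp (measurableT_comp (@measurable_powR R _) mu_) measurable_snd).
  by move=> zw; rewrite lee_fin mulr_ge0 ?powR_ge0.
- move=> z _; rewrite mulrC EFinM; apply: lee_wpmul2l; first by rewrite lee_fin powR_ge0.
  apply: normc_Kop_le => //; last by move=> w; exact: powR_ge0.
  exact: (measurableT_comp (@measurable_powR R _) mu_).
Qed.

End upper_bound.

(** * From the bilinear estimate to the operator norm *)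

Section operator_norm.
Context {R : realType} (d : nat).
Local Opaque Gamma eGamma bcoef.
Local Notation mu := (ball_measure R d).

Lemma recip_ge0 (p : \bar R) : (1 <= p)%E -> 0 <= recip p <= 1.
Proof.
case: p => [r| |//]; last by rewrite /recip /= lexx ler01.
rewrite lee_fin => r1; have r0 : 0 < r by apply: lt_le_trans r1.
by rewrite recip_fin ?gt_eqF// invr_ge0 ltW//= invf_le1.
Qed.

(** Duality with the extremal density [v = |K f| ^ r / m], where [q = r] and [m] is the integral of
    [|K f| ^ r]: the pairing of [|K f|] with [v ^ (1 - 1/r)] is exactly [m ^ (1/r)]. Normalizing
    requires [m] to be finite, which is why membership of [K f] in [L^q] is assumed. *)
Lemma Kop_Lnorm_le alpha (p q : \bar R) f : d%:R + 1 < alpha -> (1 <= p)%E -> (1 <= q)%E ->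
  alpha - (d%:R + 1) < recip q - recip p ->
  cLfun mu p f -> (cLnorm mu p f <= 1)%E -> cLfun mu q (Kop alpha f) ->
  (cLnorm mu q (Kop alpha f) <=
    (fr_const d alpha * (Gamma (d%:R + 1) * Gamma (- (alpha - (d%:R + 1)) / (recip q - recip p) + 1) /
       Gamma (d%:R + 1 + (- (alpha - (d%:R + 1)) / (recip q - recip p)))) `^ (recip q - recip p))%:E)%E.
Proof.
move=> da p1 q1 cs fp f1 [mK Kq].
have /andP[x0 x1] := recip_ge0 p1; have /andP[y0 y1] := recip_ge0 q1.
have mT0 : (0 < mu setT)%E by rewrite ball_measure_setT.
have mT1 : (mu setT <= 1)%E by rewrite ball_measure_setT.
have [mf _] := fp.
have [u [mu_ u0 uI fu1]] := cLnorm_le_density p1 mT0 ltr01 mf f1 mT1.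
have fu : {ae mu, forall w, normc (f w) <= u w `^ recip p}.
  by apply: filterS fu1 => w; rewrite mul1r.
have C0 := fr_const_gt0 da.
(* An infinite [q] would give [recip q = 0], against [0 < recip q - recip p]. *)
move: q1 cs y0 y1 Kq; case: q => [r| |//] q1 cs y0 y1 Kq; last first.
  by move: cs; rewrite {1}/recip /= => cs; exfalso; clear -da cs x0; lra.
have r1 : 1 <= r by exact: q1.
have r0 : 0 < r by apply: lt_le_trans r1.
have rn : r != 0 by rewrite gt_eqF.
have M0 : (0 <= \int[mu]_x (normc (Kop alpha f x) `^ r)%:E)%E.
  by apply: integral_ge0 => z _; rewrite lee_fin powR_ge0.
have mKr : measurable_fun setT (fun z => normc (Kop alpha f z) `^ r).
  by apply: (measurableT_comp (@measurable_powR R _)); exact: measurable_fun_normc.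
rewrite cLnormE in Kq *.
have Mfin := lty_poweRy (invr_neq0 rn) Kq.
have := @Kop_bilinear_le R d alpha f u (fun z => (normc (Kop alpha f z) `^ r) / fine (\int[mu]_x (normc (Kop alpha f x) `^ r)%:E)%E)
  (recip p) (1 - recip r%:E) (recip r%:E - recip p) da cs x0.
rewrite subr_ge0 y1 => /(_ isT).
have -> : recip p + (1 - recip r%:E) + (recip r%:E - recip p) = 1 by ring.
move=> /(_ erefl mf mu_).
have Mf : (\int[mu]_x (normc (Kop alpha f x) `^ r)%:E)%E \is a fin_num by rewrite ge0_fin_numE.
rewrite -(fineK Mf) in M0 *.
set m := fine _ in M0 *.
rewrite lee_fin in M0.
move: M0; rewrite le_eqVlt => /predU1P[<- _|m0].
  by rewrite poweR0r ?invr_neq0// lee_fin mulr_ge0 ?powR_ge0// ltW.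
have mv : measurable_fun setT (fun z => normc (Kop alpha f z) `^ r / m) by exact: measurable_funM.
move=> /(_ mv mK u0).
have v0 z : 0 <= normc (Kop alpha f z) `^ r / m by rewrite divr_ge0 ?powR_ge0 ?ltW.
have vI : (\int[mu]_z (normc (Kop alpha f z) `^ r / m)%:E <= 1)%E.
  under eq_integral do rewrite mulrC.
  rewrite integral_scale; [|exact: mKr|by move=> z; exact: powR_ge0|by rewrite invr_ge0 ltW].
  by rewrite -(fineK Mf) -/m -EFinM mulVf ?gt_eqF.
move=> /(_ v0 uI vI fu).
rewrite recip_fin//; apply: le_trans.
rewrite poweR_EFin.
have pw z : normc (Kop alpha f z) * (normc (Kop alpha f z) `^ r / m) `^ (1 - r^-1) =
    m `^ (- (1 - r^-1)) * normc (Kop alpha f z) `^ r.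
  have n0 := normc_ge0 (Kop alpha f z).
  have mV : 0 <= m^-1 by rewrite invr_ge0 ltW.
  rewrite (powRM _ (powR_ge0 _ _) mV) -powRrM -[m^-1]powR_inv1 ?ltW// -powRrM mulN1r mulrA mulrC.
  congr (_ * _); rewrite mulrBr mulr1 divff//.
  have [->|nz] := eqVneq (normc (Kop alpha f z)) 0; first by rewrite mul0r powR0.
  by rewrite -{1}(powRr1 n0) -powRD ?nz ?implybT// addrC subrK.
under eq_integral do rewrite pw.
rewrite integral_scale; [|exact: mKr|by move=> z; exact: powR_ge0|exact: powR_ge0].
rewrite -(fineK Mf) -/m -EFinM lee_fin -{3}(powRr1 (ltW m0)) -powRD ?(lt0r_neq0 m0) ?implybT//.
by rewrite opprB subrK.
Qed.

Lemma operator_norm_le alpha (p q : \bar R) : d%:R + 1 < alpha -> (1 <= p)%E -> (1 <= q)%E ->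
  alpha - (d%:R + 1) < recip q - recip p -> bounded_operator mu p q (Kop alpha) ->
  (operator_norm mu p q (Kop alpha) <=
    ((Gamma (d%:R + 1) `^ (1 + recip q - recip p) *
      Gamma (alpha - (d%:R + 1)) *
      Gamma (1 / (recip q - recip p) * (d%:R + 1 - alpha) + 1)
        `^ (recip q - recip p)) /
     (Gamma (alpha / 2) ^+ 2 *
      Gamma (1 / (recip q - recip p) * (d%:R + 1 - alpha) + d%:R + 1)
        `^ (recip q - recip p)))%:E)%E.
Proof.
move=> da p1 q1 cs [C0 bd]; apply: ge_ereal_sup => _ [f [fp f1] <-].
have [Kq _] := bd f fp.
apply: le_trans (Kop_Lnorm_le da p1 q1 cs fp f1 Kq) _; rewrite lee_fin /fr_const.
have -> : 1 + recip q - recip p = 1 + (recip q - recip p) by ring.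
move: (recip q - recip p) cs => s cs.
have c0 : 0 < alpha - (d%:R + 1) by rewrite subr_gt0.
have s0 : 0 < s by exact: lt_trans cs.
have cs1 : -1 < - (alpha - (d%:R + 1)) / s by rewrite mulNr ltrN2 ltr_pdivrMr// mul1r.
have -> : 1 / s * (d%:R + 1 - alpha) = - (alpha - (d%:R + 1)) / s by ring.
move: (_ / s) cs1 => t t1.
have -> : t + d%:R + 1 = d%:R + 1 + t by ring.
have d0 : 0 <= d%:R :> R by [].
have p1' : 0 < d%:R + 1 :> R by lra.
have p2 : 0 < t + 1 by lra.
have p3 : 0 < d%:R + 1 + t by lra.
have p4 : 0 < alpha / 2 by lra.
have G1 := Gamma_gt0 p1'; have G2 := Gamma_gt0 p2; have G3 := Gamma_gt0 p3; have G4 := Gamma_gt0 p4.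
move: (Gamma (d%:R + 1)) (Gamma (t + 1)) (Gamma (d%:R + 1 + t)) (Gamma (alpha / 2)) (Gamma (alpha - _)) G1 G2 G3 G4.
move=> g1 g2 g3 g4 g5 G1 G2 G3 G4.
have E1 : g1 `^ (1 + s) = g1 * g1 `^ s.
  by rewrite powRD ?(lt0r_neq0 G1) ?implybT// powRr1// ltW.
have E2 : (g1 * g2 / g3) `^ s = g1 `^ s * g2 `^ s / g3 `^ s.
  have g12 : 0 <= g1 * g2 by rewrite mulr_ge0 ?ltW.
  have g3V : 0 <= g3^-1 by rewrite invr_ge0 ltW.
  by rewrite (powRM _ g12 g3V) (powRM _ (ltW G1) (ltW G2)) -[g3^-1]powR_inv1 ?ltW// -powRrM mulN1r powRN.
rewrite E1 E2.
have h3 : 0 < g3 `^ s by exact: powR_gt0.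
move: (g1 `^ s) (g2 `^ s) (g3 `^ s) h3 => a b e e0.
by rewrite le_eqVlt; apply/orP; left; apply/eqP; field; rewrite !gt_eqF.
Qed.

End operator_norm.

(** * Rotations of the ball and Taylor coefficients of the kernel *)

Section cintegrable.
Context {R : realType} dd (T : measurableType dd) (mu : {measure set T -> \bar R}).

Lemma cintegrable0 : cintegrable mu (fun=> 0).
Proof.
split; first exact: measurable_cst.
by under eq_integral do rewrite normc0; rewrite integral0.
Qed.

Lemma cintegrableD f g : cintegrable mu f -> cintegrable mu g -> cintegrable mu (fun x => f x + g x).
Proof.
move=> iff ig; have mfg := measurable_cadd iff.1 ig.1; split => //.
apply: (@le_lt_trans _ _ (\int[mu]_x ((normc (f x))%:E + (normc (g x))%:E))%E).
  apply: ge0_le_integral => //.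
  - by move=> x _; rewrite lee_fin normc_ge0.
  - by apply/measurable_EFinP; exact: measurable_fun_normc.
  - by apply: emeasurable_funD; apply/measurable_EFinP; apply: measurable_fun_normc; [exact: iff.1|exact: ig.1].
  - by move=> x _; rewrite -EFinD lee_fin le_normcD.
rewrite ge0_integralD//; last 4 first.
- by move=> x _; rewrite lee_fin normc_ge0.
- by apply/measurable_EFinP; apply: measurable_fun_normc; exact: iff.1.
- by move=> x _; rewrite lee_fin normc_ge0.
- by apply/measurable_EFinP; apply: measurable_fun_normc; exact: ig.1.
by rewrite lte_add_pinfty ?iff.2 ?ig.2.
Qed.

Lemma cintegrableZ c f : cintegrable mu f -> cintegrable mu (fun x => c * f x).
Proof.
move=> [mf iff]; split; first by apply: measurable_cmul => //; exact: measurable_cst.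
under eq_integral do rewrite normcM.
rewrite integral_scale; last 3 first.
- exact: measurable_fun_normc.
- by move=> x; exact: normc_ge0.
- exact: normc_ge0.
by rewrite lte_mul_pinfty// lee_fin normc_ge0.
Qed.

Lemma cintegralD f g : cintegrable mu f -> cintegrable mu g ->
  cintegral mu (fun x => f x + g x) = cintegral mu f + cintegral mu g.
Proof.
move=> iff ig; rewrite /cintegral.
have -> : \int[mu]_x complex.Re (f x + g x) = \int[mu]_x complex.Re (f x) + \int[mu]_x complex.Re (g x).
  by under eq_Rintegral do rewrite cReD; rewrite RintegralD//; exact: cintegrable_Re.
have -> : \int[mu]_x complex.Im (f x + g x) = \int[mu]_x complex.Im (f x) + \int[mu]_x complex.Im (g x).
  by under eq_Rintegral do rewrite cImD; rewrite RintegralD//; exact: cintegrable_Im.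
by [].
Qed.

Lemma cintegralZ c f : cintegrable mu f ->
  cintegral mu (fun x => c * f x) = c * cintegral mu f.
Proof.
move=> iff; have iR := cintegrable_Re iff; have iI := cintegrable_Im iff; rewrite /cintegral.
have iZ (r : R) (h : T -> R) : mu.-integrable setT (EFin \o h) -> mu.-integrable setT (EFin \o (fun x => r * h x)).
  by move=> ih; rewrite (_ : EFin \o _ = fun x => (r%:E * (h x)%:E)%E)//; exact: integrableZl.
have -> : \int[mu]_x complex.Re (c * f x) =
    complex.Re c * \int[mu]_x complex.Re (f x) - complex.Im c * \int[mu]_x complex.Im (f x).
  by under eq_Rintegral do rewrite cReM; rewrite RintegralB ?RintegralZl//; exact: iZ.
have -> : \int[mu]_x complex.Im (c * f x) =
    complex.Re c * \int[mu]_x complex.Im (f x) + complex.Im c * \int[mu]_x complex.Re (f x).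
  by under eq_Rintegral do rewrite cImM; rewrite RintegralD ?RintegralZl//; exact: iZ.
by case: c.
Qed.

Lemma cintegral0 : cintegral mu (fun=> 0) = 0.
Proof. by rewrite /cintegral; congr (_ +i* _)%C; rewrite /Rintegral integral0. Qed.

Lemma cintegral_sum (I : Type) (s : seq I) (c : I -> R[i]) (f : I -> T -> R[i]) :
  (forall i, cintegrable mu (f i)) ->
  cintegrable mu (fun x => \sum_(i <- s) c i * f i x) /\
  cintegral mu (fun x => \sum_(i <- s) c i * f i x) = \sum_(i <- s) c i * cintegral mu (f i).
Proof.
move=> iff; elim: s => [|i s [IH1 IH2]].
  under eq_fun do rewrite big_nil; rewrite big_nil; split; [exact: cintegrable0|exact: cintegral0].
under eq_fun do rewrite big_cons.
split; first by apply: cintegrableD => //; exact: cintegrableZ.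
by rewrite cintegralD//; [rewrite IH2 cintegralZ// big_cons|exact: cintegrableZ].
Qed.

End cintegrable.

Section ball_rotation.
Context {R : realType} (d : nat).
Local Notation mu := (ball_measure R d).

Lemma ball_rotation_ge0 (c : R[i]) (F : d.-tuple R[i] -> \bar R) : normc c = 1 ->
  measurable_fun setT F -> (forall x, 0 <= F x)%E ->
  (\int[mu]_w F (tscale c w) = \int[mu]_w F w)%E.
Proof.
move=> c1 mF F0; have mB := @measurable_cball R d.
have c0 : c != 0 by apply/eqP => c0; move: c1; rewrite c0 normc0 => /eqP; rewrite eq_sym oner_eq0.
rewrite !integral_ball_measure//; last by exact: (measurableT_comp mF (measurable_tscale _)).
congr (_ * _)%E; rewrite !(integral_mkcond (cball R d)) [RHS](integral_tuple_power_cscale c0); last 2 first.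
- exact: (measurable_restrictT F mB).1 (measurable_funTS mF).
- by move=> w; rewrite patchE; case: ifPn.
rewrite c1 !expr1n mul1e; apply: eq_integral => w _; rewrite !patchE.
suff -> : (tscale c w \in cball R d) = (w \in cball R d) by [].
by apply/idP/idP; rewrite !inE !cballE sqnorm_scale c1 expr1n mul1r.
Qed.

Lemma ball_rotation (c : R[i]) (f : d.-tuple R[i] -> R) : normc c = 1 ->
  measurable_fun setT f -> \int[mu]_w f (tscale c w) = \int[mu]_w f w.
Proof.
move=> c1 mf; rewrite /Rintegral; congr fine.
have mfE : measurable_fun setT (EFin \o f) by exact/measurable_EFinP.
have E1 := ball_rotation_ge0 c1 (measurable_funepos mfE) (funepos_ge0 _).
have E2 := ball_rotation_ge0 c1 (measurable_funeneg mfE) (funeneg_ge0 _).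
rewrite integralE [RHS]integralE -E1 -E2.
by congr (_ - _)%E; apply: eq_integral => w _; rewrite ?funeposE ?funenegE.
Qed.

Lemma cintegral_rotation (c : R[i]) (g : d.-tuple R[i] -> R[i]) : normc c = 1 ->
  measurable_fun setT g -> cintegral mu (fun w => g (tscale c w)) = cintegral mu g.
Proof.
move=> c1 mg; rewrite /cintegral; congr (_ +i* _)%C.
  by rewrite -[RHS](ball_rotation c1)//; exact: measurable_fun_Re.
by rewrite -[RHS](ball_rotation c1)//; exact: measurable_fun_Im.
Qed.

Lemma cintegrable_rotation (c : R[i]) (g : d.-tuple R[i] -> R[i]) : normc c = 1 ->
  cintegrable mu g -> cintegrable mu (fun w => g (tscale c w)).
Proof.
move=> c1 [mg ig]; split; first exact: (measurableT_comp mg (measurable_tscale _)).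
rewrite (ball_rotation_ge0 (F := fun w => (normc (g w))%:E) c1)//.
  by apply/measurable_EFinP; exact: measurable_fun_normc.
by move=> w; rewrite lee_fin normc_ge0.
Qed.

End ball_rotation.

Section rotation_coefficient.
Context {R : realType}.
Local Opaque Gamma bcoef.

(** Cutting the binomial series at degree [N] and averaging over the [N]-th roots of unity leaves
    exactly the term of degree [k]. The remainder is at most [tau N], uniformly for
    [normc u <= rho]. *)
Lemma rotation_coef (a rho : R) k : 0 < a -> 0 <= rho < 1 ->
  exists2 tau : R^nat, tau @ \oo --> 0 &
  forall N (th u : R[i]), N.-primitive_root th -> (k < N)%N -> normc u <= rho ->
    N%:R * (bcoef a k * (normc u ^+ 2) ^+ k - tau N) <=
    complex.Re (\sum_(j < N) conjc (th ^+ j * u) ^+ k * (cpow (1 - th ^+ j * u) a)^-1).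
Proof.
move=> a0 rho01; have [tau tau0 tauP] := bsum_tail a0 rho01; exists tau => // N th u pth kN urho.
have /andP[rho0 rho1] := rho01.
have uj j : normc (th ^+ j * u) = normc u.
  by rewrite normcM normcX (normc_prim_root pth) expr1n mul1r.
pose e j := (cpow (1 - th ^+ j * u) a)^-1 - bsum a (th ^+ j * u) N.
have main : \sum_(j < N) conjc (th ^+ j * u) ^+ k * bsum a (th ^+ j * u) N =
    (N%:R * (bcoef a k * (normc u ^+ 2) ^+ k))%:C%C.
  transitivity (\sum_(j < N) \sum_(m < N) ((bcoef a m)%:C%C * (conjc u ^+ k * u ^+ m)) * (th ^+ m / th ^+ k) ^+ j).
    apply: eq_bigr => j _; rewrite /bsum mulr_sumr; apply: eq_bigr => m _.
    rewrite rmorphM rmorphXn/= (conjc_prim_root pth) !exprMn !exprVn -!exprM !(mulnC j); ring.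
  rewrite exchange_big/= (bigD1 (Ordinal kN))//= [X in _ + X]big1 ?addr0.
    rewrite -mulr_sumr sum_prim_root_ratio// eqxx !rmorphM/= rmorph_nat rmorphXn/= sqr_normcE exprMn.
    by rewrite mulrC [conjc u ^+ k * _]mulrC.
  by move=> m mk; rewrite -mulr_sumr sum_prim_root_ratio// ifN ?mulr0.
have -> : \sum_(j < N) conjc (th ^+ j * u) ^+ k * (cpow (1 - th ^+ j * u) a)^-1 =
   (N%:R * (bcoef a k * (normc u ^+ 2) ^+ k))%:C%C + \sum_(j < N) conjc (th ^+ j * u) ^+ k * e j.
  by rewrite -main -big_split/=; apply: eq_bigr => j _; rewrite -mulrDr [bsum _ _ _ + _]addrC subrK.
rewrite cReD mulrBr lerD2l lerNl.
set S := \sum_(j < N) _.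
apply: le_trans (ler_norm _) _; rewrite normrN; apply: le_trans (normc_le_Re S) _.
apply: le_trans (normc_sum _ _) _.
rewrite mulr_natl -[X in _ *+ X]card_ord -sumr_const; apply: ler_sum => j _.
rewrite normcM normcX normc_conj uj.
have n0 := normc_ge0 u; have e0 := normc_ge0 (e j).
apply: (@le_trans _ _ (1 * normc (e j))).
  by apply: ler_wpM2r => //; rewrite exprn_ile1// (le_trans urho)// ltW.
by rewrite mul1r tauP// uj.
Qed.

End rotation_coefficient.

Section shell_coefficient.
Context {R : realType} (d : nat).
Local Opaque Gamma bcoef.
Local Notation mu := (ball_measure R d).

Lemma normc_hdot_radius (z w : d.-tuple R[i]) : sqnorm w < 1 ->
  normc (hdot z w) <= (sqnorm z + 1) / 2.
Proof. by move=> w1; have := normc_hdot_le z w; lra. Qed.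

(* Averaging over the rotations by the N-th roots of unity isolates the k-th Taylor coefficient of the kernel. *)
Lemma Re_kernel_coef_ge a k (z : d.-tuple R[i]) (chi : d.-tuple R[i] -> R) (B : R) :
  0 < a -> sqnorm z < 1 -> measurable_fun setT chi -> (forall w, 0 <= chi w <= B) ->
  (forall w, ~~ (sqnorm w < 1) -> chi w = 0) ->
  (forall (c : R[i]) w, normc c = 1 -> chi (tscale c w) = chi w) ->
  cintegrable mu (fun w => (chi w)%:C%C * (conjc (hdot z w) ^+ k * (cpow (1 - hdot z w) a)^-1)) ->
  ((bcoef a k)%:E * \int[mu]_w (chi w * (normc (hdot z w) ^+ 2) ^+ k)%:E <=
   (complex.Re (cintegral mu (fun w => (chi w)%:C%C * (conjc (hdot z w) ^+ k * (cpow (1 - hdot z w) a)^-1))))%:E)%E.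
Proof.
move=> a0 z1 mchi chiB chi0 chiR ig.
set g := fun w => _ in ig *.
pose rho := (sqnorm z + 1) / 2.
have rho01 : 0 <= rho < 1 by rewrite /rho; have := sqnorm_ge0 z; lra.
have [tau tau0 tauP] := rotation_coef k a0 rho01.
have B0 : 0 <= B by have /andP[h1 h2] := chiB z; exact: le_trans h2.
have b0 := bcoef_ge0 k a0.
have mu2 := measurable_hdot_pow k z.
have u0 w : 0 <= (normc (hdot z w) ^+ 2) ^+ k by rewrite !exprn_ge0 ?normc_ge0.
have chi_ge0 w : 0 <= chi w by have /andP[] := chiB w.
have mcu : measurable_fun setT (fun w => chi w * (normc (hdot z w) ^+ 2) ^+ k) by exact: measurable_funM.
have cu0 w : 0 <= chi w * (normc (hdot z w) ^+ 2) ^+ k by rewrite mulr_ge0.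
have key N : (k < N)%N ->
    ((bcoef a k)%:E * \int[mu]_w (chi w * (normc (hdot z w) ^+ 2) ^+ k)%:E <=
    (complex.Re (cintegral mu g) + B * `|tau N|)%:E)%E.
  move=> kN; have N0 : (0 < N)%N by exact: leq_ltn_trans kN.
  have [th pth] := @prim_root_exists R N N0.
  have pthc : N.-primitive_root (conjc th) by rewrite (fmorph_primitive_root (@conjc R)).
  have thj j : normc (th ^+ j) = 1 by rewrite normcX (normc_prim_root pth) expr1n.
  have ij (j : 'I_N) : cintegrable mu (fun w => g (tscale (th ^+ j) w)) by exact: cintegrable_rotation.
  have [iS eS] := cintegral_sum (index_enum 'I_N) (fun=> 1) ij.
  set G := (fun x => \sum_(i <- _) _) in iS eS.
  (* Each rotated copy of [g] has the same integral, so lower bounds for the sum [G] transfer to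
     [g]. *)
  have eG : complex.Re (cintegral mu G) = N%:R * complex.Re (cintegral mu g).
    have E (j : 'I_N) : 1 * cintegral mu (fun w => g (tscale (th ^+ j) w)) = cintegral mu g.
      by rewrite mul1r; exact: (cintegral_rotation (thj j) ig.1).
    rewrite eS (eq_bigr _ (fun j _ => E j)).
    rewrite sumr_const card_ord mulr_natl.
    by elim: (N) => [|n IH]; rewrite ?mulr0n// !mulrS cReD IH.
  have GE w : G w = (chi w)%:C%C * \sum_(j < N) conjc (conjc th ^+ j * hdot z w) ^+ k *
      (cpow (1 - conjc th ^+ j * hdot z w) a)^-1.
    rewrite mulr_sumr; apply: eq_bigr => j _; rewrite mul1r /g chiR//.
    by rewrite hdot_scale rmorphXn.
  have Glow w : N%:R * (chi w * (bcoef a k * (normc (hdot z w) ^+ 2) ^+ k)) <=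
      complex.Re (G w) + N%:R * (B * `|tau N|).
    rewrite GE; set S := \sum_(j < N) _.
    have -> : complex.Re ((chi w)%:C%C * S) = chi w * complex.Re S by case: (S) => p q; rewrite /= mul0r subr0.
    have [w1|w1] := boolP (sqnorm w < 1); last first.
      by rewrite chi0// !mul0r mulr0 add0r !mulr_ge0.
    have := tauP N _ (hdot z w) pthc kN (normc_hdot_radius z w1).
    rewrite -/S mulrBr lerBlDr => /(ler_wpM2l (chi_ge0 w)) H.
    rewrite mulrCA; apply: le_trans H _; rewrite mulrDr lerD2l mulrCA ler_wpM2l//.
    have /andP[_ chiw] := chiB w.
    by apply: le_trans (ler_wpM2l (chi_ge0 w) (ler_norm _)) _; apply: ler_wpM2r.
  have NB0 : 0 <= N%:R * (B * `|tau N|) by rewrite !mulr_ge0.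
  have iR := cintegrable_Re iS.
  have NR0 : 0 < N%:R :> R by rewrite ltr0n.
  have H1 : (N%:R%:E * ((bcoef a k)%:E * \int[mu]_w (chi w * (normc (hdot z w) ^+ 2) ^+ k)%:E) <=
     (complex.Re (cintegral mu G) + N%:R * (B * `|tau N|))%:E)%E.
    rewrite EFinD muleA -EFinM -integral_scale//; last by rewrite mulr_ge0.
    have -> : (complex.Re (cintegral mu G))%:E = (\int[mu]_w (complex.Re (G w))%:E)%E.
      by rewrite /cintegral /= /Rintegral fineK//; exact: integrable_fin_num iR.
    have iK : mu.-integrable setT (fun=> (N%:R * (B * `|tau N|))%:E).
      exact: (finite_measure_integrable_cst (@ball_prob R d)).
    have -> : (N%:R * (B * `|tau N|))%:E = (\int[mu]_w (N%:R * (B * `|tau N|))%:E)%E.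
      rewrite (integral_cst mu measurableT (N%:R * (B * `|tau N|))%:E).
      by rewrite ball_measure_setT mule1.
    rewrite -integralD//; apply: ge0_le_integral => //.
    - by move=> w _; rewrite lee_fin; apply: mulr_ge0; [exact: mulr_ge0|exact: cu0].
    - by apply/measurable_EFinP; exact: measurable_funM.
    - apply/measurable_EFinP; apply: measurable_funD => //.
      by apply: measurable_fun_Re; exact: iS.1.
    - move=> w _; rewrite -EFinD lee_fin; apply: le_trans (Glow w).
      by rewrite -mulrA (mulrCA (bcoef a k)).
  rewrite -(@lee_pmul2l _ N%:R%:E)// ?lte_fin//; apply: le_trans H1 _.
  by rewrite EFinD -EFinM -EFinD lee_fin eG mulrDr.
(* Only the error term depends on [N], and it vanishes as [N] grows. *)
apply/lee_addgt0Pr => e e0.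
have cB : B * `|tau N| @[N --> \oo] --> 0.
  by rewrite -[X in _ --> X](mulr0 B); apply: cvgMr; rewrite -[X in _ --> X](normr0 R); exact: cvg_norm.
near \oo => N.
have kN : (k < N)%N by near: N; exact: nbhs_infty_gt.
apply: le_trans (key N kN) _; rewrite EFinD leeD2l// lee_fin ltW//.
by near: N; apply: (cvgr_lt _ cB).
Unshelve. all: by end_near. Qed.

End shell_coefficient.

(** * Riesz products *)

Section riesz_products.
Context {R : realType} (J : finType).
Implicit Types (x : J -> R) (b : J -> R[i]) (eps : {ffun J -> bool}).

(* Each factor has modulus [sqrt (1 + x_j ^ 2)], so the product stays bounded, while its correlation
   with a Rademacher sum is exactly bilinear. *)
Definition riesz x eps : R[i] := \prod_j (1 +i* ((-1) ^+ eps j * x j))%C.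

Definition rademacher b eps : R[i] := \sum_j (-1) ^+ eps j * b j.

(** [sqrt (1 + x^2) <= 1 + x^2 <= expR (x^2)] in each factor, whatever the signs and the number of
    factors. *)
Lemma normc_riesz x eps : \sum_j x j ^+ 2 <= 1 -> normc (riesz x eps) <= expR 1.
Proof.
move=> x1; apply: (@le_trans _ _ (\prod_j expR (x j ^+ 2))); last first.
  by rewrite -expR_sum ler_expR.
rewrite /riesz (big_morph (@normc R) (@normcM R) (@normc1 R)).
apply: ler_prod => j _; rewrite normc_ge0/=.
apply: le_trans (expR_ge1Dx _).
rewrite exprMn sqrr_sign mul1r expr1n.
have x0 := sqr_ge0 (x j); have t0 : 0 <= 1 + x j ^+ 2 by rewrite addr_ge0.
by rewrite -[leRHS](ger0_norm t0) -sqrtr_sqr ler_sqrt ?sqr_ge0// [leRHS]expr2; nra.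
Qed.

(** Independence of the signs. *)
Lemma sum_sign_prod (G : J -> bool -> R[i]) :
  \sum_(eps : {ffun J -> bool}) \prod_j G j (eps j) = \prod_j (G j true + G j false).
Proof. by rewrite -bigA_distr_bigA; apply: eq_bigr => j _; rewrite big_bool. Qed.

(** For a sign [e], the average of [(1 + i e x) e] is [i x] and that of [1 + i e x] is 1. Hence
    against the [l]-th sign only the [l]-th factor contributes. *)
Lemma sum_riesz_rademacher x b :
  \sum_eps riesz x eps * rademacher b eps =
  (2 ^ #|J|)%:R * (0 +i* 1)%C * \sum_j (x j)%:C%C * b j.
Proof.
under eq_bigr do rewrite mulr_sumr.
rewrite exchange_big/= mulr_sumr; apply: eq_bigr => l _.
under eq_bigr do rewrite mulrA.
rewrite -mulr_suml mulrA; congr (_ * _).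
pose G j e : R[i] := (1 +i* ((-1) ^+ nat_of_bool e * x j))%C * (if j == l then (-1) ^+ nat_of_bool e else 1).
transitivity (\sum_(eps : {ffun J -> bool}) \prod_j G j (eps j)).
  apply: eq_bigr => eps _; rewrite big_split/=; congr (_ * _).
  by rewrite (bigD1 l)//= eqxx big1 ?mulr1// => j /negbTE ->.
rewrite sum_sign_prod (bigD1 l)//= /G eqxx.
rewrite (eq_bigr (fun=> 2)); last first.
  move=> j /negbTE ->; rewrite !mulr1 expr1 expr0 mulN1r mul1r.
  by rewrite [RHS]mulr2n; apply/eqP; rewrite eq_complex/= addNr addr0 !eqxx.
have -> : (2 ^ #|J|)%:R = 2 * \prod_(j | j != l) 2 :> R[i].
  by rewrite natrX -prodr_const (bigD1 l).
set P := \prod_(j | j != l) 2.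
have -> : (1 +i* ((-1) ^+ true * x l))%C * (-1) ^+ true + (1 +i* ((-1) ^+ false * x l))%C * (-1) ^+ false =
    2 * (0 +i* 1)%C * (x l)%:C%C.
  by rewrite expr1 expr0 mulr1 mulN1r mul1r mulrN1 [2]mulr2n; apply/eqP; rewrite eq_complex/=; apply/andP; split; apply/eqP; ring.
by ring.
Qed.

Lemma sum_sign2 (l m : J) :
  \sum_(eps : {ffun J -> bool}) (-1) ^+ eps l * (-1) ^+ eps m = if l == m then (2 ^ #|J|)%:R else 0 :> R[i].
Proof.
have [->|lm] := eqVneq l m.
  under eq_bigr do rewrite -expr2 sqrr_sign.
  by rewrite sumr_const card_ffun card_bool.
pose G j e : R[i] := (if j == l then (-1) ^+ nat_of_bool e else 1) * (if j == m then (-1) ^+ nat_of_bool e else 1).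
transitivity (\sum_(eps : {ffun J -> bool}) \prod_j G j (eps j)).
  apply: eq_bigr => eps _; rewrite big_split/=; congr (_ * _).
    by rewrite (bigD1 l)//= eqxx big1 ?mulr1// => j /negbTE ->.
  by rewrite (bigD1 m)//= eqxx big1 ?mulr1// => j /negbTE ->.
by rewrite sum_sign_prod (bigD1 l)//= /G eqxx (negbTE lm) expr1 expr0 !mulr1 addNr mul0r.
Qed.

Lemma sum_rademacher_sqr b :
  \sum_eps normc (rademacher b eps) ^+ 2 = (2 ^ #|J|)%:R * \sum_j normc (b j) ^+ 2.
Proof.
apply: complexI; rewrite rmorph_sum rmorphM rmorph_nat rmorph_sum/= mulr_sumr.
transitivity (\sum_(eps : {ffun J -> bool}) \sum_l \sum_m (b l * conjc (b m)) * ((-1) ^+ eps l * (-1) ^+ eps m)).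
  apply: eq_bigr => eps _; rewrite sqr_normcE /rademacher mulr_suml; apply: eq_bigr => l _.
  rewrite rmorph_sum mulr_sumr; apply: eq_bigr => m _.
  by rewrite rmorphM/= rmorph_sign; ring.
rewrite exchange_big/=; apply: eq_bigr => l _; rewrite exchange_big/= (bigD1 l)//= [X in _ + X]big1 ?addr0.
  by rewrite -mulr_sumr sum_sign2 eqxx sqr_normcE mulrC.
by move=> m ml; rewrite -mulr_sumr sum_sign2 eq_sym (negbTE ml) mulr0.
Qed.

(** With [r] the Rademacher sum and [E] the average over signs, [A <= E |X r| <= (A/4) E |r|^2 + E
    |X|^2 / A]. The first term is at most [A/2], and [|X|^2 <= D |X|] in the second leaves
    [E |X| >= A^2 / (2 D)]. *)
Lemma sum_normc_ge (b : J -> R[i]) (X : {ffun J -> bool} -> R[i]) (A D : R) :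
  \sum_j normc (b j) ^+ 2 <= 2 -> 0 < A -> 0 < D -> (forall eps, normc (X eps) <= D) ->
  (2 ^ #|J|)%:R * A <= normc (\sum_eps X eps * rademacher b eps) ->
  (2 ^ #|J|)%:R * (A ^+ 2 / (2 * D)) <= \sum_eps normc (X eps).
Proof.
move=> b2 A0 D0 XD HA.
have n0 : 0 < (2 ^ #|J|)%:R :> R by rewrite ltr0n expn_gt0.
have pt eps : normc (X eps * rademacher b eps) <=
    A / 4 * normc (rademacher b eps) ^+ 2 + D / A * normc (X eps).
  have x0 := normc_ge0 (X eps); have := XD eps; rewrite normcM.
  move: (normc (X eps)) (normc (rademacher b eps)) x0 => x y x0 xD.
  have : x * y <= A / 4 * y ^+ 2 + x ^+ 2 / A.
    rewrite -subr_ge0; have -> : A / 4 * y ^+ 2 + x ^+ 2 / A - x * y = (A * y / 2 - x) ^+ 2 / A.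
      by field; rewrite gt_eqF.
    by rewrite divr_ge0 ?sqr_ge0 ?ltW.
  move=> /le_trans; apply; rewrite lerD2l expr2 mulrAC; apply: ler_wpM2r => //.
  by apply: ler_wpM2r => //; rewrite invr_ge0 ltW.
have := le_trans HA (le_trans (normc_sum _ _) (ler_sum _ (fun eps _ => pt eps))).
rewrite big_split/= -!mulr_sumr sum_rademacher_sqr.
move: (2 ^ _)%:R n0 (\sum_eps normc _) (\sum_j _) b2 => n n0 S s s2 H.
have h1 : A / 4 * (n * s) <= A / 4 * (n * 2).
  by rewrite ler_pM2l ?divr_gt0// ler_pM2l.
have h2 : n * A / 2 <= D / A * S by lra.
have -> : n * (A ^+ 2 / (2 * D)) = (n * A / 2) * (A / D) by field; rewrite gt_eqF.
have -> : S = D / A * S * (A / D) by field; rewrite !gt_eqF.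
by rewrite ler_pM2r ?divr_gt0.
Qed.

End riesz_products.

(** * Dyadic shells *)

Section bernoulli.
Context {R : realType}.
Implicit Types t : R.

Lemma bernoulli_ge t n : 0 <= t <= 1 -> 1 - n%:R * t <= (1 - t) ^+ n.
Proof.
move=> /andP[t0 t1]; elim: n => [|n IH]; first by rewrite mul0r subr0 expr0.
rewrite exprS -natr1; have t10 : 0 <= 1 - t by rewrite subr_ge0.
apply: le_trans (ler_wpM2l t10 IH).
have : 0 <= n%:R * (t * t) by rewrite !mulr_ge0.
nra.
Qed.

Lemma bernoulli_le t n : 0 <= t <= 1 -> (1 - t) ^+ n * (1 + n%:R * t) <= 1.
Proof.
move=> /andP[t0 t1]; elim: n => [|n IH]; first by rewrite expr0 mul0r addr0 mulr1.
have t10 : 0 <= 1 - t by rewrite subr_ge0.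
apply: le_trans IH; rewrite exprSr -mulrA ler_wpM2l ?exprn_ge0// -natr1.
have : 0 <= n%:R * (t * t) by rewrite !mulr_ge0.
have : 0 <= t * t by rewrite mulr_ge0.
nra.
Qed.

End bernoulli.

Section shells.
Context {R : realType} (d : nat).
Local Opaque Gamma eGamma bcoef.
Local Notation mu := (ball_measure R d).
Implicit Types z w : d.-tuple R[i].

(* On the shell [shell_radius n <= |w|^2 < shell_radius n.+1] one has [1 - |w|^2 ~ 2^-n], the scale at
   which the degree [2 ^ n] part of the kernel dominates. *)
Definition shell_radius n : R := 1 - 2^-1 ^+ n.+1.

Definition inshell n w := (shell_radius n <= sqnorm w) && (sqnorm w < shell_radius n.+1).

Lemma half_pow_le m n : (m <= n)%N -> 2^-1 ^+ n <= 2^-1 ^+ m :> R.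
Proof. by move=> mn; apply: ler_wiXn2l => //; rewrite ?invr_ge0// invf_le1 ?ler1n. Qed.

Lemma half_pow_gt0 n : 0 < 2^-1 ^+ n :> R.
Proof. by rewrite exprn_gt0. Qed.

Lemma rad_lt1 n : shell_radius n < 1. Proof. by have := half_pow_gt0 n.+1; rewrite /shell_radius; lra. Qed.

Lemma rad_ge n : 2^-1 <= shell_radius n.
Proof. by have := half_pow_le (ltn0Sn n); rewrite expr1 /shell_radius; lra. Qed.

Lemma rad_gt0 n : 0 < shell_radius n. Proof. by apply: lt_le_trans (rad_ge n). Qed.

Lemma rad_le m n : (m <= n)%N -> shell_radius m <= shell_radius n.
Proof. by move=> mn; rewrite lerD2l lerN2 half_pow_le. Qed.

Lemma inshell_lt1 n w : inshell n w -> sqnorm w < 1.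
Proof. by move=> /andP[_ /lt_trans]; apply; exact: rad_lt1. Qed.

Lemma inshell_uniq m n w : inshell m w -> inshell n w -> m = n.
Proof.
suff H a b : inshell a w -> inshell b w -> (a <= b)%N.
  by move=> hm hn; apply/eqP; rewrite eqn_leq !H.
move=> /andP[a1 _] /andP[_ b2]; rewrite leqNgt; apply/negP => /rad_le ba.
by have := lt_le_trans b2 (le_trans ba a1); rewrite ltxx.
Qed.

Lemma inshell_rotation n (c : R[i]) w : normc c = 1 -> inshell n (tscale c w) = inshell n w.
Proof. by move=> c1; rewrite /inshell sqnorm_scale c1 expr1n mul1r. Qed.

Lemma measurable_sqnorm_lt (r : R) : measurable_fun setT (fun w : d.-tuple R[i] => (sqnorm w < r)%R%:R : R).
Proof.
rewrite (_ : (fun _ => _) = \1_[set w | sqnorm w < r]); last first.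
  apply/funext => w; rewrite indicE; congr (nat_of_bool _)%:R.
  by apply/idP/idP => [h|]; [apply/mem_set|rewrite inE].
apply: measurable_indic; rewrite -[X in measurable X]setTI.
have -> : [set w : d.-tuple R[i] | sqnorm w < r] = (fun w => sqnorm w < r) @^-1` [set true].
  by apply/seteqP; split => w.
by apply: (@measurable_fun_ltr _ _ _ setT _ (cst r)) => //; exact: measurable_sqnorm.
Qed.

Lemma inshellE n w : (inshell n w)%:R = (sqnorm w < shell_radius n.+1)%R%:R - (sqnorm w < shell_radius n)%R%:R :> R.
Proof.
rewrite /inshell leNgt; have [w1|w1] := ltP (sqnorm w) (shell_radius n); last by rewrite subr0.
by rewrite (lt_le_trans w1 (rad_le (leqnSn n))) subrr.
Qed.

Lemma measurable_inshell n : measurable_fun setT (fun w => (inshell n w)%:R : R).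
Proof.
under eq_fun do rewrite inshellE.
by apply: measurable_funB; exact: measurable_sqnorm_lt.
Qed.

Lemma shell_moment n k z :
  (\int[mu]_w ((inshell n w)%:R * (normc (hdot z w) ^+ 2) ^+ k)%:E =
   ((shell_radius n.+1 ^+ (d + k) - shell_radius n ^+ (d + k)) *
     (Gamma (d%:R + 1) * k`!%:R / Gamma (d%:R + 1 + k%:R)) * sqnorm z ^+ k)%:E)%E.
Proof.
have mu2 := measurable_hdot_pow k z.
have u0 w : 0 <= (normc (hdot z w) ^+ 2) ^+ k by rewrite !exprn_ge0 ?normc_ge0.
have lt (m : nat) : (\int[mu]_w ((sqnorm w < shell_radius m)%R%:R * (normc (hdot z w) ^+ 2) ^+ k)%:E =
   (shell_radius m ^+ (d + k) * (Gamma (d%:R + 1) * k`!%:R / Gamma (d%:R + 1 + k%:R)) * sqnorm z ^+ k)%:E)%E.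
  rewrite -ball_moment_lt; last by rewrite rad_gt0 ltW ?rad_lt1.
  rewrite [RHS]integral_mkcond; apply: eq_integral => w _; rewrite patchE.
  case: ifPn => [|]; first by rewrite inE/= => ->; rewrite mul1r.
  by rewrite notin_setE/= => /negP/negbTE ->; rewrite mul0r.
have := lt n.+1.
have -> : (fun w => ((sqnorm w < shell_radius n.+1)%R%:R * (normc (hdot z w) ^+ 2) ^+ k)%:E) =
   (fun w => (1 * ((sqnorm w < shell_radius n)%R%:R * (normc (hdot z w) ^+ 2) ^+ k) +
              1 * ((inshell n w)%:R * (normc (hdot z w) ^+ 2) ^+ k))%:E).
  by apply/funext => w; rewrite !mul1r -mulrDl inshellE addrC subrK.
rewrite integral_lincomb; last 6 first.
- by apply: measurable_funM => //; exact: measurable_sqnorm_lt.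
- by apply: measurable_funM => //; exact: measurable_inshell.
- by move=> w; rewrite mulr_ge0.
- by move=> w; rewrite mulr_ge0.
- exact: ler01.
- exact: ler01.
rewrite !mul1e (lt n) => H.
(* The shell moment is a difference of two ball moments; its finiteness allows the subtraction in
   the extended reals. *)
have : (\int[mu]_w ((inshell n w)%:R * (normc (hdot z w) ^+ 2) ^+ k)%:E)%E \is a fin_num.
  have I0 : (0 <= \int[mu]_w ((inshell n w)%:R * (normc (hdot z w) ^+ 2) ^+ k)%:E)%E.
    by apply: integral_ge0 => w _; rewrite lee_fin mulr_ge0.
  rewrite ge0_fin_numE// ltey; apply/negP => /eqP E; move: H.
  by rewrite E addey.
move: H; set I := (\int[mu]_w _)%E => H /fineK <-; move: H => /(congr1 (fun x => x - (shell_radius n ^+ (d + k) * (Gamma (d%:R + 1) * k`!%:R / Gamma (d%:R + 1 + k%:R)) * sqnorm z ^+ k)%:E))%E.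
rewrite addeAC subee ?add0e// => ->; rewrite -EFinB /=; congr EFin; ring.
Qed.

(** With [dl = 2 ^ -(n+2)] the radii are [1 - 2 dl] and [1 - dl], and [2 ^ n * dl = 1/4].
    Bernoulli's inequalities bound the outer power below by [2 ^ -d * 3/4] and the quotient of the
    powers above by [4/5]; then [3/4 * 1/5 = 3/20]. *)
Lemma shell_gap n : shell_radius n.+1 ^+ (d + 2 ^ n) - shell_radius n ^+ (d + 2 ^ n) >= 2^-1 ^+ d * (3 / 20).
Proof.
pose dl : R := 2^-1 ^+ n.+2.
have dl0 : 0 < dl by exact: half_pow_gt0.
have dl2 : 2 * dl = 2^-1 ^+ n.+1 by rewrite /dl exprS mulrA divff ?mul1r.
have kd : (2 ^ n)%:R * dl = 4^-1 :> R.
  rewrite /dl natrX; have -> : n.+2 = (n + 2)%N by rewrite addn2.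
  rewrite exprD mulrA -exprMn divff// expr1n mul1r expr2; lra.
have dl14 : dl <= 4^-1.
  by rewrite -kd ler_peMl ?(ltW dl0)// ler1n expn_gt0.
have dl01 : 0 <= dl <= 1 by rewrite (ltW dl0); lra.
have r1E : shell_radius n = 1 - 2 * dl by rewrite dl2.
have r2E : shell_radius n.+1 = 1 - dl by [].
have r10 := rad_gt0 n; have r20 := rad_gt0 n.+1.
have r1le : shell_radius n <= shell_radius n.+1 * (1 - dl) by rewrite r1E r2E; nra.
set K := (d + 2 ^ n)%N.
have q0 : 0 <= (1 - dl) ^+ K by rewrite exprn_ge0; lra.
have qle : (1 - dl) ^+ K <= 4 / 5.
  have := bernoulli_le K dl01.
  have : 5 / 4 <= 1 + K%:R * dl.
    have : 4^-1 <= K%:R * dl by rewrite -kd ler_wpM2r ?(ltW dl0)// ler_nat leq_addl.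
    lra.
  move=> h1 h2; have := le_trans (ler_wpM2l q0 h1) h2; lra.
have h1 : shell_radius n ^+ K <= shell_radius n.+1 ^+ K * (4 / 5).
  apply: (@le_trans _ _ ((shell_radius n.+1 * (1 - dl)) ^+ K)); first by rewrite lerXn2r// nnegrE ltW//; apply: lt_le_trans r1le.
  by rewrite exprMn ler_wpM2l// exprn_ge0// ltW.
have h2 : 2^-1 ^+ d * (3 / 4) <= shell_radius n.+1 ^+ K.
  have p1 : 0 <= 2^-1 ^+ d :> R by rewrite ltW ?half_pow_gt0.
  have p2 : 0 <= 3 / 4 :> R by lra.
  rewrite /K exprD; apply: (ler_pM p1 p2).
    by apply: lerXn2r; rewrite ?nnegrE// ?(ltW r20)// rad_ge.
  by have := bernoulli_ge (2 ^ n) dl01; rewrite kd -r2E; lra.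
lra.
Qed.

(** At most one term is nonzero, the shells being disjoint. Each shell contributes a mass bounded
    below independently of [n], so the total mass grows at least linearly in [N]. *)
Definition omega N w : R := \sum_(n < N) (inshell n w)%:R / (1 - sqnorm w).

Lemma omega_shell N n w : (n < N)%N -> inshell n w -> omega N w = (1 - sqnorm w)^-1.
Proof.
move=> nN nw; rewrite /omega (bigD1 (Ordinal nN))//= nw mul1r big1 ?addr0// => m mn.
suff /negbTE -> : ~~ inshell m w by rewrite mul0r.
by apply: contra mn => mw; apply/eqP/val_inj; exact: inshell_uniq mw nw.
Qed.

Lemma omega_out N w : (forall n, (n < N)%N -> ~~ inshell n w) -> omega N w = 0.
Proof. by move=> out; rewrite /omega big1// => m _; rewrite (negbTE (out _ (ltn_ord m))) mul0r. Qed.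

Lemma omega_case N w : (exists2 n, (n < N)%N & inshell n w) \/ omega N w = 0.
Proof.
have [/existsP[n nw]|] := boolP [exists n : 'I_N, inshell n w]; first by left; exists n.
by rewrite negb_exists => /forallP h; right; apply: omega_out => n nN; exact: (h (Ordinal nN)).
Qed.

Lemma measurable_omega N : measurable_fun setT (omega N).
Proof.
have -> : omega N = (fun w => \sum_(n < N) (inshell n w)%:R * ((1 - sqnorm w) `^ (-1))).
  apply/funext => w; apply: eq_bigr => n _; have [nw|_] := boolP (inshell n w); last by rewrite !mul0r.
  by rewrite powR_inv1// subr_ge0 ltW// (inshell_lt1 nw).
by apply: measurable_sum => n; apply: measurable_funM; [exact: measurable_inshell|exact: measurable_weight].
Qed.


Lemma omega_ge0 N w : 0 <= omega N w.
Proof.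
have [[n nN nw]|->//] := omega_case N w.
by rewrite (omega_shell nN nw) invr_ge0 subr_ge0 ltW// (inshell_lt1 nw).
Qed.

Lemma omega_le_inv N w : sqnorm w < 1 -> omega N w <= (1 - sqnorm w)^-1.
Proof.
move=> w1; have [[n nN nw]|->] := omega_case N w; first by rewrite (omega_shell nN nw).
by rewrite invr_ge0 subr_ge0 ltW.
Qed.

Lemma inshell_bounds n w : inshell n w -> 2^-1 ^+ n.+2 < 1 - sqnorm w <= 2^-1 ^+ n.+1.
Proof. by move=> /andP[]; rewrite /shell_radius => a b; apply/andP; split; lra. Qed.

Lemma omega_le N w : omega N w <= 2 ^+ N.+1.
Proof.
have [[n nN nw]|->] := omega_case N w; last by rewrite exprn_ge0.
rewrite (omega_shell nN nw); have /andP[h _] := inshell_bounds nw.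
have p := half_pow_gt0 n.+2.
apply: (@le_trans _ _ (2^-1 ^+ n.+2)^-1).
  by rewrite lef_pV2 ?posrE ?ltW// (lt_trans p).
by rewrite exprVn invrK ler_weXn2l// ler1n.
Qed.

End shells.

Lemma powRVl (R : realType) (a x : R) : 0 <= a -> a^-1 `^ x = a `^ (- x).
Proof. by move=> a0; rewrite -powR_inv1// -powRrM mulN1r. Qed.

Section shell_estimates.
Context {R : realType} (d : nat).
Local Opaque Gamma eGamma bcoef.
Local Notation mu := (ball_measure R d).
Implicit Types z w : d.-tuple R[i].

Lemma shell_measure n :
  (\int[mu]_w ((inshell n w)%:R)%:E = (shell_radius n.+1 ^+ d - shell_radius n ^+ d)%:E)%E.
Proof.
have := shell_moment n 0 [tuple of nseq d (0 : R[i])].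
under eq_integral do rewrite expr0 mulr1.
move=> ->; rewrite addn0 fact0 expr0 !mulr1 addr0 divff ?mulr1//.
by rewrite gt_eqF// Gamma_gt0// ltr_wpDl.
Qed.

(** With [d = e + 1], the difference of powers is at least [shell_radius n.+1 ^+ e] times the width
    [2 ^ -(n+2)]. For [d = 0] the shells have no mass, hence [1 <= d]. *)
Lemma shell_measure_ge n : (1 <= d)%N ->
  2^-1 ^+ d <= 2 ^+ n.+1 * (shell_radius n.+1 ^+ d - shell_radius n ^+ d) :> R.
Proof.
case: d => // e _; have r0 := @rad_gt0 R n; have r1 := @rad_le R _ _ (leqnSn n).
have h1 : shell_radius n ^+ e.+1 <= shell_radius n.+1 ^+ e * shell_radius n :> R.
  by rewrite exprSr ler_wpM2r ?(ltW r0)//; apply: lerXn2r; rewrite ?nnegrE ?(ltW r0) ?(ltW (rad_gt0 _)).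
have h2 : 2^-1 ^+ e * 2^-1 ^+ n.+2 <= shell_radius n.+1 ^+ e.+1 - shell_radius n ^+ e.+1 :> R.
  apply: (@le_trans _ _ (shell_radius n.+1 ^+ e * (shell_radius n.+1 - shell_radius n))); last by rewrite exprSr; lra.
  have -> : shell_radius n.+1 - shell_radius n = 2^-1 ^+ n.+2 :> R.
    by rewrite /shell_radius !(exprS _ n.+1); lra.
  apply: ler_wpM2r; first by rewrite ltW ?half_pow_gt0.
  by apply: lerXn2r; rewrite ?nnegrE ?(ltW (rad_gt0 _)) ?rad_ge// invr_ge0.
have p2 : 0 <= 2 ^+ n.+1 :> R by rewrite exprn_ge0.
apply: le_trans (ler_wpM2l p2 h2).
have ah : 2 ^+ n.+1 * 2^-1 ^+ n.+1 = 1 :> R by rewrite -exprMn divff// expr1n.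
rewrite (exprS 2^-1 n.+1) (exprS 2^-1 e).
have -> : 2 ^+ n.+1 * (2^-1 ^+ e * (2^-1 * 2^-1 ^+ n.+1)) =
  (2 ^+ n.+1 * 2^-1 ^+ n.+1) * (2^-1 * 2^-1 ^+ e) :> R by ring.
by rewrite ah mul1r.
Qed.

(** On shell [n] the density is at least [2 ^ (n+1)], which compensates the measure of the shell, so
    each of the [N] shells contributes at least [2 ^ -d]. *)
Lemma omega_integral_ge N : (1 <= d)%N ->
  ((N%:R * 2^-1 ^+ d)%:E <= \int[mu]_w (omega N w)%:E)%E.
Proof.
move=> d1; apply: (@le_trans _ _ (\int[mu]_w (\sum_(n < N) (2 ^+ n.+1 * (inshell n w)%:R))%:E)%E).
  under eq_integral do rewrite -sumEFin.
  rewrite ge0_integral_sum; last 3 first.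
  - exact: measurableT.
  - move=> n; apply/measurable_EFinP; apply: measurable_funM => //; exact: measurable_inshell.
  - by move=> n w _; rewrite lee_fin mulr_ge0 ?exprn_ge0.
  rewrite mulr_natl -[X in (_ *+ X)%:E]card_ord -sumr_const -sumEFin; apply: lee_sum => n _.
  rewrite integral_scale; last 3 first.
  - exact: measurable_inshell.
  - by move=> w; exact: ler0n.
  - by rewrite exprn_ge0.
  by rewrite shell_measure -EFinM lee_fin shell_measure_ge.
apply: ge0_le_integral => //.
- by move=> w _; rewrite lee_fin sumr_ge0// => n _; rewrite mulr_ge0 ?exprn_ge0.
- by apply/measurable_EFinP; apply: measurable_sum => n; apply: measurable_funM => //; exact: measurable_inshell.
- by apply/measurable_EFinP; exact: measurable_omega.
- move=> w _; rewrite lee_fin; apply: ler_sum => n _.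
  have [nw|_] := boolP (inshell n w); last by rewrite mulr0 mul0r.
  have /andP[a b] := inshell_bounds nw; have p := @half_pow_gt0 R n.+2.
  rewrite mulr1 mul1r -[X in X <= _]invrK -exprVn lef_pV2 ?posrE ?half_pow_gt0//.
  exact: lt_trans a.
Qed.

Lemma omega_integral_lty N : (\int[mu]_w (omega N w)%:E < +oo)%E.
Proof.
apply: (@le_lt_trans _ _ (\int[mu]_w (2 ^+ N.+1)%:E)%E).
  apply: ge0_le_integral => //.
  - by move=> w _; rewrite lee_fin omega_ge0.
  - by apply/measurable_EFinP; exact: measurable_omega.
  - by move=> w _; rewrite lee_fin omega_le.
by rewrite (integral_cst mu measurableT (2 ^+ N.+1)%:E) ball_measure_setT mule1 ltry.
Qed.

(** The Gamma quotient comes from the Taylor coefficient and the moment, and the next factor from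
    [shell_gap]. The 16 is [2 * 2 * 4]: from [Gamma_add_ge], from [|z| ^ (2k) >= 1/2] on the shell,
    and from [shell_weight_le]. *)
Definition kernel_low (c : R) : R :=
  Gamma (d%:R + 1) / Gamma (d%:R + 1 + c) * (2^-1 ^+ d * (3 / 20)) / 16.

Lemma kernel_low_gt0 c : 0 <= c -> 0 < kernel_low c.
Proof.
move=> c0; have d0 : 0 <= d%:R :> R by [].
have p1 : 0 < d%:R + 1 :> R by lra.
have p2 : 0 < d%:R + 1 + c by lra.
have p3 : 0 < 3 / 20 :> R by lra.
have G1 := Gamma_gt0 p1; have G2 := Gamma_gt0 p2.
rewrite /kernel_low; apply: divr_gt0; last by []; apply: mulr_gt0; first exact: divr_gt0.
by apply: mulr_gt0 => //; exact: half_pow_gt0.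
Qed.

Lemma shell_weight_ge n w (x0 : R) : 0 <= x0 -> inshell n w ->
  (2 ^ n)%:R `^ x0 <= (1 - sqnorm w) `^ (- x0).
Proof.
move=> x00 nw; have /andP[a b] := inshell_bounds nw; have p := @half_pow_gt0 R n.+2.
have q : 0 < 1 - sqnorm w by exact: lt_trans a.
rewrite -powRVl ?(ltW q)//.
apply: ge0_ler_powR => //; rewrite ?nnegrE ?invr_ge0 ?(ltW q)//.
rewrite natrX -[X in X <= _]invrK -exprVn lef_pV2 ?posrE ?half_pow_gt0//.
by apply: le_trans b _; exact: half_pow_le.
Qed.

(** On the shell [1 / (1 - |z|^2)] is below [4 * 2 ^ n], and [4 ^ y <= 4]. *)
Lemma shell_weight_le n z (y : R) : 0 <= y <= 1 -> inshell n z ->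
  (1 - sqnorm z) `^ (- y) <= 4 * (2 ^ n)%:R `^ y.
Proof.
move=> /andP[y0 y1] nz; have /andP[a b] := inshell_bounds nz; have p := @half_pow_gt0 R n.+2.
have q : 0 < 1 - sqnorm z by exact: lt_trans a.
apply: (@le_trans _ _ ((4 * (2 ^ n)%:R) `^ y)).
  rewrite -powRVl ?(ltW q)//.
  apply: ge0_ler_powR => //; rewrite ?nnegrE ?invr_ge0 ?(ltW q)// ?mulr_ge0//.
  have -> : 4 * (2 ^ n)%:R = (2^-1 ^+ n.+2)^-1 :> R.
    by rewrite exprVn invrK natrX !exprS; ring.
  by rewrite lef_pV2 ?posrE// ltW.
rewrite powRM// ler_wpM2r ?powR_ge0// -[leRHS]powRr1//.
by apply: ler_powR => //; rewrite ler1n.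
Qed.

(** With [k = 2 ^ n], the weight contributes [k ^ x0]. The coefficient times the moment contributes
    [Gamma (d+1+k+c) / Gamma (d+1+k)], at least [k ^ c / 2]. On the shell [k ^ (x0 + c)] is
    comparable to [(1 - |z|^2) ^ (- (x0 + c))]. *)
Lemma shell_kernel_ge n z (x0 c : R) : 0 <= x0 -> 0 <= c -> x0 + c <= 1 -> inshell n z ->
  ((kernel_low c * (1 - sqnorm z) `^ (- (x0 + c)))%:E <=
   (bcoef (d%:R + 1 + c) (2 ^ n))%:E *
   \int[mu]_w ((inshell n w)%:R * (1 - sqnorm w) `^ (- x0) * (normc (hdot z w) ^+ 2) ^+ (2 ^ n))%:E)%E.
Proof.
move=> x00 c0 xc1 nz; set k := (2 ^ n)%N.
have k1 : 1 <= k%:R :> R by rewrite ler1n expn_gt0.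
have k0 : 0 < k%:R :> R by apply: lt_le_trans k1.
have d0 : 0 <= d%:R :> R by [].
have mu2 := measurable_hdot_pow k z.
have u0 w : 0 <= (normc (hdot z w) ^+ 2) ^+ k by rewrite !exprn_ge0 ?normc_ge0.
have Z : 2^-1 <= sqnorm z ^+ k.
  have /andP[zr _] := nz.
  apply: (@le_trans _ _ (shell_radius n ^+ k)); last by apply: lerXn2r; rewrite ?nnegrE ?sqnorm_ge0 ?(ltW (rad_gt0 _)).
  have h01 : 0 <= (2^-1 ^+ n.+1 : R) <= 1.
    by rewrite ltW ?half_pow_gt0//= exprn_ile1 ?invr_ge0// invf_le1 ?ler1n.
  apply: le_trans (bernoulli_ge k h01).
  have : k%:R * 2^-1 ^+ n.+1 = 2^-1 :> R.
    by rewrite /k natrX exprS mulrCA -exprMn divff// expr1n mulr1.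
  by move=> ->; clear; lra.
have low : ((k%:R `^ x0 * ((shell_radius n.+1 ^+ (d + k) - shell_radius n ^+ (d + k)) *
     (Gamma (d%:R + 1) * k`!%:R / Gamma (d%:R + 1 + k%:R)) * sqnorm z ^+ k))%:E <=
    \int[mu]_w ((inshell n w)%:R * (1 - sqnorm w) `^ (- x0) * (normc (hdot z w) ^+ 2) ^+ k)%:E)%E.
  rewrite EFinM -shell_moment -integral_scale; last 3 first.
  - by apply: measurable_funM => //; exact: measurable_inshell.
  - by move=> w; rewrite mulr_ge0.
  - exact: powR_ge0.
  apply: ge0_le_integral => //.
  - by move=> w _; rewrite lee_fin mulr_ge0 ?powR_ge0// mulr_ge0.
  - apply/measurable_EFinP; apply: measurable_funM => //.
    by apply: measurable_funM => //; exact: measurable_inshell.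
  - apply/measurable_EFinP; apply: measurable_funM => //.
    by apply: measurable_funM; [exact: measurable_inshell|exact: measurable_weight].
  - move=> w _; rewrite lee_fin mulrA; apply: ler_wpM2r => //.
    have [nw|_] := boolP (inshell n w); last by rewrite mulr0 mul0r.
    by rewrite mulr1 mul1r shell_weight_ge.
have b0 : 0 <= bcoef (d%:R + 1 + c) k by apply: bcoef_ge0; lra.
have b0E : (0 <= (bcoef (d%:R + 1 + c) k)%:E)%E by rewrite lee_fin.
apply: le_trans (lee_wpmul2l b0E low); rewrite -EFinM lee_fin bcoefE.
have y01 : 0 <= x0 + c <= 1 by rewrite addr_ge0.
have hz := shell_weight_le y01 nz.
have p1 : 0 < d%:R + 1 :> R by lra.
have p2 : 0 < d%:R + 1 + c by lra.
have p3 : 1 <= d%:R + 1 + k%:R :> R by lra.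
have p4 : 0 < d%:R + 1 + k%:R :> R by lra.
have c01 : 0 <= c <= 1 by rewrite c0; lra.
have kc : k%:R `^ c <= (d%:R + 1 + k%:R) `^ c.
  by apply: (ge0_ler_powR c0); rewrite ?nnegrE ?(ltW k0) ?(ltW p4)//; lra.
have GA := Gamma_add_ge p3 c01.
have G1 := Gamma_gt0 p1; have G2 := Gamma_gt0 p2; have G4 := Gamma_gt0 p4.
have gap := @shell_gap R d n; rewrite -/k in gap.
have kxc : k%:R `^ (x0 + c) = k%:R `^ x0 * k%:R `^ c by rewrite powRD ?(lt0r_neq0 k0) ?implybT.
rewrite kxc in hz.
have E : d%:R + 1 + c + k%:R = d%:R + 1 + k%:R + c :> R by ring.
rewrite E /kernel_low.
have kf : 0 < k`!%:R :> R by rewrite ltr0n fact_gt0.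
have kx0 : 0 <= k%:R `^ x0 by exact: powR_ge0.
have kc0 : 0 <= k%:R `^ c by exact: powR_ge0.
have h0 : 0 <= 2^-1 ^+ d * (3 / 20) :> R by rewrite mulr_ge0 ?(ltW (half_pow_gt0 _))//; lra.
move: (Gamma (d%:R + 1)) (Gamma (d%:R + 1 + c)) (Gamma (d%:R + 1 + k%:R)) (Gamma (_ + c)) ((_ + k%:R) `^ c)
  (k%:R `^ x0) (k%:R `^ c) (sqnorm z ^+ k) (2^-1 ^+ d * (3 / 20)) (shell_radius n.+1 ^+ (d + k) - shell_radius n ^+ (d + k))
  (k`!%:R) ((1 - sqnorm z) `^ _) G1 G2 G4 GA kc hz Z gap kf kx0 kc0 h0.
clear=> g ga g1 gak pc kx kc zk h gp f hz g0 ga0 g10 GA kcpc hzle Z gap f0 kx0 kc0 h0.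
have -> : gak / (ga * f) * (kx * (gp * (g * f / g1) * zk)) = g / ga * (gak / g1) * gp * zk * kx.
  by field; rewrite !gt_eqF.
have q : 2^-1 * kc <= gak / g1.
  rewrite ler_pdivlMr//; apply: le_trans GA; rewrite -mulrA ler_pM2l ?invr_gt0//.
  by apply: ler_wpM2r => //; exact: ltW.
have gga : 0 <= g / ga by rewrite divr_ge0 ?ltW.
apply: (@le_trans _ _ (g / ga * (2^-1 * kc) * h * 2^-1 * kx)).
  have -> : g / ga * (2^-1 * kc) * h / 2 * kx = (g / ga * h / 16) * (4 * (kx * kc)) by field; rewrite gt_eqF.
  by apply: ler_wpM2l => //; rewrite divr_ge0// mulr_ge0.
have A0 : 0 <= g / ga * (2^-1 * kc) by apply: mulr_ge0 => //; rewrite mulr_ge0.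
have Ah0 : 0 <= g / ga * (2^-1 * kc) * h by exact: mulr_ge0.
apply: ler_wpM2r => //; apply: ler_pM => //.
by apply: ler_pM => //; exact: ler_wpM2l.
Qed.

End shell_estimates.

(** * Densities and [L^p] norms on a probability space *)

Section density_bounds.
Context {R : realType} dd (T : measurableType dd) (mu : probability T R).

Lemma integral_prob1 : (\int[mu]_x (1 : R)%:E = 1)%E.
Proof. by rewrite (integral_cst mu measurableT 1%E) mul1e; exact: probability_setT. Qed.

(** Weighted AM-GM for [u], [v] and 1 with weights [y], [1 - y0] and [y0 - y], by two applications
    of the two-term inequality. *)
Lemma powR_amgm3 (u v y y0 : R) : 0 <= u -> 0 <= v -> 0 <= y <= y0 -> y0 <= 1 ->
  u `^ y * v `^ (1 - y0) <= y * u + (1 - y0) * v + (y0 - y).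
Proof.
move=> u0 v0 /andP[y_0 yy0] y01.
have [y00|y0n] := eqVneq y0 0.
  have -> : y = 0 by apply/le_anti; rewrite y_0 -y00 yy0.
  by rewrite y00 subr0 powRr0 powRr1//; lra.
have y0p : 0 < y0 by rewrite lt_neqAle eq_sym y0n (le_trans y_0).
have th01 : 0 <= y / y0 <= 1 by rewrite divr_ge0 ?(ltW y0p)//= ler_pdivrMr// mul1r.
have H := powR_amgm u0 ler01 th01; rewrite powR1 mulr1 in H.
have H2 : u `^ y <= (y / y0 * u + (1 - y / y0) * 1) `^ y0.
  have -> : u `^ y = (u `^ (y / y0)) `^ y0 by rewrite -powRrM divfK.
  apply: ge0_ler_powR => //; rewrite ?nnegrE ?powR_ge0 ?(ltW y0p)//.
  by apply: le_trans H; exact: powR_ge0.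
have w0 : 0 <= y / y0 * u + (1 - y / y0) * 1 by apply: le_trans H; exact: powR_ge0.
have y0_01 : 0 <= y0 <= 1 by rewrite (ltW y0p).
apply: le_trans (ler_wpM2r (powR_ge0 _ _) H2) _.
apply: le_trans (powR_amgm w0 v0 y0_01) _.
have -> : y0 * (y / y0 * u + (1 - y / y0) * 1) = y * u + (y0 - y) by field.
by lra.
Qed.

(** Hoelder's inequality with slack: when [y < y0] the exponents of [u] and [v] sum to less than 1,
    and on a probability space the constant 1 supplies the rest. *)
Lemma integral_density_le (g u v : T -> R) (M y y0 : R) :
  measurable_fun setT g -> measurable_fun setT u -> measurable_fun setT v ->
  (forall x, 0 <= g x) -> (forall x, 0 <= u x) -> (forall x, 0 <= v x) -> 0 <= M ->
  0 <= y <= y0 -> y0 <= 1 ->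
  (\int[mu]_x (u x)%:E <= 1)%E -> (\int[mu]_x (v x)%:E <= 1)%E ->
  {ae mu, forall x, g x <= M * u x `^ y} ->
  (\int[mu]_x (g x * v x `^ (1 - y0))%:E <= M%:E)%E.
Proof.
move=> mg mu_ mv g0 u0 v0 M0 yy0 y01 uI vI gu; have /andP[y_0 yy0'] := yy0.
have y10 : 0 <= 1 - y0 by rewrite subr_ge0.
have yd0 : 0 <= y0 - y by rewrite subr_ge0.
have B0 x : 0 <= y * u x + (1 - y0) * v x + (y0 - y) by rewrite addr_ge0// addr_ge0// mulr_ge0.
have mB : measurable_fun setT (fun x => y * u x + (1 - y0) * v x + (y0 - y)).
  by apply: measurable_funD => //; apply: measurable_funD; exact: measurable_funM.
apply: (@le_trans _ _ (\int[mu]_x (M * (y * u x + (1 - y0) * v x + (y0 - y)))%:E)%E).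
  apply: ae_ge0_le_integral => //.
  - by move=> x _; rewrite lee_fin mulr_ge0 ?powR_ge0.
  - apply/measurable_EFinP; apply: measurable_funM => //.
    exact: (measurableT_comp (@measurable_powR R _) mv).
  - by move=> x _; rewrite lee_fin mulr_ge0.
  - by apply/measurable_EFinP; exact: measurable_funM.
  apply: filterS gu => x gx _; rewrite lee_fin.
  apply: le_trans (ler_wpM2r (powR_ge0 _ _) gx) _; rewrite -mulrA ler_wpM2l//.
  exact: powR_amgm3.
rewrite integral_scale// -[leRHS]mule1; apply: lee_wpmul2l; first by rewrite lee_fin.
under eq_integral do rewrite -[X in _ + X]mulr1.
have -> : (fun x => (y * u x + (1 - y0) * v x + (y0 - y) * 1)%:E) =
   (fun x => (1 * (y * u x + (1 - y0) * v x) + (y0 - y) * 1)%:E) by apply/funext => x; rewrite mul1r.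
rewrite integral_lincomb//; last 2 first.
- by apply: measurable_funD; exact: measurable_funM.
- by move=> x; rewrite addr_ge0 ?mulr_ge0.
rewrite mul1e integral_lincomb// integral_prob1.
apply: (@le_trans _ _ (y%:E * 1 + (1 - y0)%:E * 1 + (y0 - y)%:E)%E).
  by apply: leeD; [|by rewrite mule1]; apply: leeD; apply: lee_wpmul2l; rewrite ?lee_fin.
by rewrite !mule1 -!EFinD lee_fin; lra.
Qed.

(** A converse to [cLnorm_le_density]. An exponent [x0] below [recip p] is allowed, since
    [u ^ (x0 r) <= x0 r u + (1 - x0 r)] and the total mass is 1. *)
Lemma cLnorm_le_of_density p (f : T -> R[i]) (u : T -> R) (M x0 : R) : (1 <= p)%E ->
  measurable_fun setT f -> measurable_fun setT u -> (forall x, 0 <= u x) ->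
  (\int[mu]_x (u x)%:E <= 1)%E -> 0 <= x0 <= recip p -> 0 <= M ->
  (forall x, normc (f x) <= M * u x `^ x0) -> (cLnorm mu p f <= M%:E)%E.
Proof.
move=> p1 mf mu_ u0 uI; case: p p1 => [r| |//]; last first.
  rewrite {1}/recip /= => _ /andP[x00 x01] M0 fu.
  have x0E : x0 = 0 by apply/le_anti; rewrite x00 x01.
  have mT0 : (0 < mu setT)%E by rewrite [X in (_ < X)%E](probability_setT mu) lte01.
  rewrite /cLnorm unlock mT0; apply/ess_supP; apply: aeW => x /=.
  by rewrite lee_fin ger0_norm ?normc_ge0// (le_trans (fu x))// x0E powRr0 mulr1.
rewrite lee_fin => r1; have r0 : 0 < r by apply: lt_le_trans r1.
have rn : r != 0 by rewrite gt_eqF.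
rewrite recip_fin// => /andP[x00 x01] M0 fu; rewrite cLnormE.
have th01 : 0 <= x0 * r <= 1.
  by rewrite mulr_ge0 ?(ltW r0)//= -ler_pdivlMr// mul1r.
have /andP[th0 th1] := th01; have th10 : 0 <= 1 - x0 * r by rewrite subr_ge0.
have Mr0 : 0 <= M `^ r by exact: powR_ge0.
have I0 : (0 <= \int[mu]_x (normc (f x) `^ r)%:E)%E.
  by apply: integral_ge0 => x _; rewrite lee_fin powR_ge0.
have le : (\int[mu]_x (normc (f x) `^ r)%:E <= (M `^ r)%:E)%E.
  apply: (@le_trans _ _ (\int[mu]_x (M `^ r * (x0 * r * u x + (1 - x0 * r) * 1))%:E)%E).
    apply: ge0_le_integral => //.
    - by move=> x _; rewrite lee_fin powR_ge0.
    - apply/measurable_EFinP; apply: (measurableT_comp (@measurable_powR R _)).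
      exact: measurable_fun_normc.
    - apply/measurable_EFinP; apply: measurable_funM => //.
      by apply: measurable_funD => //; exact: measurable_funM.
    - move=> x _; rewrite lee_fin; apply: (@le_trans _ _ ((M * u x `^ x0) `^ r)).
        by apply: (ge0_ler_powR (ltW r0)); rewrite ?nnegrE ?normc_ge0 ?mulr_ge0 ?powR_ge0.
      rewrite powRM ?powR_ge0// -powRrM ler_wpM2l//.
      by have := powR_amgm (u0 x) ler01 th01; rewrite powR1 mulr1.
  rewrite integral_scale//; last 2 first.
  - by apply: measurable_funD => //; exact: measurable_funM.
  - by move=> x; rewrite mulr1 addr_ge0// mulr_ge0.
  rewrite -[leRHS]mule1; apply: lee_wpmul2l; first by rewrite lee_fin.
  rewrite integral_lincomb// integral_prob1.
  apply: (@le_trans _ _ ((x0 * r)%:E * 1 + (1 - x0 * r)%:E * 1)%E).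
    by apply: leeD => //; apply: lee_wpmul2l; rewrite ?lee_fin.
  by rewrite !mule1 -EFinD lee_fin; lra.
have rV0 : 0 <= r^-1 by rewrite invr_ge0 ltW.
have := gt0_ler_poweR rV0; move=> /(_ _ _ _ _ le).
rewrite !in_itv/= !leey !andbT I0 lee_fin Mr0 => /(_ isT isT) /le_trans; apply.
by rewrite lee_fin -powRrM divff// powRr1.
Qed.

End density_bounds.

(** * Lacunary functions and the necessary condition on the exponents *)

Section lacunary.
Context {R : realType} (d N : nat).
Local Opaque Gamma eGamma bcoef.
Local Notation mu := (ball_measure R d).
Implicit Types z w : d.-tuple R[i].

(** A degree [2 ^ n] together with a word of that length in the coordinates. Words are used instead
    of multi-indices so that powers of [hdot] expand without multinomial coefficients. *)
Definition monoidx := {n : 'I_N & {ffun 'I_(2 ^ n) -> 'I_d}}.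

(* The sum over [i] of [amon i w * conjc (amon i z)] is the positive definite kernel equal to
   [hdot w z ^+ (2 ^ n)] when both points lie in shell [n], and to [0] otherwise. *)
Definition amon (i : monoidx) w : R[i] :=
  (inshell (tag i) w)%:R * \prod_(l < 2 ^ tag i) tnth w (tagged i l).

Lemma amon_sum w z : \sum_(i : monoidx) amon i w * conjc (amon i z) =
  \sum_(n < N) (inshell n w)%:R * (inshell n z)%:R * hdot w z ^+ (2 ^ n).
Proof.
rewrite -(@sig_big_dep _ _ _ 'I_N (fun n : 'I_N => {ffun 'I_(2 ^ n) -> 'I_d}) xpredT (fun _ => xpredT) (fun (n : 'I_N) (phi : {ffun 'I_(2 ^ n) -> 'I_d}) =>
  ((inshell n w)%:R * \prod_(l < 2 ^ n) tnth w (phi l)) *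
  conjc ((inshell n z)%:R * \prod_(l < 2 ^ n) tnth z (phi l))))/=.
apply: eq_bigr => n _.
have -> : hdot w z ^+ (2 ^ n) =
    \sum_(phi : {ffun 'I_(2 ^ n) -> 'I_d}) \prod_(l < 2 ^ n) (tnth w (phi l) * conjc (tnth z (phi l))).
  by rewrite -(bigA_distr_bigA (fun (_ : 'I_(2 ^ n)) j => tnth w j * conjc (tnth z j))) prodr_const card_ord.
rewrite mulr_sumr; apply: eq_bigr => phi _.
rewrite rmorphM rmorph_prod rmorph_nat big_split/=; ring.
Qed.

Lemma amon_sum_shell n w z : (n < N)%N -> inshell n z ->
  \sum_(i : monoidx) amon i w * conjc (amon i z) = (inshell n w)%:R * hdot w z ^+ (2 ^ n).
Proof.
move=> nN nz; rewrite amon_sum (bigD1 (Ordinal nN))//= nz mulr1 big1 ?addr0// => m mn.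
suff /negbTE -> : ~~ inshell m z by rewrite mulr0 mul0r.
by apply: contra mn => mz; apply/eqP/val_inj; exact: inshell_uniq mz nz.
Qed.

Lemma hdot_diag w : hdot w w = (sqnorm w)%:C%C.
Proof. by rewrite /sqnorm rmorph_sum; apply: eq_bigr => j _; exact/esym/sqr_normcE. Qed.

Lemma amon_sqr_le w : \sum_(i : monoidx) normc (amon i w) ^+ 2 <= 1.
Proof.
have E : (\sum_(i : monoidx) normc (amon i w) ^+ 2)%:C%C = \sum_(i : monoidx) amon i w * conjc (amon i w).
  by rewrite rmorph_sum; apply: eq_bigr => i _; exact: sqr_normcE.
have [[n nN nw]|out] : (exists2 n, (n < N)%N & inshell n w) \/ (forall n, (n < N)%N -> ~~ inshell n w).
  have [/existsP[n nw]|] := boolP [exists n : 'I_N, inshell n w]; first by left; exists n.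
  by rewrite negb_exists => /forallP h; right => n nN; exact: (h (Ordinal nN)).
  move: E; rewrite (amon_sum_shell _ nN nw) nw mul1r hdot_diag -rmorphXn => /complexI ->.
  by rewrite exprn_ile1 ?sqnorm_ge0// ltW// (inshell_lt1 nw).
rewrite big1// => i _; rewrite /amon (negbTE (out _ (ltn_ord (tag i)))) mul0r normc0 expr0n.
by [].
Qed.

Lemma measurable_inshell_C n : measurable_fun setT (fun w : d.-tuple R[i] => (inshell n w)%:R : R[i]).
Proof.
apply: measurable_fun_complex; under eq_fun do rewrite -(rmorph_nat (real_complex R)).
  exact: measurable_inshell.
exact: measurable_cst.
Qed.

Lemma measurable_amon i : measurable_fun setT (amon i).
Proof.
apply: measurable_cmul; first exact: measurable_inshell_C.
by apply: measurable_cprod => l; exact: measurable_tnth.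
Qed.

(** A Riesz product takes real coefficients, so each monomial is split into its real and imaginary
    parts. The factor [i] in [bz] reassembles them, so that the pairing of [xr w] with [bz z] is the
    kernel of [amon_sum]; the doubling of indices raises the bound 1 to 2 in [bz_sqr_le]. *)
Definition xr w (j : monoidx * bool) : R :=
  if j.2 then complex.Im (amon j.1 w) else complex.Re (amon j.1 w).

Definition bz z (j : monoidx * bool) : R[i] :=
  if j.2 then (0 +i* 1)%C * conjc (amon j.1 z) else conjc (amon j.1 z).

Lemma xr_sqr_le w : \sum_j xr w j ^+ 2 <= 1.
Proof.
apply: le_trans (amon_sqr_le w).
rewrite -(pair_bigA _ (fun i b => (if b then complex.Im (amon i w) else complex.Re (amon i w)) ^+ 2))/=.
by apply: ler_sum => i _; rewrite big_bool/= addrC Defs.normcE.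
Qed.

Lemma bz_sqr_le z : \sum_j normc (bz z j) ^+ 2 <= 2.
Proof.
apply: (@le_trans _ _ (2 * \sum_(i : monoidx) normc (amon i z) ^+ 2)); last first.
  by have := amon_sqr_le z; lra.
rewrite mulr_sumr -(pair_bigA _ (fun i (b : bool) => normc (if b then (0 +i* 1)%C * conjc (amon i z) else conjc (amon i z)) ^+ 2))/=.
apply: ler_sum => i _; rewrite big_bool/= normcM normc_conj.
have -> : normc (0 +i* 1 : R[i])%C = 1 by rewrite /= expr0n add0r expr1n sqrtr1.
by rewrite mul1r mulr2n mulrDl mul1r.
Qed.

Lemma xr_bz w z : \sum_j (xr w j)%:C%C * bz z j = \sum_(i : monoidx) amon i w * conjc (amon i z).
Proof.
rewrite -(pair_bigA _ (fun i (b : bool) => (if b then complex.Im (amon i w) else complex.Re (amon i w))%:C%C *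
  (if b then (0 +i* 1)%C * conjc (amon i z) else conjc (amon i z))))/=.
apply: eq_bigr => i _; rewrite big_bool/= mulrA -mulrDl; congr (_ * _).
case: (amon i w) => p q; apply/eqP; rewrite eq_complex/=; apply/andP; split; apply/eqP; ring.
Qed.

Lemma measurable_xr j : measurable_fun setT (xr ^~ j).
Proof.
case: j => i [] /=; [apply: measurable_fun_Im|apply: measurable_fun_Re]; exact: measurable_amon.
Qed.

(* Off the shells [omega] is [0], and [0 `^ 0 = 1]: harmless, as [amon] vanishes there. *)
Definition lacunary (x0 : R) (eps : {ffun monoidx * bool -> bool}) w : R[i] :=
  (omega N w `^ x0)%:C%C * riesz (xr w) eps.

Lemma measurable_lacunary x0 eps : measurable_fun setT (lacunary x0 eps).
Proof.
apply: measurable_cmul.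
  apply: measurable_fun_complex; last exact: measurable_cst.
  exact: (measurableT_comp (@measurable_powR R _) (measurable_omega N)).
apply: measurable_cprod => j; apply: measurable_fun_complex; first exact: measurable_cst.
by apply: measurable_funM => //; exact: measurable_xr.
Qed.

Lemma normc_lacunary x0 eps w : normc (lacunary x0 eps w) <= expR 1 * omega N w `^ x0.
Proof.
rewrite normcM normc_real ger0_norm ?powR_ge0// mulrC ler_wpM2r ?powR_ge0//.
exact/normc_riesz/xr_sqr_le.
Qed.

(** The point [z] enters only through the weights [bz z], so one family of test functions serves all
    points of all shells. *)
Lemma sum_lacunary x0 n w z : (n < N)%N -> inshell n z ->
  \sum_eps lacunary x0 eps w * rademacher (bz z) eps =
  (2 ^ #|{: monoidx * bool}|)%:R * (0 +i* 1)%C *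
    (((inshell n w)%:R * (1 - sqnorm w) `^ (- x0))%:C%C * hdot w z ^+ (2 ^ n)).
Proof.
move=> nN nz; under eq_bigr do rewrite -mulrA.
rewrite -mulr_sumr sum_riesz_rademacher xr_bz (amon_sum_shell _ nN nz).
rewrite mulrCA; congr (_ * _); rewrite mulrA; congr (_ * _).
have [nw|_] := boolP (inshell n w); last by rewrite mulr0 mul0r.
rewrite mulr1 mul1r (omega_shell nN nw) powRVl//.
by rewrite subr_ge0 ltW// (inshell_lt1 nw).
Qed.

End lacunary.

(** * Average size of the images of the lacunary functions *)

Section necessity.
Context {R : realType} (d : nat).
Local Opaque Gamma eGamma bcoef.
Local Notation mu := (ball_measure R d).
Implicit Types z w : d.-tuple R[i].

(** [expR 1] bounds the Riesz product; the rest is the Forelli-Rudin constant for [t = - x0] and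
    [alpha = d + 1 + c]. *)
Definition lacunary_const (x0 c : R) : R :=
  expR 1 * (Gamma (d%:R + 1) * Gamma (- x0 + 1) * Gamma (x0 + c) / Gamma ((d%:R + 1 + c) / 2) ^+ 2).

Lemma lacunary_const_gt0 (x0 c : R) : 0 <= x0 < 1 -> 0 < c -> 0 < lacunary_const x0 c.
Proof.
move=> /andP[x00 x01] c0; have d0 : 0 <= d%:R :> R by [].
have p1 : 0 < d%:R + 1 :> R by lra.
have p2 : 0 < - x0 + 1 by lra.
have p3 : 0 < x0 + c by lra.
have p4 : 0 < (d%:R + 1 + c) / 2 by lra.
have := Gamma_gt0 p1; have := Gamma_gt0 p2; have := Gamma_gt0 p3; have := Gamma_gt0 p4.
rewrite /lacunary_const; move: (Gamma _) (Gamma _) (Gamma _) (Gamma _) => a b e f a0 b0 e0 f0.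
by rewrite mulr_gt0 ?expR_gt0// divr_gt0 ?exprn_gt0// !mulr_gt0.
Qed.

Lemma lacunary_kernel_integral N (x0 c : R) eps z : 0 <= x0 < 1 -> 0 < c -> sqnorm z < 1 ->
  (\int[mu]_w (normc (lacunary (N := N) x0 eps w / cpow (1 - hdot z w) (d%:R + 1 + c)))%:E <=
   (lacunary_const x0 c * (1 - sqnorm z) `^ (- (x0 + c)))%:E)%E.
Proof.
move=> /andP[x00 x01] c0 z1.
have mk : measurable_fun setT (fun w => (1 - sqnorm w) `^ (- x0) * normc (1 - hdot z w) `^ (- (d%:R + 1 + c))).
  by apply: measurable_funM; [exact: measurable_weight|exact: measurable_kernel_norm].
have k0 w : 0 <= (1 - sqnorm w) `^ (- x0) * normc (1 - hdot z w) `^ (- (d%:R + 1 + c)).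
  by rewrite mulr_ge0 ?powR_ge0.
apply: (@le_trans _ _ (\int[mu]_w (expR 1 * ((1 - sqnorm w) `^ (- x0) * normc (1 - hdot z w) `^ (- (d%:R + 1 + c))))%:E)%E).
  apply: ae_ge0_le_integral => //.
  - by move=> w _; rewrite lee_fin normc_ge0.
  - apply/measurable_EFinP; apply: measurable_fun_normc; apply: measurable_Kop_integrand.
    exact: measurable_lacunary.
  - by move=> w _; rewrite lee_fin mulr_ge0 ?expR_ge0.
  - by apply/measurable_EFinP; exact: measurable_funM.
  have := @ae_cball R d; apply: filterS => w w1 _.
  rewrite lee_fin normcM normcV normc_cpow -powRN mulrA; apply: ler_wpM2r; first exact: powR_ge0.
  apply: le_trans (normc_lacunary _ _ _) _; apply: ler_wpM2l; first exact: expR_ge0.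
  have s0 : 0 <= 1 - sqnorm w by rewrite subr_ge0 ltW.
  rewrite -powRVl//; apply: ge0_ler_powR => //; rewrite ?nnegrE ?omega_ge0 ?invr_ge0//.
  exact: omega_le_inv.
rewrite integral_scale ?expR_ge0// /lacunary_const -mulrA EFinM.
apply: lee_wpmul2l; first by rewrite lee_fin expR_ge0.
have E : d%:R + 1 + c - (d%:R + 1) = c by ring.
have t1 : -1 < - x0 by rewrite ltrN2.
have t2 : - x0 < d%:R + 1 + c - (d%:R + 1) by rewrite E; lra.
have := forelli_rudin t1 t2 z1; rewrite E opprK [c + x0]addrC.
by have -> : - x0 - c = - (x0 + c) by ring.
Qed.

Lemma lacunary_cintegrable N (x0 c : R) eps z : 0 <= x0 < 1 -> 0 < c -> sqnorm z < 1 ->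
  cintegrable mu (fun w => lacunary (N := N) x0 eps w / cpow (1 - hdot z w) (d%:R + 1 + c)).
Proof.
move=> x001 c0 z1; split; first by apply: measurable_Kop_integrand; exact: measurable_lacunary.
by apply: le_lt_trans (lacunary_kernel_integral _ x001 c0 z1) _; rewrite ltry.
Qed.

Lemma Kop_lacunary N (x0 c : R) eps z : sqnorm z < 1 ->
  Kop (d%:R + 1 + c) (lacunary (N := N) x0 eps) z =
  cintegral mu (fun w => lacunary (N := N) x0 eps w / cpow (1 - hdot z w) (d%:R + 1 + c)).
Proof. by move=> z1; rewrite /Kop ifT// inE cballE. Qed.

(** The uniform upper bound [D] (Forelli-Rudin) and the correlation [A] with the signs (the Taylor
    coefficient of degree [2 ^ n]) are both constants times [(1 - |z|^2) ^ (- (x0 + c))]. Hence so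
    is the bound [A^2 / (2 D)] of [sum_normc_ge]. *)
Lemma sum_Kop_lacunary_ge N n (x0 c : R) z : (n < N)%N -> 0 <= x0 < 1 -> 0 < c -> x0 + c <= 1 -> inshell n z ->
  (2 ^ #|{: monoidx d N * bool}|)%:R *
    (kernel_low d c ^+ 2 / (2 * lacunary_const x0 c) * (1 - sqnorm z) `^ (- (x0 + c))) <=
  \sum_eps normc (Kop (d%:R + 1 + c) (lacunary (N := N) x0 eps) z).
Proof.
move=> nN x001 c0 xc1 nz; have z1 := inshell_lt1 nz; have /andP[x00 x01] := x001.
have d0 : 0 <= d%:R :> R by [].
have a0 : 0 < d%:R + 1 + c by lra.
pose h := (1 - sqnorm z) `^ (- (x0 + c)).
have h0 : 0 < h by rewrite powR_gt0// subr_gt0.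
have A0 := kernel_low_gt0 d (ltW c0); have D0 := lacunary_const_gt0 x001 c0.
set n2 := (2 ^ _)%N.
have n20 : 0 < n2%:R :> R by rewrite ltr0n expn_gt0.
pose K eps := Kop (d%:R + 1 + c) (lacunary (N := N) x0 eps) z.
have KD eps : normc (K eps) <= lacunary_const x0 c * h.
  rewrite /K Kop_lacunary// -lee_fin.
  have mf := measurable_Kop_integrand (d%:R + 1 + c) z (measurable_lacunary x0 eps).
  exact: le_trans (normc_cintegral_le _ mf) (lacunary_kernel_integral _ x001 c0 z1).
have -> : kernel_low d c ^+ 2 / (2 * lacunary_const x0 c) * h =
   (kernel_low d c * h) ^+ 2 / (2 * (lacunary_const x0 c * h)) by field; rewrite !gt_eqF.
apply: (@sum_normc_ge _ _ (bz z) K) => //.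
- exact: bz_sqr_le.
- exact: mulr_gt0.
- exact: mulr_gt0.
pose chi w : R := (inshell n w)%:R * (1 - sqnorm w) `^ (- x0).
pose g w : R[i] := (chi w)%:C%C * (conjc (hdot z w) ^+ (2 ^ n) * (cpow (1 - hdot z w) (d%:R + 1 + c))^-1).
have [iS eS] := cintegral_sum (index_enum {ffun monoidx d N * bool -> bool}) (rademacher (bz z))
  (fun eps => lacunary_cintegrable eps x001 c0 z1).
(* Summing over the signs inside the integral leaves only the degree [2 ^ n] monomial kernel on the
   shell of [z], times the kernel of the operator. *)
have SE : (fun w => \sum_eps rademacher (bz z) eps * (lacunary (N := N) x0 eps w / cpow (1 - hdot z w) (d%:R + 1 + c))) =
    (fun w => (n2%:R * (0 +i* 1)%C) * g w).
  apply/funext => w; under eq_bigr do rewrite mulrA [rademacher _ _ * _]mulrC.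
  by rewrite -mulr_suml (sum_lacunary _ _ nN nz) hdotC /g /chi !mulrA.
have i0 : n2%:R * (0 +i* 1)%C != 0 :> R[i].
  rewrite mulf_neq0//; first by rewrite pnatr_eq0 -lt0n expn_gt0.
  by rewrite eq_complex/= oner_eq0 andbF.
rewrite SE in iS eS.
have ig : cintegrable mu g.
  have := cintegrableZ (n2%:R * (0 +i* 1)%C)^-1 iS.
  by under eq_fun do rewrite mulKf//.
have -> : \sum_eps K eps * rademacher (bz z) eps = n2%:R * (0 +i* 1)%C * cintegral mu g.
  rewrite -(cintegralZ _ ig) eS; apply: eq_bigr => eps _.
  by rewrite mulrC /K Kop_lacunary.
have ni : normc (n2%:R * (0 +i* 1)%C : R[i]) = n2%:R.
  rewrite normcM -(rmorph_nat (real_complex R)) normc_real ger0_norm//.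
  by rewrite /= expr0n add0r expr1n sqrtr1 mulr1.
rewrite normcM ni ler_pM2l//.
apply: le_trans (le_trans (ler_norm _) (normc_le_Re _)).
rewrite -lee_fin; apply: le_trans (shell_kernel_ge x00 (ltW c0) xc1 nz) _.
apply: (@Re_kernel_coef_ge _ _ _ _ _ chi (4 * (2 ^ n)%:R `^ x0)) => //.
- by apply: measurable_funM; [exact: measurable_inshell|exact: measurable_weight].
- move=> w; rewrite /chi mulr_ge0 ?powR_ge0//=.
  have [nw|_] := boolP (inshell n w); last by rewrite mul0r mulr_ge0 ?powR_ge0.
  by rewrite mul1r; apply: shell_weight_le => //; rewrite x00 ltW.
- move=> w w1; rewrite /chi; suff /negbTE -> : ~~ inshell n w by rewrite mul0r.
  by apply: contra w1; exact: inshell_lt1.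
- by move=> r w r1; rewrite /chi inshell_rotation// sqnorm_scale r1 expr1n mul1r.
Qed.

End necessity.

(** * Boundedness forces the gap between the exponents *)

Section gap.
Context {R : realType} (d : nat).
Local Opaque Gamma eGamma bcoef.
Local Notation mu := (ball_measure R d).

(* The weight [omega `^ x0] is critical: both [omega `^ x0] in [L^(1/x0)] and the lower bound
   [(1 - |z|^2) `^ (- (x0 + c))] in [L^(1/(x0 + c))] have the mass of [omega] as their norm to the
   power [1/x0], resp. [1/(x0 + c)]. *)
Lemma lacunary_mass_le (p q : \bar R) (c x0 C : R) N : (1 <= d)%N -> 0 < c -> (1 <= p)%E -> (1 <= q)%E ->
  0 <= x0 -> x0 <= recip p -> recip q <= x0 + c -> x0 + c <= 1 -> 0 < C ->
  (forall f, cLfun mu p f -> cLfun mu q (Kop (d%:R + 1 + c) f) /\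
    (cLnorm mu q (Kop (d%:R + 1 + c) f) <= C%:E * cLnorm mu p f)%E) ->
  kernel_low d c ^+ 2 / (2 * lacunary_const d x0 c) * (N.+1%:R * 2^-1 ^+ d) `^ c <= C * expR 1.
Proof.
move=> d1 c0 p1 q1 x00 x0p qy y01 C0 bd.
have x001 : 0 <= x0 < 1 by rewrite x00; lra.
have /andP[yq0 yq1] := recip_ge0 q1.
have y00 : 0 <= x0 + c by rewrite addr_ge0// ltW.
have A0 := kernel_low_gt0 d (ltW c0); have D0 := lacunary_const_gt0 d x001 c0.
have kap0 : 0 < kernel_low d c ^+ 2 / (2 * lacunary_const d x0 c).
  by rewrite divr_gt0 ?exprn_gt0// mulr_gt0.
have low n z nN nz := @sum_Kop_lacunary_ge R d N.+1 n x0 c z nN x001 c0 y01 nz.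
move: (_ / (2 * _)) kap0 low => kap kap0 low.
have Lge := @omega_integral_ge R d N.+1 d1.
have Llt := @omega_integral_lty R d N.+1.
have Ifin : (\int[mu]_w (omega N.+1 w)%:E)%E \is a fin_num.
  by rewrite ge0_fin_numE//; apply: integral_ge0 => w _; rewrite lee_fin omega_ge0.
move: Lge; rewrite -(fineK Ifin) lee_fin; set L := fine _ => Lge.
have N0 : 0 < N.+1%:R * 2^-1 ^+ d :> R by rewrite mulr_gt0 ?half_pow_gt0.
have L0 : 0 < L by exact: lt_le_trans Lge.
(* One density plays both roles: [v ^ x0] bounds the test functions, and [v ^ (1 - (x0 + c))] is
   what their images are paired with. *)
pose v (w : d.-tuple R[i]) : R := L^-1 * omega N.+1 w.
have LV0 : 0 <= L^-1 by rewrite invr_ge0 ltW.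
have mv : measurable_fun setT v by apply: measurable_funM => //; exact: measurable_omega.
have v0 w : 0 <= v w by rewrite mulr_ge0// omega_ge0.
have vI1 : (\int[mu]_w (v w)%:E = 1)%E.
  rewrite integral_scale; [|exact: measurable_omega|by move=> w; exact: omega_ge0|exact: LV0].
  by rewrite -(fineK Ifin) -/L -EFinM mulVf// gt_eqF.
have vI : (\int[mu]_w (v w)%:E <= 1)%E by rewrite vI1.
pose J := (monoidx d N.+1 * bool)%type.
pose f (eps : {ffun J -> bool}) := lacunary (R := R) x0 eps.
pose M := expR 1 * L `^ x0.
have M0 : 0 < M by rewrite mulr_gt0 ?expR_gt0// powR_gt0.
have omv w : omega N.+1 w = L * v w by rewrite /v mulrA divff ?mul1r// gt_eqF.
have fM eps w : normc (f eps w) <= M * v w `^ x0.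
  apply: le_trans (normc_lacunary _ _ _) _; rewrite omv powRM ?(ltW L0)//.
  by rewrite mulrA.
have mf eps : measurable_fun setT (f eps) by exact: measurable_lacunary.
have x0p' : 0 <= x0 <= recip p by rewrite x00.
have fp eps : (cLnorm mu p (f eps) <= M%:E)%E.
  exact: (cLnorm_le_of_density (mu := @ball_prob R d) p1 (mf eps) mv v0 vI x0p' (ltW M0) (fM eps)).
have CM0 : 0 < C * M by exact: mulr_gt0.
have mT0 : (0 < mu setT)%E by rewrite ball_measure_setT.
have mT1 : (mu setT <= 1)%E by rewrite ball_measure_setT.
have Kbd eps : measurable_fun setT (Kop (d%:R + 1 + c) (f eps)) /\
  (\int[mu]_z (normc (Kop (d%:R + 1 + c) (f eps) z) * v z `^ (1 - (x0 + c)))%:E <= (C * M)%:E)%E.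
  have fL : cLfun mu p (f eps).
    by split; [exact: mf|apply: le_lt_trans (fp eps) _; rewrite ltry].
  have [[mK _] Kq] := bd _ fL; split => //.
  have KCM : (cLnorm mu q (Kop (d%:R + 1 + c) (f eps)) <= (C * M)%:E)%E.
    apply: le_trans Kq _; rewrite EFinM; apply: lee_wpmul2l => //.
    by rewrite lee_fin ltW.
  have [u [mu_ u0 uI Ku]] := cLnorm_le_density q1 mT0 CM0 mK KCM mT1.
  have yq : 0 <= recip q <= x0 + c by rewrite yq0.
  exact: (integral_density_le (mu := @ball_prob R d) (measurable_fun_normc mK) mu_ mv
    (fun z => normc_ge0 _) u0 v0 (ltW CM0) yq y01 uI vI Ku).
have n20 : 0 < (2 ^ #|{: J}|)%:R :> R by rewrite ltr0n expn_gt0.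
have mKv eps : measurable_fun setT (fun z => normc (Kop (d%:R + 1 + c) (f eps) z) * v z `^ (1 - (x0 + c))).
  apply: measurable_funM; first by apply: measurable_fun_normc; exact: (Kbd eps).1.
  exact: (measurableT_comp (@measurable_powR R _) mv).
have Kv0 eps z : 0 <= normc (Kop (d%:R + 1 + c) (f eps) z) * v z `^ (1 - (x0 + c)).
  by rewrite mulr_ge0 ?powR_ge0 ?normc_ge0.
have up : (\int[mu]_z (\sum_eps normc (Kop (d%:R + 1 + c) (f eps) z) * v z `^ (1 - (x0 + c)))%:E <=
    ((2 ^ #|{: J}|)%:R * (C * M))%:E)%E.
  under eq_integral do rewrite -sumEFin.
  rewrite ge0_integral_sum; last 3 first.
  - exact: measurableT.
  - by move=> eps; apply/measurable_EFinP; exact: mKv.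
  - by move=> eps z _; rewrite lee_fin.
  have -> : (2 ^ #|{: J}|)%:R * (C * M) = \sum_(eps : {ffun J -> bool}) C * M.
    by rewrite sumr_const card_ffun card_bool mulr_natl.
  by rewrite -sumEFin; apply: lee_sum => eps _; exact: (Kbd eps).2.
pose W := (2 ^ #|{: J}|)%:R * kap * L `^ (x0 + c).
have W0 : 0 <= W by rewrite !mulr_ge0 ?powR_ge0// ltW.
(* On the shells the lower bound for the images is a multiple of [v ^ (x0 + c)], so the exponents
   add up to 1; off the shells the left side is 0. *)
have lowz z : W * v z <= \sum_eps normc (Kop (d%:R + 1 + c) (f eps) z) * v z `^ (1 - (x0 + c)).
  have [[n nN nz]|oz] := omega_case N.+1 z; last first.
    by rewrite {1}/v oz !mulr0 sumr_ge0.
  have s0 : 0 <= 1 - sqnorm z by rewrite subr_ge0 ltW// (inshell_lt1 nz).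
  have vz : 0 < v z.
    by rewrite mulr_gt0 ?invr_gt0// (omega_shell nN nz) invr_gt0 subr_gt0 (inshell_lt1 nz).
  have := low n z nN nz.
  rewrite -powRVl// -(omega_shell nN nz) omv powRM ?(ltW L0)// => /(ler_wpM2r (powR_ge0 (v z) (1 - (x0 + c)))).
  rewrite mulr_suml; apply: le_trans.
  rewrite le_eqVlt; apply/orP; left; apply/eqP.
  have vzE : v z `^ (x0 + c) * v z `^ (1 - (x0 + c)) = v z.
    by rewrite -powRD ?(lt0r_neq0 vz) ?implybT// addrC subrK powRr1// ltW.
  have alg (n2 k l a b : R) : n2 * k * l * (a * b) = n2 * (k * (l * a)) * b by ring.
  by rewrite -{1}vzE; exact: alg.
have WM : W <= (2 ^ #|{: J}|)%:R * (C * M).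
  rewrite -lee_fin; apply: le_trans up; rewrite -[leLHS]mule1 -vI1 -integral_scale//.
  apply: ge0_le_integral => //.
  - by move=> z _; rewrite lee_fin mulr_ge0.
  - by apply/measurable_EFinP; exact: measurable_funM.
  - by apply/measurable_EFinP; apply: measurable_sum => eps; exact: mKv.
  - by move=> z _; rewrite lee_fin.
(* The images carry [L ^ (x0 + c)] and the test functions only [L ^ x0]; the surplus [L ^ c] is what
   grows with [N]. *)
have Lc : L `^ (x0 + c) = L `^ x0 * L `^ c by rewrite powRD ?(lt0r_neq0 L0) ?implybT.
have Lx0 : 0 < L `^ x0 by exact: powR_gt0.
move: WM; rewrite /W -mulrA ler_pM2l// Lc /M.
have -> : kap * (L `^ x0 * L `^ c) = L `^ x0 * (kap * L `^ c) by ring.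
have -> : C * (expR 1 * L `^ x0) = L `^ x0 * (C * expR 1) by ring.
rewrite ler_pM2l//; apply: le_trans; apply: ler_wpM2l; first exact: ltW.
by apply: (ge0_ler_powR (ltW c0)); rewrite ?nnegrE ?(ltW L0) ?(ltW N0).
Qed.

(** The upper bound on [alpha] gives [c < 1], which makes room for a weight exponent [x0 >= 0] with
    [x0 + c <= 1]. *)
Lemma bounded_gap (alpha : R) (p q : \bar R) : (1 <= d)%N -> d%:R + 1 < alpha < d%:R + 2 ->
  (1 <= p)%E -> (1 <= q)%E -> bounded_operator mu p q (Kop alpha) ->
  alpha - (d%:R + 1) < recip q - recip p.
Proof.
move=> d1 /andP[da1 da2] p1 q1 [C0 bd]; rewrite ltNge; apply/negP => gap.
move cE : (alpha - (d%:R + 1)) gap => c gap.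
have aE : alpha = d%:R + 1 + c by rewrite -cE; ring.
have c0 : 0 < c by rewrite -cE subr_gt0.
have c1 : c < 1 by rewrite -cE; lra.
have /andP[x0 x1] := recip_ge0 p1; have /andP[y0 y1] := recip_ge0 q1.
(* [m] is the largest admissible value of [x0 + c]. The negated gap and [recip q <= 1] give
   [recip q <= m], and [c <= m] makes [x0 = m - c] nonnegative. *)
pose m := Num.min 1 (recip p + c).
have m1 : m <= 1 by rewrite ge_min lexx.
have mp : m <= recip p + c by rewrite ge_min lexx orbT.
have mc : c <= m by rewrite le_min (ltW c1) lerDr.
have qm : recip q <= m by rewrite le_min y1; lra.
(* The bound in [bounded_operator] may be nonpositive; enlarging it makes it a usable positive
   constant. *)
pose C := Num.max 1 C0.
have C1 : 1 <= C by rewrite le_max lexx.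
have C_gt0 : 0 < C by exact: lt_le_trans C1.
have bdC f : cLfun mu p f -> cLfun mu q (Kop (d%:R + 1 + c) f) /\
    (cLnorm mu q (Kop (d%:R + 1 + c) f) <= C%:E * cLnorm mu p f)%E.
  move=> fp; rewrite -aE; have [Kq Kle] := bd f fp; split => //; apply: le_trans Kle _.
  by apply: lee_wpmul2r; [exact: Lnorm_ge0|rewrite lee_fin le_max lexx orbT].
have x00 : 0 <= m - c by rewrite subr_ge0.
have xp : m - c <= recip p by lra.
have mcE : m - c + c = m by rewrite subrK.
have H N : kernel_low d c ^+ 2 / (2 * lacunary_const d (m - c) c) * (N.+1%:R * 2^-1 ^+ d) `^ c <= C * expR 1.
  by apply: (@lacunary_mass_le p q) => //; rewrite mcE.
have x01 : 0 <= m - c < 1 by rewrite x00; lra.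
have A0 := kernel_low_gt0 d (ltW c0); have D0 := lacunary_const_gt0 d x01 c0.
have kap0 : 0 < kernel_low d c ^+ 2 / (2 * lacunary_const d (m - c) c).
  by rewrite divr_gt0 ?exprn_gt0// mulr_gt0.
move: (_ / (2 * _)) kap0 H => kap kap0 H.
pose B := (C * expR 1) / kap.
have B0 : 0 < B by rewrite divr_gt0// mulr_gt0// expR_gt0.
have HB N : (N.+1%:R * 2^-1 ^+ d) `^ c <= B by rewrite /B ler_pdivlMr// mulrC.
have hd0 := @half_pow_gt0 R d.
(* Chosen so that [((N+1) * 2 ^ -d) ^ c] exceeds the bound [B], which does not depend on [N]. *)
pose N := Num.bound (B `^ c^-1 / 2^-1 ^+ d).
have BN : B `^ c^-1 < N.+1%:R * 2^-1 ^+ d.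
  rewrite -ltr_pdivrMr//; apply: (@lt_le_trans _ _ N%:R); last by rewrite ler_nat.
  by apply: archi_boundP; rewrite divr_ge0 ?powR_ge0// ltW.
have := HB N; rewrite leNgt => /negP; apply.
have BE : B = (B `^ c^-1) `^ c by rewrite -powRrM mulVf ?gt_eqF// powRr1// ltW.
by rewrite {1}BE; apply: gt0_ltr_powR => //; rewrite ?nnegrE ?powR_ge0//.
Qed.

End gap.

Theorem proposition6p1 (R : realType) (d : nat) (alpha : R) (p q : \bar R)
  (hd : (1 <= d)%N)
  (halpha : d%:R + 1 < alpha < d%:R + 2)
  (hp : (1 <= p)%E) (hq : (1 <= q)%E)
  (hbounded : bounded_operator (ball_measure R d) p q (Kop alpha)) :
  (operator_norm (ball_measure R d) p q (Kop alpha) <=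
    ((Gamma (d%:R + 1) `^ (1 + recip q - recip p) *
      Gamma (alpha - (d%:R + 1)) *
      Gamma (1 / (recip q - recip p) * (d%:R + 1 - alpha) + 1)
        `^ (recip q - recip p)) /
     (Gamma (alpha / 2) ^+ 2 *
      Gamma (1 / (recip q - recip p) * (d%:R + 1 - alpha) + d%:R + 1)
        `^ (recip q - recip p)))%:E)%E.
Proof.
have /andP[da _] := halpha.
exact: operator_norm_le da hp hq (bounded_gap hd halpha hp hq hbounded) hbounded.
Qed.
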